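(* Let $\mathcal{H}$ be a complex separable Hilbert space with $\dim\mathcal{H}\ge 3$. Let $T:\mathcal{B}(\mathcal{H})\to\mathcal{B}(\mathcal{H})$ be a continuous bijective linear map. Then the following are equivalent. (1) There is a bijection $\psi:\operatorname{Conj}(\mathcal{H})\to\operatorname{Conj}(\mathcal{H})$ preserving commutativity, which satisfies $T(\mathcal{S}_C)=\mathcal{S}_{\psi(C)}$ for every $C\in\operatorname{Conj}(\mathcal{H})$. (2) There is a bijection $\varphi:\mathcal{E}(\mathcal{H})\to\mathcal{E}(\mathcal{H})$, which satisfies $T(\mathcal{D}_{\{e_n\}})=\mathcal{D}_{\varphi(\{e_n\})}$ for every $\{e_n\}\in\mathcal{E}(\mathcal{H})$. (3) There exist $c\in\mathbb{C}\setminus\{0\}$, a bounded linear functional $f$ on $\mathcal{B}(\mathcal{H})$, and a unitary or anti-unitary $U\in\mathcal{B}(\mathcal{H})$ such that \[T(A)=c\,UAU^{*}+f(A)I,\quad A\in\mathcal{B}(\mathcal{H}).\]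
   Context: $\mathcal{B}(\mathcal{H})$ is the algebra of all bounded linear operators on $\mathcal{H}$; $I$ is the identity operator. A conjugation on $\mathcal{H}$ is an antilinear map $C:\mathcal{H}\to\mathcal{H}$ that is invertible with $C^{-1}=C$ and satisfies $\langle Cx,Cy\rangle=\langle y,x\rangle$ for all $x,y\in\mathcal{H}$; $\operatorname{Conj}(\mathcal{H})$ is the set of all conjugations on $\mathcal{H}$. For $C\in\operatorname{Conj}(\mathcal{H})$, $\mathcal{S}_C=\{A\in\mathcal{B}(\mathcal{H}) : CAC=A^*\}$ is the set of $C$-symmetric operators. A bijection $\psi:\operatorname{Conj}(\mathcal{H})\to\operatorname{Conj}(\mathcal{H})$ is said to preserve commutativity if, for all $C_1,C_2\in\operatorname{Conj}(\mathcal{H})$, $C_1C_2=C_2C_1$ if and only if $\psi(C_1)\psi(C_2)=\psi(C_2)\psi(C_1)$. $\mathcal{E}(\mathcal{H})$ is the set of all orthonormal bases of $\mathcal{H}$, each regarded as an ordered sequence (so reordering a basis gives a different element). For $\{e_n\}\in\mathcal{E}(\mathcal{H})$, $\mathcal{D}_{\{e_n\}}$ is the set of all operators in $\mathcal{B}(\mathcal{H})$ having a diagonal matrix representation with respect to $\{e_n\}$. An anti-unitary is a bijective antilinear map $U:\mathcal{H}\to\mathcal{H}$ with $\langle Ux,Uy\rangle=\langle y,x\rangle$ for all $x,y\in\mathcal{H}$, for which $U^*=U^{-1}$; the notation $U\in\mathcal{B}(\mathcal{H})$ is used loosely to include such maps.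
   Formalization: In (3), for anti-unitary U the formula is T(A) = c U A* U* + f(A) I instead of c U A U* + f(A) I: the printed one is antilinear in A and never holds for linear T, and T(A) = J A* J (J a conjugation) satisfies (1) and (2) but not the printed (3). *)

(* Defs.v *)
From HB Require Import structures.
From mathcomp Require Import all_boot all_order all_algebra.
From mathcomp Require Import complex.
From mathcomp Require Import all_classical all_reals all_analysis.
Set Implicit Arguments.
Unset Strict Implicit.
Unset Printing Implicit Defensive.
Import Order.TTheory GRing.Theory Num.Theory.
Import numFieldNormedType.Exports.
Local Open Scope classical_set_scope.
Local Open Scope ring_scope.

(* {dot H for conj} is linear in its first and antilinear in its second argument *)
HB.mixin Record CompleteNormedModule_isHilbert (R : realType) H
    & CompleteNormedModule R[i] H := {
  inner : {dot H for (@Num.conj R[i])};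
  inner_normE : forall x : H, `|x| ^+ 2 = inner x x
}.
#[short(type="hilbertType")]
HB.structure Definition Hilbert (R : realType) :=
  {H of CompleteNormedModule_isHilbert R H & CompleteNormedModule R[i] H}.


Section BoundedOperators.
Variables (R : realType) (H : hilbertType R).

Definition bounded_op : {pred H -> H} :=
  fun A => `[< linear A /\ continuous A >].

Lemma bounded_op_submod : submod_closed bounded_op.
Proof.
split.
  apply/asboolP; split; last by move=> x; exact: cvg_cst.
  by move=> a x y /=; rewrite scaler0 addr0.
move=> a A B /asboolP[linA cA] /asboolP[linB cB]; apply/asboolP; split.
  move=> b x y; rewrite !fctE linA linB !scalerDr !scalerA.
  by rewrite addrACA mulrC.
move=> x; apply: cvgD; last exact: cB.
by apply: cvgZl_tmp; exact: cA.
Qed.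
HB.instance Definition _ :=
  GRing.isSubmodClosed.Build R[i] (H -> H) bounded_op bounded_op_submod.

Record bop := Bop { bop_fun :> H -> H; _ : bop_fun \in bounded_op }.
HB.instance Definition _ := [isSub for bop_fun].
HB.instance Definition _ := [Choice of bop by <:].
HB.instance Definition _ := [SubChoice_isSubLmodule of bop by <:].

Lemma bop_linear (A : bop) : linear A.
Proof. by case: A => A /= /asboolP[]. Qed.
HB.instance Definition _ (A : bop) :=
  GRing.isLinear.Build R[i] H H *:%R A (bop_linear A).

Lemma bop_continuous (A : bop) : continuous A.
Proof. by case: A => A /= /asboolP[]. Qed.

End BoundedOperators.

Section OperatorNorm.
Variables (R : realType) (H : hilbertType R).

Definition opnorm (A : bop H) : R[i] :=
  (sup [set complex.Re `|A x| | x in [set x : H | `|x| <= 1]])%:C%C.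

Lemma Re_norm (V : normedModType R[i]) (x : V) : (complex.Re `|x|)%:C%C = `|x|.
Proof. by rewrite RRe_real// normr_real. Qed.

Lemma le_Re_norm (V : normedModType R[i]) (x : V) (r : R) :
  (complex.Re `|x| <= r) = (`|x| <= r%:C%C).
Proof. by rewrite -[in RHS]Re_norm lecR. Qed.

Lemma opnorm_has_sup (A : bop H) :
  has_sup [set complex.Re `|A x| | x in [set x : H | `|x| <= 1]].
Proof.
split; first by exists (complex.Re `|A 0|), 0 => //=; rewrite normr0.
have /linear_bounded_continuous/linear_boundedP := @bop_continuous _ _ A.
move=> /pinfty_ex_gt0[r r0 Ar]; exists (complex.Re r) => _ [x /= x1 <-].
rewrite le_Re_norm RRe_real ?gtr0_real//.
by rewrite (le_trans (Ar x))// ler_piMr// ltW.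
Qed.

Lemma le_opnorm1 (A : bop H) x : `|x| <= 1 -> `|A x| <= opnorm A.
Proof.
move=> x1; rewrite -le_Re_norm; apply: ub_le_sup; last by exists x.
by have [] := opnorm_has_sup A.
Qed.

Lemma opnorm_le (A : bop H) (r : R[i]) : r \is Num.real ->
  (forall x, `|x| <= 1 -> `|A x| <= r) -> opnorm A <= r.
Proof.
move=> rr Ar; rewrite -(RRe_real rr) lecR; apply: ge_sup.
  by have [] := opnorm_has_sup A.
by move=> _ [x /= x1 <-]; rewrite le_Re_norm RRe_real//; exact: Ar.
Qed.

Lemma opnorm_real (A : bop H) : opnorm A \is Num.real.
Proof. by rewrite complex_real. Qed.

Lemma opnormD (A B : bop H) : opnorm (A + B) <= opnorm A + opnorm B.
Proof.
apply: opnorm_le => [|x x1]; first by rewrite rpredD ?opnorm_real.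
by rewrite (le_trans (ler_normD _ _))// lerD ?le_opnorm1.
Qed.

Lemma opnormZ_le (l : R[i]) (A : bop H) : opnorm (l *: A) <= `|l| * opnorm A.
Proof.
apply: opnorm_le => [|x x1]; first by rewrite rpredM ?normr_real ?opnorm_real.
by rewrite [X in `|X|](_ : _ = l *: A x)// normrZ ler_wpM2l ?le_opnorm1.
Qed.

Lemma opnorm0_eq0 (A : bop H) : opnorm A = 0 -> A = 0.
Proof.
move=> A0; apply/val_inj/funext => x /=; have [->|x0] := eqVneq x 0.
  by rewrite linear0.
have: `|A (`|x|^-1 *: x)| <= 0.
  by rewrite -A0 le_opnorm1// normrZ normfV normr_id mulVf ?normr_eq0.
by rewrite normr_le0 linearZ/= scaler_eq0 invr_eq0 normr_eq0 (negbTE x0) => /eqP.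
Qed.

Lemma opnormZ (l : R[i]) (A : bop H) : opnorm (l *: A) = `|l| * opnorm A.
Proof.
apply/le_anti; rewrite opnormZ_le/=; have [->|l0] := eqVneq l 0.
  rewrite normr0 mul0r (le_trans _ (le_opnorm1 (x := 0) _ _))//.
  by rewrite normr0.
rewrite -ler_pdivlMl ?normr_gt0// -normfV.
by rewrite -{1}[A]scale1r -(mulVf l0) -scalerA opnormZ_le.
Qed.

HB.instance Definition _ :=
  @Lmodule_isNormed.Build R[i] (bop H) opnorm opnormD opnormZ opnorm0_eq0.

End OperatorNorm.

Section HilbertNotions.
Variables (R : realType) (H : hilbertType R).

(* Its existence is the Riesz representation theorem, its uniqueness follows
   from the nondegeneracy of the inner product: the default 0 is never used. *)
Definition adjoint (A : bop H) : bop H :=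
  xget 0 [set B : bop H | forall x y, inner (A x) y = inner x (B y)].

Definition unitary_op (U : bop H) :=
  adjoint U \o U = id /\ U \o adjoint U = id.

Definition antilinear (U : H -> H) := linear_for (Num.conj \; *:%R) U.

(* V is the inverse of U, which is the adjoint U^* of the antilinear map U *)
Definition antiunitary (U V : H -> H) :=
  [/\ antilinear U, cancel U V, cancel V U &
      forall x y, inner (U x) (U y) = inner y x].

Record conjugation := Conjugation {
  conj_fun :> H -> H;
  _ : antilinear conj_fun;
  _ : involutive conj_fun;
  _ : forall x y, inner (conj_fun x) (conj_fun y) = inner y x }.

Definition csymmetric_op (C : conjugation) : set (bop H) :=
  [set A : bop H | C \o A \o C = adjoint A :> (H -> H)].

Definition preserves_commutativity (psi : conjugation -> conjugation) :=
  forall C1 C2 : conjugation,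
    C1 \o C2 = C2 \o C1 <-> psi C1 \o psi C2 = psi C2 \o psi C1.

Definition linspan (I : choiceType) (e : I -> H) : set H :=
  [set x | exists (s : seq I) (k : I -> R[i]), x = \sum_(i <- s) k i *: e i].

(* Index set of an ordered basis: {0, ..., n - 1} for a finite sequence, all of nat for an infinite one *)
Definition seq_index (d : option nat) : countType :=
  if d is Some n then 'I_n else nat.

Record onbasis := Onbasis {
  onb_length : option nat;
  onb_vec :> seq_index onb_length -> H;
  _ : forall i j, inner (onb_vec i) (onb_vec j) = (i == j)%:R;
  _ : dense (linspan onb_vec) }.

Definition diagonal_op (e : onbasis) : set (bop H) :=
  [set A : bop H | forall i j, i != j -> inner (A (e j)) (e i) = 0].

Definition separable := exists2 D : set H, countable D & dense D.

Definition dim_ge (n : nat) := exists v : 'I_n -> H,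
  forall k : 'I_n -> R[i], \sum_i k i *: v i = 0 -> forall i, k i = 0.

End HilbertNotions.
Arguments separable {R} H.
Arguments dim_ge {R} H n.

(* Main.v *)
Require Import Defs.
From HB Require Import structures.
From mathcomp Require Import all_boot all_order all_algebra.
From mathcomp Require Import complex.
From mathcomp Require Import all_classical all_reals all_analysis.
From mathcomp Require Import ring.
Set Implicit Arguments.
Unset Strict Implicit.
Unset Printing Implicit Defensive.
Import Order.TTheory GRing.Theory Num.Theory.
Import numFieldNormedType.Exports.
Local Open Scope classical_set_scope.
Local Open Scope ring_scope.

(** Let S_J be the space of J-symmetric operators of a conjugation J and D_e the
    algebra of operators diagonal in a basis e; let P_x denote the projection
    onto the line of a unit vector x, written ketbra x x below.

    That an operator of the form A |-> c U A U^* + f(A) I permutes the spaces S_J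
    and the algebras D_e is a direct verification, J going to U J U^* and e to
    U e. In the antiunitary case the adjoint of A takes the place of A. For the
    converse, both kinds of preservers share three properties (compatible): T I
    is a scalar, T maps each projection P to a combination a I + b Q with Q a
    projection, and T A commutes with T P when A and the projection P are
    diagonal in the same basis. The second property comes from the fact that an
    operator which is diagonal in all bases in which P is diagonal is a
    combination of I and P (in_diag_span): it applies to the preimage of (T P)^2,
    so that the normal operator T P satisfies a quadratic equation. For preservers of the S_J one
    uses that D_e is the intersection of the S_J with J fixing the lines of e,
    and that psi and its inverse map commuting conjugations to commuting ones.

    Since the inverse of T has the same three properties, T P_x = a I + b Q with Q
    again, up to replacing it by I - Q, a projection onto a line
    (rank_one_image): projections of rank and corank at least two differ from
    P_x in that they generate four atoms with some projection commuting with
    them. Orthogonal lines go to orthogonal lines, and as H has dimension at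
    least three, b does not depend on x. So T induces a bijection of the lines
    which moreover comes from a linear map on operators. Comparing T on the
    rank-one operators of e0 + t x for all complex t shows that x |-> T (ketbra x e0)
    produces either a linear or an antilinear isometry, and this is the unitary
    or antiunitary map U (rank_one_plane, wigner).

    After composition with the inverse of A |-> b U A U^* the map T fixes every
    P_x up to scalars. Commutation then forces it to fix diagonal operators up to
    scalars (diag_linear_identity). Finite combinations of diagonal operators are
    all operators: a self-adjoint operator is block tridiagonal with finite blocks
    along a suitable filtration of H, and the symmetry with sign pattern + + - -
    on the blocks splits it into two block diagonal self-adjoint operators
    (selfadjoint_sum_diagonal). This replaces the spectral theorem.

    The Hilbert space facts needed on the way rest on two results: partial sums
    of orthogonal series with bounded norms converge (orthogonal_series_cvg), and
    orthonormal bases can be chosen among vectors with a given property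
    (onbasis_in), by Zorn's lemma. *)

Local Notation "'[ x , y ]" := (inner x y) : ring_scope.

(** * Inner products *)

Section InnerProduct.
Variables (R : realType) (H : hilbertType R).
Local Notation C := R[i].
Implicit Types (x y z : H) (a : C).

Lemma innerC x y : '[x, y] = '[y, x]^*.
Proof. by rewrite (hermC (inner : {dot H for (@Num.conj C)})) expr0 mul1r. Qed.

Lemma innerDl x y z : '[x + y, z] = '[x, z] + '[y, z].
Proof. exact: linearDl. Qed.

Lemma innerDr x y z : '[x, y + z] = '[x, y] + '[x, z].
Proof. exact: linearDr. Qed.

Lemma innerZl a x y : '[a *: x, y] = a * '[x, y].
Proof. exact: linearZl_LR. Qed.

Lemma innerZr a x y : '[x, a *: y] = a^* * '[x, y].
Proof. by rewrite innerC innerZl rmorphM /= -innerC. Qed.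

Lemma innerNl x y : '[- x, y] = - '[x, y].
Proof. by rewrite -scaleN1r innerZl mulN1r. Qed.

Lemma innerNr x y : '[x, - y] = - '[x, y].
Proof. by rewrite innerC innerNl rmorphN /= -innerC. Qed.

Lemma innerBl x y z : '[x - y, z] = '[x, z] - '[y, z].
Proof. by rewrite innerDl innerNl. Qed.

Lemma innerBr x y z : '[x, y - z] = '[x, y] - '[x, z].
Proof. by rewrite innerDr innerNr. Qed.

Lemma inner0l y : '[0, y] = 0.
Proof. by rewrite -(scale0r 0) innerZl mul0r. Qed.

Lemma inner0r y : '[y, 0] = 0.
Proof. by rewrite innerC inner0l rmorph0. Qed.

Lemma inner_suml (I : Type) (s : seq I) (P : pred I) (F : I -> H) y :
  '[\sum_(i <- s | P i) F i, y] = \sum_(i <- s | P i) '[F i, y].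
Proof.
by apply: (big_morph (fun x => '[x, y])) => [u v|]; rewrite (innerDl, inner0l).
Qed.

Lemma inner_sumr (I : Type) (s : seq I) (P : pred I) (F : I -> H) y :
  '[y, \sum_(i <- s | P i) F i] = \sum_(i <- s | P i) '[y, F i].
Proof.
by apply: (big_morph (fun x => '[y, x])) => [u v|]; rewrite (innerDr, inner0r).
Qed.

Lemma inner_eq0C x y : '[x, y] = 0 -> '[y, x] = 0.
Proof. by move=> xy; rewrite innerC xy rmorph0. Qed.

Lemma inner_ge0 x : 0 <= '[x, x].
Proof. by rewrite -inner_normE exprn_ge0. Qed.

Lemma inner_eq0 x : '[x, x] = 0 -> x = 0.
Proof. by rewrite -inner_normE => /eqP; rewrite sqrf_eq0 normr_eq0 => /eqP. Qed.

Lemma inner_ext x y : (forall z, '[x, z] = '[y, z]) -> x = y.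
Proof.
by move=> xy; apply/eqP; rewrite -subr_eq0; apply/eqP/inner_eq0; rewrite innerBl !xy subrr.
Qed.

Lemma inner_extr x y : (forall z, '[z, x] = '[z, y]) -> x = y.
Proof. by move=> xy; apply: inner_ext => z; rewrite innerC xy -innerC. Qed.

Lemma inner1_norm x : '[x, x] = 1 <-> `|x| = 1.
Proof.
rewrite -inner_normE; split => [x1|->]; last by rewrite expr1n.
by apply/eqP; rewrite -(@eqrXn2 _ 2)// x1 expr1n.
Qed.

Lemma inner1_neq0 x : '[x, x] = 1 -> x != 0.
Proof.
by move=> x1; apply/eqP => x0; move: x1; rewrite x0 inner0l => /eqP; rewrite eq_sym oner_eq0.
Qed.

Lemma pythagoras x y : '[x, y] = 0 -> '[x + y, x + y] = '[x, x] + '[y, y].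
Proof.
by move=> xy; rewrite innerDl !innerDr xy (inner_eq0C xy) addr0 add0r.
Qed.

Lemma cauchy_schwarz x y : `|'[x, y]| <= `|x| * `|y|.
Proof.
have [->|y0] := eqVneq y 0; first by rewrite inner0r !normr0 mulr0.
have yy0 : 0 < '[y, y] by rewrite lt0r inner_ge0 andbT; apply/eqP => /inner_eq0 /eqP; exact/negP.
have yyr : '[y, y]^* = '[y, y] by rewrite -innerC.
rewrite -(@ler_pXn2r _ 2)// ?nnegrE ?mulr_ge0// exprMn !inner_normE.
have := inner_ge0 ('[y, y] *: x - '[x, y] *: y).
rewrite innerBl !innerBr !innerZl !innerZr yyr (innerC y x) normCK.
rewrite [X in _ <= X](_ : _ = '[y, y] * ('[x, x] * '[y, y] - '[x, y] * '[x, y]^*)).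
  by rewrite pmulr_rge0// subr_ge0.
by ring.
Qed.

Definition normalized x := `|x|^-1 *: x.

Lemma normalized_unit x : x != 0 -> '[normalized x, normalized x] = 1.
Proof.
move=> x0; rewrite inner1_norm normrZ normfV normr_id mulVf//.
by rewrite normr_eq0.
Qed.

Lemma conjC_norm x : `|x|^* = `|x|.
Proof. by apply: CrealP; exact: normr_real. Qed.

Lemma inv_sqrt2 : exists r : C, [/\ r != 0, r^* = r & r * r * 2%:R = 1].
Proof.
exists (sqrtC 2%:R)^-1; split.
- by rewrite invr_eq0 sqrtC_eq0 pnatr_eq0.
- by apply: CrealP; rewrite ger0_real// invr_ge0 sqrtC_ge0.
- by rewrite -expr2 exprVn sqrtCK mulVf// pnatr_eq0.
Qed.

End InnerProduct.

(** * Orthogonal series and orthonormal bases *)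

Section OrthogonalSeries.
Variables (R : realType) (H : hilbertType R).
Local Notation C := R[i].
Implicit Types (x y z : H) (a : C).

(** By Pythagoras the squared distance of two partial sums is the difference of
    their squared norms, and these form a bounded nondecreasing sequence of
    reals; so the partial sums are Cauchy. *)
Lemma orthogonal_series_cvg (v : nat -> H) (M : C) :
  (forall i j, i != j -> '[v i, v j] = 0) ->
  (forall n, '[\sum_(i < n) v i, \sum_(i < n) v i] <= M) ->
  exists y, (fun n => \sum_(i < n) v i) @ \oo --> y.
Proof.
move=> ov bM; pose S n := \sum_(i < n) v i.
have Sv n i : (n <= i)%N -> '[S n, v i] = 0.
  move=> ni; rewrite /S inner_suml big1// => k _; apply: ov.
  by rewrite neq_ltn (leq_trans (ltn_ord k) ni).
have SD n k : '[S (n + k)%N, S (n + k)%N] =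
    '[S n, S n] + '[S (n + k)%N - S n, S (n + k)%N - S n].
  rewrite -pythagoras ?[S n + _]addrC ?subrK//.
  elim: k => [|k IH]; first by rewrite addn0 subrr inner0r.
  rewrite addnS [S (n + k).+1]big_ord_recr/= addrAC innerDr [X in X + _]IH add0r.
  by rewrite Sv ?leq_addr.
pose r n : R := complex.Re '[S n, S n].
have rE n : (r n)%:C%C = '[S n, S n] by rewrite RRe_real// ger0_real// inner_ge0.
have bR n : r n <= complex.Re M.
  by have := bM n; rewrite -/(S n) -(rE n) lecE => /andP[_].
(* The supremum of the squared norms provides the Cauchy index. *)
have hs : has_sup (range r).
  by split; [exists (r 0%N), 0%N|exists (complex.Re M) => _ [n _ <-]].
suff cS : cauchy (S @ \oo) by apply/cvg_ex; exact: cauchy_cvg cS.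
apply: cauchy_exP => e e0.
have eR : (complex.Re e)%:C%C = e by rewrite RRe_real// gtr0_real.
have e0' : 0 < complex.Re e by rewrite -ltcR eR.
have d0 : 0 < complex.Re e ^+ 2 by rewrite exprn_gt0.
have [_ [N _ <-] rN] := sup_adherent d0 hs.
exists (S N); exists N => // n /= Nn.
rewrite -ball_normE /= distrC.
suff: `|S n - S N : H| < e by [].
rewrite -(@ltr_pXn2r _ 2)// ?nnegrE ?normr_ge0 ?(ltW e0)// inner_normE.
have := SD N (n - N)%N; rewrite subnKC// => SDn.
rewrite (_ : '[S n - S N, S n - S N] = '[S n, S n] - '[S N, S N]); last first.
  by rewrite SDn [X in _ = X - _]addrC addrK.
rewrite -!rE -eR -rmorphB -rmorphXn ltcR ltrBlDl.
apply: le_lt_trans (_ : r n <= sup (range r)) _.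
  by apply: ub_le_sup; [case: hs|exists n].
by rewrite -ltrBlDr.
Qed.

(** The form of continuity that the Fourier sums need: their inner products with
    a fixed vector are eventually constant. *)
Lemma inner_lim (u : nat -> H) y z (c : C) N : u @ \oo --> y ->
  (forall n, (N <= n)%N -> '[u n, z] = c) -> '[y, z] = c.
Proof.
move=> uy uz; apply/eqP; rewrite -subr_eq0 -normr_le0; apply/ler_addgt0Pl => e e0.
rewrite addr0; pose d := e / (`|z| + 1).
have z1 : 0 < `|z| + 1 by rewrite ltr_wpDl.
have d0 : 0 < d by rewrite divr_gt0.
have /cvgrPdist_lt/(_ _ d0)[m _ um] := uy.
have /um {um} := leq_maxl m N; rewrite /= => un.
rewrite -(uz _ (leq_maxr m N)) -innerBl (le_trans (cauchy_schwarz _ _))//.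
rewrite (@le_trans _ _ (d * `|z|))//; first by rewrite ler_wpM2r// ltW ?un.
by rewrite /d -mulrA ler_piMr ?(ltW e0)// mulrC ler_pdivrMr// mul1r lerDl.
Qed.

End OrthogonalSeries.

Section OrthonormalFamilies.
Variables (R : realType) (H : hilbertType R).
Local Notation C := R[i].
Implicit Types (x y z : H) (a : C) (S G : set H).

Definition orthonormal_family (I : eqType) (e : I -> H) :=
  forall i j, '[e i, e j] = (i == j)%:R.

Definition orthonormal_set S :=
  (forall x, S x -> '[x, x] = 1) /\
  (forall x y, S x -> S y -> x <> y -> '[x, y] = 0).

Section Family.
Variables (I : countType) (e : I -> H).
Hypothesis oe : orthonormal_family e.

Lemma inner_lincomb (s : seq I) (k : I -> C) j : uniq s -> j \in s ->
  '[\sum_(i <- s) k i *: e i, e j] = k j.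
Proof.
move=> us js; rewrite inner_suml (bigD1_seq j)//= innerZl oe eqxx mulr1.
by rewrite big1 ?addr0// => i /negbTE ij; rewrite innerZl oe ij mulr0.
Qed.

Lemma norm_lincomb (s : seq I) (k : I -> C) : uniq s ->
  '[\sum_(i <- s) k i *: e i, \sum_(i <- s) k i *: e i] = \sum_(i <- s) `|k i| ^+ 2.
Proof.
move=> us; rewrite inner_sumr big_seq [RHS]big_seq; apply: eq_bigr => j js.
by rewrite innerZr inner_lincomb// normCKC.
Qed.

Lemma bessel (s : seq I) x : uniq s ->
  \sum_(i <- s) `|'[x, e i]| ^+ 2 <= '[x, x].
Proof.
move=> us; pose p := \sum_(i <- s) '[x, e i] *: e i.
have px : '[x - p, p] = 0.
  rewrite {2}/p inner_sumr big_seq big1// => j js.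
  by rewrite innerZr innerBl inner_lincomb// subrr mulr0.
rewrite -(norm_lincomb (fun i => '[x, e i]))// -/p -[x in leRHS](subrK p) pythagoras//.
by rewrite lerDr inner_ge0.
Qed.

(** The index type is enumerated by pickle, indices outside its range
    contributing the zero vector. The sequence in the conclusion records that y
    lies in the closed span, whence y is orthogonal to all that e is orthogonal
    to, even when e is not total. *)
Lemma riesz_fischer (a : I -> C) (M : C) :
  (forall s, uniq s -> \sum_(i <- s) `|a i| ^+ 2 <= M) ->
  exists y, (forall i, '[y, e i] = a i) /\
    exists2 u : nat -> H, (forall n, linspan e (u n)) & u @ \oo --> y.
Proof.
move=> bM; pose F i := a i *: e i; pose v k := oapp F 0 (pickle_inv k : option I).
pose s n : seq I := pmap pickle_inv (iota 0 n).
have us n : uniq (s n) by apply: (pmap_uniq pickle_invK); exact: iota_uniq.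
have vE n : \sum_(i < n) v i = \sum_(i <- s n) F i.
  by rewrite -(big_mkord xpredT v) /index_iota subn0 /s big_pmap.
have vpK k (i : I) : pickle_inv k = Some i -> pickle i = k.
  by move=> ki; have := @pickle_invK I k; rewrite (ki : @pickle_inv I k = _).
have [||y vy] := @orthogonal_series_cvg _ _ v M.
- move=> k l kl; rewrite /v.
  case ki: (pickle_inv k) => [i|] /=; last by rewrite inner0l.
  case lj: (pickle_inv l) => [j|] /=; last by rewrite inner0r.
  rewrite innerZl innerZr oe; case: eqVneq => [ij|]; last by rewrite !mulr0.
  by move: kl; rewrite -(vpK _ _ ki) -(vpK _ _ lj) ij eqxx.
- by move=> n; rewrite vE norm_lincomb// bM.
exists y; split=> [j|]; last first.
  exists (fun n => \sum_(i < n) v i) => // n.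
  by exists (s n), a; rewrite vE.
apply: (inner_lim (N := (pickle j).+1) vy) => n jn.
rewrite vE inner_lincomb// /s mem_pmap; apply/mapP; exists (pickle j).
  by rewrite mem_iota.
by rewrite pickleK_inv.
Qed.

Lemma linspan_orth x z : linspan e x -> (forall i, '[z, e i] = 0) -> '[x, z] = 0.
Proof.
move=> [s [k ->]] ze; rewrite inner_suml big1// => i _.
by rewrite innerZl (inner_eq0C (ze i)) mulr0.
Qed.

Definition total_family := forall x, (forall i, '[x, e i] = 0) -> x = 0.

Lemma fourier x : exists y, (forall i, '[y, e i] = '[x, e i]) /\
    exists2 u : nat -> H, (forall n, linspan e (u n)) & u @ \oo --> y.
Proof. by apply: (@riesz_fischer _ '[x, x]) => s; exact: bessel. Qed.

(** A vector and its Fourier sum have the same coefficients. *)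
Lemma total_dense : total_family -> dense (linspan e).
Proof.
move=> te O [x Ox] oO; have [y [yx [u us uy]]] := fourier x.
have xy : x = y.
  by apply/eqP; rewrite -subr_eq0; apply/eqP/te => i; rewrite innerBl yx subrr.
move: oO; rewrite openE => /(_ _ Ox); rewrite xy => /uy[N _ uO].
by exists (u N); split => //; apply: uO => /=.
Qed.

(** If x is orthogonal to the span, Cauchy-Schwarz makes x at least as short as
    its distance to any element z of the span, but z can be chosen closer. *)
Lemma dense_total : dense (linspan e) -> total_family.
Proof.
move=> de x xe; apply/eqP/negPn/negP => x0.
have nx : 0 < `|x| by rewrite normr_gt0.
have [z [xz /= sz]] := de (ball x `|x|) (ex_intro _ x (ballxx x nx)) (ball_open x _).
move: xz; rewrite -ball_normE /= => xz.
have : `|x| ^+ 2 <= `|x| * `|x - z|.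
  rewrite inner_normE (le_trans (y := `|'[x, x - z]|)) ?cauchy_schwarz//.
  by rewrite innerBr (inner_eq0C (linspan_orth sz xe)) subr0 ger0_norm ?inner_ge0.
rewrite expr2 ler_pM2l// => /le_lt_trans/(_ xz).
by rewrite ltxx.
Qed.

End Family.

(** Zorn's lemma applied to the sets S for which S together with S0 is
    orthonormal: the union of the empty chain is empty, so S0 cannot be required
    to lie inside S. *)
Lemma max_orthonormal G S0 : orthonormal_set S0 -> S0 `<=` G ->
  exists S, [/\ S0 `<=` S, S `<=` G, orthonormal_set S &
    forall g, G g -> '[g, g] = 1 -> ~ (forall s, S s -> '[g, s] = 0)].
Proof.
move=> o0 sG; pose P S := S `<=` G /\ orthonormal_set (S `|` S0).
have [|S [[SG oS] maxS]] := @Zorn_bigcup H P.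
  move=> F FP Ftot; split; first by move=> x [A /FP[AG _]] /AG.
  split=> [x [[A FA Ax]|]|x y]; [|exact: o0.1|].
    by have [_ [+ _]] := FP _ FA; apply; left.
  case=> [[A FA Ax]|Sx] [[B FB By]|Sy]; last exact: o0.2.
  - case: (Ftot _ _ FA FB) => sub.
    + by have [_ [_ +]] := FP _ FB; apply; left => //; apply: sub.
    + by have [_ [_ +]] := FP _ FA; apply; left => //; apply: sub.
  - by have [_ [_ +]] := FP _ FA; apply; [left|right].
  - by have [_ [_ +]] := FP _ FB; apply; [right|left].
exists (S `|` S0); split; [by move=> x; right|by rewrite subUset|exact: oS|].
move=> g Gg g1 gS; apply: (maxS (S `|` [set g])).
  split; first by move=> x; left.
  move=> sub; have Sg : S g by apply: sub; right.
  have := gS g (or_introl Sg); rewrite g1 => /eqP; rewrite oner_eq0//.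
have [nS ooS] := oS; split; first by rewrite subUset; split => // _ ->.
rewrite setUAC; split=> [x [/nS//|-> //]|x y].
case=> [Sx|->] [Sy|->] // xy; [exact: ooS|exact/inner_eq0C/gS|exact: gS].
Qed.

(** Distinct elements are at distance larger than 1, so they cannot share an
    approximation at distance less than 1/2 in a countable dense set. *)
Lemma orthonormal_countable S : separable H -> orthonormal_set S -> countable S.
Proof.
move=> [D cD dD] [S1 S2].
have h0 : 0 < 2^-1 :> C by rewrite invr_gt0.
have /choice[f fP] : forall x, exists d, D d /\ `|x - d| < 2^-1.
  move=> x; have [d [xd Dd]] := dD (ball x (2^-1 : C)) (ex_intro _ x (ballxx x h0)) (ball_open x _).
  by exists d; split=> //; move: xd; rewrite -ball_normE.
have finj : {in S &, injective f}.
  move=> x y; rewrite !inE => Sx Sy fxy; apply: contrapT => xy.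
  have : `|x - y| < 1.
    rewrite -(subrKA (f x)) (le_lt_trans (ler_normD _ _))// (splitr 1) ltrD//.
      by rewrite mul1r; exact: (fP x).2.
    by rewrite mul1r fxy distrC; exact: (fP y).2.
  apply/negP; rewrite -real_leNgt ?real1 ?normr_real//.
  rewrite -(@ler_pXn2r _ 2)// ?nnegrE// expr1n inner_normE.
  rewrite innerBl !innerBr S1// [in X in _ - X]S1// S2// (S2 y x)//; last exact/nesym.
  by rewrite subr0 sub0r opprK lerDl.
rewrite -(eq_countable (inj_card_eq finj)).
apply: sub_countable cD; apply: subset_card_le => _ [x Sx <-]; exact: (fP x).1.
Qed.

Lemma orthonormal_enum S : separable H -> orthonormal_set S ->
  exists (d : option nat) (e : seq_index d -> H),
    orthonormal_family e /\ range e = S.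
Proof.
move=> sH oS; have cS := orthonormal_countable sH oS.
have bij (A : set nat) : (A #= S)%card -> exists f : nat -> H, set_bij A S f.
  by move/card_set_bijP.
suff [d [e [ie re]]] : exists (d : option nat) (e : seq_index d -> H),
    injective e /\ range e = S.
  exists d, e; split=> // i j; have Se k : S (e k) by rewrite -re; exists k.
  case: eqVneq => [->|ij]; first exact: oS.1.
  by apply: oS.2 => // /ie /eqP; exact/negP.
have [/finite_setP[n]|iS] := pselect (finite_set S).
  rewrite card_eq_sym => /bij[f [fS fi fs]].
  exists (Some n), (fun i : 'I_n => f i); split.
    move=> i j fij; apply/val_inj; apply: fi => //; rewrite inE /=; exact: ltn_ord.
  rewrite eqEsubset; split=> [_ [i _ <-]|x /fs[k /= kn <-]].
    by apply: fS => /=; exact: ltn_ord.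
  by exists (Ordinal kn).
have := eq_card_nat cS iS; rewrite card_eq_sym => /bij[f [fS fi fs]].
exists None, f; split; first by move=> i j; apply: fi; rewrite inE.
by rewrite eqEsubset; split=> [_ [i _ <-]|x /fs[k _ <-]]; [exact: fS|exists k].
Qed.

Lemma onb_inner (e : onbasis H) : orthonormal_family e.
Proof. by case: e. Qed.

Lemma onb_total (e : onbasis H) : total_family e.
Proof. by apply: dense_total; case: e. Qed.

(** The source of all orthonormal bases with prescribed properties. The last
    hypothesis says that an incomplete orthonormal family inside G never gets
    stuck; it is usually verified by applying to z projections that leave every
    element of S fixed or kill it, as they keep z orthogonal to S. *)
Lemma onbasis_in G S0 : separable H -> orthonormal_set S0 -> S0 `<=` G ->
  (forall a x, G x -> G (a *: x)) ->
  (forall S, S0 `<=` S -> S `<=` G -> orthonormal_set S ->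
    forall z, z <> 0 -> (forall s, S s -> '[z, s] = 0) ->
    exists g, [/\ G g, g <> 0 & forall s, S s -> '[g, s] = 0]) ->
  exists e : onbasis H, (forall i, G (e i)) /\
    (forall s, S0 s -> exists i, e i = s).
Proof.
move=> sH o0 sG GZ next; have [S [S0S SG oS maxS]] := max_orthonormal o0 sG.
have [d [e [oe re]]] := orthonormal_enum sH oS.
have te : total_family e.
  move=> z ze; apply: contrapT => z0; have [|g [Gg /eqP g0 gS]] := next S S0S SG oS z z0.
    by move=> s; rewrite -re => -[i _ <-].
  apply: (maxS (normalized g)); [exact: GZ|exact: normalized_unit|].
  by move=> s /gS gs; rewrite innerZl gs mulr0.
exists (Onbasis oe (total_dense oe te)); split=> [i|s /S0S].
  by apply: SG; rewrite -re; exists i.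
by rewrite -re => -[i _ <-]; exists i.
Qed.

End OrthonormalFamilies.

(** * Bounded operators and their adjoints *)

Lemma bounded_linear_continuous_map (K : numFieldType) (V W : normedModType K)
    (f : {linear V -> W}) (M : K) : 0 <= M ->
  (forall x, `|f x| <= M * `|x|) -> continuous f.
Proof.
move=> M0 fM; apply/linear_bounded_continuous/linear_boundedP.
near=> r => x; rewrite (le_trans (fM x))// ler_wpM2r//.
by near: r; apply: nbhs_pinfty_ge; rewrite ger0_real.
Unshelve. all: by end_near. Qed.

Section BoundedOperators.
Variables (R : realType) (H : hilbertType R).
Local Notation C := R[i].
Implicit Types (x y z : H) (a : C) (A B : bop H).

Lemma bopP A B : (forall x, A x = B x) -> A = B.
Proof. by move=> AB; apply/val_inj/funext. Qed.

Lemma bop0E x : (0 : bop H) x = 0. Proof. by []. Qed.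
Lemma bopDE A B x : (A + B) x = A x + B x. Proof. by []. Qed.
Lemma bopNE A x : (- A) x = - A x. Proof. by []. Qed.
Lemma bopBE A B x : (A - B) x = A x - B x. Proof. by []. Qed.
Lemma bopZE a A x : (a *: A) x = a *: A x. Proof. by []. Qed.
Definition bopE := (bop0E, bopBE, bopDE, bopNE, bopZE).

Lemma bop_add A x y : A (x + y) = A x + A y. Proof. exact: linearD. Qed.
Lemma bop_sub A x y : A (x - y) = A x - A y. Proof. exact: linearB. Qed.
Lemma bop_opp A x : A (- x) = - A x. Proof. exact: linearN. Qed.
Lemma bop_scale A a x : A (a *: x) = a *: A x. Proof. exact: linearZ. Qed.
Lemma bop_zero A : A 0 = 0. Proof. exact: linear0. Qed.
Lemma bop_sum A (I : Type) (s : seq I) (P : pred I) (F : I -> H) :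
  A (\sum_(i <- s | P i) F i) = \sum_(i <- s | P i) A (F i).
Proof. exact: linear_sum. Qed.

Lemma bop_bounded A : exists2 M : C, 0 < M & forall x, `|A x| <= M * `|x|.
Proof.
have /linear_bounded_continuous/linear_boundedP := @bop_continuous _ _ A.
by move=> /pinfty_ex_gt0[r r0 Ar]; exists r.
Qed.

Lemma bounded_bop (f : H -> H) (M : C) : linear f -> 0 <= M ->
  (forall x, `|f x| <= M * `|x|) -> f \in bounded_op (H := H).
Proof.
move=> lf M0 fM; apply/asboolP; split=> //.
pose F : {linear H -> H} := HB.pack f (GRing.isLinear.Build _ _ _ _ f lf).
exact: (@bounded_linear_continuous_map _ _ _ F M).
Qed.

Lemma comp_bop_subproof A B : A \o B \in bounded_op (H := H).
Proof.
apply/asboolP; split=> [a x y|x]; first by rewrite /= linearP linearP.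
by apply: continuous_comp; exact: bop_continuous.
Qed.
Definition bop_comp A B := Bop (comp_bop_subproof A B).

Lemma id_bop_subproof : idfun \in bounded_op (H := H).
Proof. by apply/asboolP; split=> // x; exact: cvg_id. Qed.
Definition bop_id : bop H := Bop id_bop_subproof.

Lemma ketbra_subproof x y : (fun z => '[z, y] *: x) \in bounded_op (H := H).
Proof.
apply: (@bounded_bop _ (`|x| * `|y|)) => [a u v||u].
- by rewrite innerDl innerZl scalerDl scalerA.
- by rewrite mulr_ge0.
- by rewrite normrZ mulrC -mulrA ler_wpM2l// mulrC cauchy_schwarz.
Qed.
Definition ketbra x y : bop H := Bop (ketbra_subproof x y).

Lemma bop_compE A B x : bop_comp A B x = A (B x). Proof. by []. Qed.
Lemma bop_idE x : bop_id x = x. Proof. by []. Qed.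
Lemma ketbraE x y z : ketbra x y z = '[z, y] *: x. Proof. by []. Qed.

(** Extension by continuity of an identity from the span of a basis to H. The
    map is only required to be subtractive, so that it may be antilinear. *)
Lemma bounded_map_onb_eq0 (e : onbasis H) (V : normedModType C) (g : H -> V) (M : C) :
  0 < M -> {morph g : x y / x - y} -> (forall x, `|g x| <= M * `|x|) ->
  (forall x, linspan e x -> g x = 0) -> forall x, g x = 0.
Proof.
move=> M0 gB gM ge x; apply/eqP; rewrite -normr_le0; apply/ler_addgt0Pl => eps eps0.
have d0 : 0 < eps / M by rewrite divr_gt0.
have de : dense (linspan e) by case: e {ge}.
have [z [xz sz]] := de (ball x (eps / M)) (ex_intro _ x (ballxx x d0)) (ball_open x _).
move: xz; rewrite -ball_normE /= => xz.
rewrite addr0 -[g x]subr0 -(ge z sz) -gB (le_trans (gM _))//.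
by rewrite mulrC -ler_pdivlMr// ltW.
Qed.

Lemma bop_ext_onb (e : onbasis H) A B : (forall i, A (e i) = B (e i)) -> A = B.
Proof.
move=> AB; apply: bopP => x; apply/eqP; rewrite -subr_eq0 -bopBE; apply/eqP; move: x.
have [M M0 gM] := bop_bounded (A - B).
apply: (@bounded_map_onb_eq0 e _ _ _ M0 _ gM) => [x y|x [s [k ->]]]; first exact: bop_sub.
rewrite bop_sum big1// => i _.
by rewrite bop_scale bopBE AB subrr scaler0.
Qed.

Hypothesis sepH : separable H.

Lemma onbasis_exists : inhabited (onbasis H).
Proof.
have [||||e _] := @onbasis_in _ _ setT set0 sepH; last by exists.
- by split=> x.
- by move=> x.
- by [].
- by move=> S _ _ _ z z0 zS; exists z.
Qed.

(** Riesz representation: the Fourier coefficients of the vector B y are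
    prescribed, and testing A on the finite sums they define shows that they are
    square summable. *)
Lemma adjoint_exists A : exists B : bop H, forall x y, '[A x, y] = '[x, B y].
Proof.
have [M M0 AM] := bop_bounded A; have [e] := onbasis_exists.
have/choice[B eB] : forall y, exists z, forall i, '[z, e i] = ('[A (e i), y])^*.
  move=> y; have [|z [zE _]] := @riesz_fischer _ _ _ e (@onb_inner _ _ e)
      (fun i => ('[A (e i), y])^*) ((M * `|y|) ^+ 2); last by exists z.
  move=> s us; pose a := fun i => ('[A (e i), y])^*.
  pose u := \sum_(i <- s) a i *: e i.
  have uE : '[u, u] = \sum_(i <- s) `|a i| ^+ 2 by exact: norm_lincomb (@onb_inner _ _ e) _ _ us.
  have uA : '[u, u] = '[A u, y].
    rewrite uE /u bop_sum inner_suml; apply: eq_bigr => i _.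
    by rewrite bop_scale innerZl /a normCK conjCK.
  rewrite -[leLHS]uE -inner_normE; have [->|u0] := eqVneq u 0.
    by rewrite normr0 expr0n exprn_ge0// mulr_ge0// ltW.
  rewrite ler_pXn2r ?nnegrE ?mulr_ge0 ?(ltW M0)//.
  have : `|u| ^+ 2 <= `|u| * (M * `|y|).
    rewrite inner_normE -[leLHS]ger0_norm ?inner_ge0// uA.
    by rewrite (le_trans (cauchy_schwarz _ _))// mulrA [`|u| * M]mulrC ler_wpM2r.
  by rewrite expr2 ler_pM2l// normr_gt0.
have adj x y : '[A x, y] = '[x, B y].
  apply/eqP; rewrite -subr_eq0; apply/eqP; move: x.
  have K0 : 0 < M * `|y| + `|B y| + 1.
    by rewrite ltr_wpDl// addr_ge0// mulr_ge0// ltW.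
  apply: (@bounded_map_onb_eq0 e C^o (fun x => '[A x, y] - '[x, B y]) _ K0).
  - by move=> u v; rewrite bop_sub !innerBl opprD addrACA [in RHS]opprD.
  - move=> x; rewrite (le_trans (ler_normB _ _))//.
    rewrite 2!mulrDl mul1r -[leLHS]addr0 lerD// lerD//.
      rewrite (le_trans (cauchy_schwarz _ _))// mulrAC ler_wpM2r//.
    by rewrite (le_trans (cauchy_schwarz _ _))// mulrC.
  - move=> x [s [k ->]]; rewrite bop_sum !inner_suml -sumrB big1// => i _.
    rewrite bop_scale !innerZl [X in _ - _ * X]innerC eB conjCK subrr//.
have lB : linear B.
  move=> a u v; apply: inner_extr => x.
  by rewrite -adj !innerDr !innerZr !adj.
have bB x : `|B x| <= M * `|x|.
  have [->|u0] := eqVneq (B x) 0; first by rewrite normr0 mulr_ge0// ltW.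
  have : `|B x| ^+ 2 <= `|B x| * (M * `|x|).
    rewrite inner_normE -[leLHS]ger0_norm ?inner_ge0// -adj.
    by rewrite (le_trans (cauchy_schwarz _ _))// mulrA [`|B x| * M]mulrC ler_wpM2r.
  by rewrite expr2 ler_pM2l// normr_gt0.
by exists (Bop (bounded_bop lB (ltW M0) bB)).
Qed.

Lemma adjointE A x y : '[A x, y] = '[x, adjoint A y].
Proof.
rewrite /adjoint; case: xgetP => [B _ ->//|/(_ _)].
by have [B BE] := adjoint_exists A; move/(_ B).
Qed.

Lemma adjointEr A x y : '[x, A y] = '[adjoint A x, y].
Proof. by rewrite innerC adjointE -innerC. Qed.

Lemma adjoint_unique A B : (forall x y, '[A x, y] = '[x, B y]) -> adjoint A = B.
Proof. by move=> AB; apply: bopP => y; apply: inner_extr => x; rewrite -adjointE AB. Qed.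

Lemma adjointK A : adjoint (adjoint A) = A.
Proof. by apply: adjoint_unique => x y; rewrite -adjointEr. Qed.

Lemma adjointD A B : adjoint (A + B) = adjoint A + adjoint B.
Proof. by apply: adjoint_unique => x y; rewrite !bopE innerDl innerDr !adjointE. Qed.

Lemma adjointZ a A : adjoint (a *: A) = a^* *: adjoint A.
Proof. by apply: adjoint_unique => x y; rewrite !bopE innerZl innerZr adjointE conjCK. Qed.

Lemma adjoint_id : adjoint bop_id = bop_id.
Proof. exact: adjoint_unique. Qed.

Lemma adjoint_comp A B : adjoint (bop_comp A B) = bop_comp (adjoint B) (adjoint A).
Proof. by apply: adjoint_unique => x y; rewrite /= !adjointE. Qed.

Lemma adjoint_ketbra x y : adjoint (ketbra x y) = ketbra y x.
Proof.
by apply: adjoint_unique => u v; rewrite !ketbraE innerZl innerZr -innerC mulrC.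
Qed.

End BoundedOperators.

(** * Projections and diagonal operators *)

Section Projections.
Variables (R : realType) (H : hilbertType R).
Local Notation C := R[i].
Implicit Types (x y z : H) (a : C) (A B P Q : bop H) (e : onbasis H).
Local Notation I := (bop_id H).

Definition is_proj P :=
  (forall x, P (P x) = P x) /\ (forall x y, '[P x, y] = '[x, P y]).

Definition commuting A B := forall x, A (B x) = B (A x).

Lemma proj_id : is_proj I.
Proof. by []. Qed.

Lemma proj_zero : is_proj 0.
Proof. by split=> x //= y; rewrite inner0l inner0r. Qed.

Lemma proj_compl P : is_proj P -> is_proj (I - P).
Proof.
move=> [PP Ps]; split=> x; first by rewrite !bopE !bop_idE bop_sub PP subrr subr0.
by move=> y; rewrite !bopE !bop_idE innerBl innerBr Ps.
Qed.

Lemma proj_ketbra x : '[x, x] = 1 -> is_proj (ketbra x x).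
Proof.
move=> x1; split=> [y|y z]; rewrite !ketbraE; first by rewrite innerZl x1 mulr1.
by rewrite innerZl innerZr -innerC mulrC.
Qed.

Lemma proj_add P Q : is_proj P -> is_proj Q ->
  (forall x, P (Q x) = 0) -> is_proj (P + Q).
Proof.
move=> [PP Ps] [QQ Qs] PQ.
have QP x : Q (P x) = 0.
  by apply: inner_ext => y; rewrite Qs Ps PQ inner0r inner0l.
split=> [x|x y]; rewrite !bopE; last by rewrite innerDl innerDr Ps Qs.
by rewrite !bop_add PP QQ PQ QP addr0 add0r.
Qed.

Lemma proj_sub P Q : is_proj P -> is_proj Q ->
  (forall x, P (Q x) = Q x) -> is_proj (P - Q).
Proof.
move=> [PP Ps] [QQ Qs] PQ.
have QP x : Q (P x) = Q x.
  by apply: inner_ext => y; rewrite Qs Ps PQ Qs.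
split=> [x|x y]; rewrite !bopE; last by rewrite innerBl innerBr Ps Qs.
by rewrite !bop_sub PP QQ PQ QP subrr subr0.
Qed.

Lemma proj_orth P x y : is_proj P -> P x = x -> P y = 0 -> '[x, y] = 0.
Proof. by move=> [_ Ps] <- Py; rewrite Ps Py inner0r. Qed.

(** If x and w are orthogonal eigenvectors in V then so is their sum, which
    forces their eigenvalues to agree; an arbitrary y in V is a multiple of x
    plus such a w. *)
Lemma eigen_scalar A (V : set H) : (forall a x y, V x -> V y -> V (a *: x + y)) ->
  (forall x, V x -> exists c, A x = c *: x) ->
  exists c, forall x, V x -> A x = c *: x.
Proof.
move=> VD eA; have [[x0 Vx0 /eqP x00]|no] := pselect (exists2 x, V x & x <> 0); last first.
  exists 0 => x Vx; suff -> : x = 0 by rewrite bop_zero scaler0.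
  by apply: contrapT => x0; apply: no; exists x.
have [c Ax0] := eA _ Vx0; exists c => y Vy.
have xx0 : '[x0, x0] != 0 by apply: contra_neq x00; exact: inner_eq0.
pose w := (- ('[y, x0] / '[x0, x0])) *: x0 + y.
have Vw : V w by exact: VD.
have wx : '[w, x0] = 0.
  by rewrite innerDl innerZl mulNr divfK// addNr.
have yE : y = ('[y, x0] / '[x0, x0]) *: x0 + w by rewrite /w scaleNr addNKr.
clearbody w; suff Aw : A w = c *: w.
  by rewrite yE bop_add bop_scale Aw Ax0 scalerDr !scalerA mulrC.
have [->|w0] := eqVneq w 0; first by rewrite bop_zero scaler0.
have ww0 : '[w, w] != 0 by apply: contra_neq w0; exact: inner_eq0.
have [d Aw] := eA _ Vw; have [f] : exists f, A (1 *: x0 + w) = f *: (1 *: x0 + w).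
  by apply: eA; exact: VD.
rewrite scale1r bop_add Ax0 Aw scalerDr => E.
have fx : c = f.
  apply: (mulIf xx0); have := congr1 (fun u => '[u, x0]) E.
  by rewrite !innerDl !innerZl wx !mulr0 !addr0.
suff -> : d = f by rewrite fx.
apply: (mulIf ww0); have := congr1 (fun u => '[u, w]) E.
by rewrite !innerDl !innerZl (inner_eq0C wx) !mulr0 !add0r.
Qed.

Lemma diag_eig e A : diagonal_op e A <-> forall j, exists c, A (e j) = c *: e j.
Proof.
split=> [dA j|eA i j ij]; last first.
  have [c ->] := eA j; rewrite innerZl onb_inner eq_sym (negbTE ij) mulr0//.
exists '[A (e j), e j]; apply/eqP; rewrite -subr_eq0; apply/eqP.
apply: (@onb_total _ _ e) => i; rewrite innerBl innerZl onb_inner.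
by case: eqVneq => [->|ji]; rewrite ?mulr1 ?subrr// mulr0 subr0 dA// eq_sym.
Qed.

Lemma onb_extl e x y : (forall i, '[x, e i] = '[y, e i]) -> x = y.
Proof.
move=> xy; apply/eqP; rewrite -subr_eq0; apply/eqP/(@onb_total _ _ e) => i.
by rewrite innerBl xy subrr.
Qed.

Lemma onb_unit e i : '[e i, e i] = 1.
Proof. by rewrite onb_inner eqxx. Qed.

Lemma diag_ketbra e i : diagonal_op e (ketbra (e i) (e i)).
Proof.
apply/diag_eig => j; rewrite ketbraE onb_inner.
by case: eqVneq => [->|_]; [exists 1|exists 0; rewrite !scale0r].
Qed.

Lemma diag_id e : diagonal_op e I.
Proof. by apply/diag_eig => j; exists 1; rewrite scale1r. Qed.

Lemma diag_lin e a A B : diagonal_op e A -> diagonal_op e B ->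
  diagonal_op e (a *: A + B).
Proof.
move=> /diag_eig dA /diag_eig dB; apply/diag_eig => j.
have [c Ac] := dA j; have [d Bd] := dB j; exists (a * c + d).
by rewrite !bopE Ac Bd scalerA scalerDl.
Qed.

Lemma diag_comp e A B : diagonal_op e A -> diagonal_op e B ->
  diagonal_op e (bop_comp A B).
Proof.
move=> /diag_eig dA /diag_eig dB; apply/diag_eig => j.
have [c Ac] := dA j; have [d Bd] := dB j; exists (d * c).
by rewrite bop_compE Bd bop_scale Ac scalerA.
Qed.

Lemma diag_commute e A B : diagonal_op e A -> diagonal_op e B -> commuting A B.
Proof.
move=> /diag_eig dA /diag_eig dB x; rewrite -!bop_compE; congr (bop_fun _ x).
apply: (bop_ext_onb (e := e)) => j; have [c Ac] := dA j; have [d Bd] := dB j.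
by rewrite !bop_compE Bd Ac !bop_scale Ac Bd !scalerA mulrC.
Qed.

Definition joint_eigen P Q : set H :=
  [set v | (P v = v \/ P v = 0) /\ (Q v = v \/ Q v = 0)].

Lemma proj_orth_set P (S : set H) z : is_proj P ->
  (forall s, S s -> P s = s \/ P s = 0) -> (forall s, S s -> '[z, s] = 0) ->
  forall s, S s -> '[P z, s] = 0.
Proof.
by move=> [_ Ps] SP zS s Ss; rewrite Ps; case: (SP _ Ss) => ->; [exact: zS|exact: inner0r].
Qed.

Hypothesis sepH : separable H.

Lemma diag_adjoint e A : diagonal_op e A -> diagonal_op e (adjoint A).
Proof.
move=> dA i j ij; rewrite -adjointEr// innerC dA ?rmorph0//.
by rewrite eq_sym.
Qed.

(** Applying a projection to a vector, or keeping the vector if the result is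
    zero, produces an eigenvector of the projection that is still orthogonal to
    any given set of eigenvectors. *)
Lemma joint_basis P Q (S0 : set H) : is_proj P -> is_proj Q -> commuting P Q ->
  orthonormal_set S0 -> S0 `<=` joint_eigen P Q ->
  exists e, [/\ diagonal_op e P, diagonal_op e Q & forall s, S0 s -> exists i, e i = s].
Proof.
move=> pP pQ cPQ oS0 S0G.
have [||e [eG eS0]] := onbasis_in sepH oS0 S0G.
- move=> a x [Px Qx]; rewrite /joint_eigen /= !bop_scale.
  by split; [case: Px|case: Qx] => ->; rewrite ?scaler0; [left|right|left|right].
- move=> S _ SG oS z z0 zS.
  have step T v : is_proj T -> v <> 0 ->
      exists w, [/\ w <> 0, w = v \/ w = T v & T w = w \/ T w = 0].
    move=> [TT _] v0; have [Tv0|Tv0] := eqVneq (T v) 0.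
      by exists v; split=> //; [left|right].
    by exists (T v); split; [exact/eqP|right|left].
  have [u [u0 uE Pu]] := step P z pP z0; have [w [w0 wE Qw]] := step Q u pQ u0.
  have uS s : S s -> '[u, s] = 0.
    by move=> Ss; case: uE => ->; [exact: zS|apply: (proj_orth_set pP _ zS) => // t /SG[]].
  exists w; split=> //; last first.
    by move=> s Ss; case: wE => ->; [exact: uS|apply: (proj_orth_set pQ _ uS) => // t /SG[]].
  split=> //; case: wE => -> //.
  by rewrite cPQ; case: Pu => ->; rewrite ?bop_zero; [left|right].
exists e; split=> //; apply/diag_eig => j; have [Pj Qj] := eG j.
  by case: Pj => ->; [exists 1; rewrite scale1r|exists 0; rewrite scale0r].
by case: Qj => ->; [exists 1; rewrite scale1r|exists 0; rewrite scale0r].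
Qed.

Lemma orthonormal0 : orthonormal_set (set0 : set H).
Proof. by split=> x. Qed.

Lemma orthonormal1 x : '[x, x] = 1 -> orthonormal_set [set x].
Proof. by move=> x1; split=> [y ->//|y z -> ->]. Qed.

Lemma common_basis P Q : is_proj P -> is_proj Q -> commuting P Q ->
  exists e, diagonal_op e P /\ diagonal_op e Q.
Proof.
move=> pP pQ cPQ; have [//|e [dP dQ _]] := joint_basis pP pQ cPQ orthonormal0.
by exists e.
Qed.

(** Each vector of the range and each vector of the kernel of P is, up to a
    factor, a member of a basis that diagonalizes P, hence an eigenvector of X.
    So X is scalar on the range and on the kernel. *)
Lemma in_diag_span P X : is_proj P ->
  (forall e, diagonal_op e P -> diagonal_op e X) ->
  exists a b, X = a *: I + b *: P.
Proof.
move=> pP XP.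
have eX x : P x = x \/ P x = 0 -> exists c, X x = c *: x.
  move=> Px; have [->|x0] := eqVneq x 0; first by exists 0; rewrite bop_zero scaler0.
  have [||e [dP _ xe]] := joint_basis pP proj_id _ (orthonormal1 (normalized_unit x0)).
  - by [].
  - move=> _ ->; split; last by left.
    by rewrite bop_scale; case: Px => ->; rewrite ?scaler0; [left|right].
  have [i ei] := xe (normalized x) erefl.
  have /diag_eig/(_ i)[c] := XP e dP; rewrite ei => Xc; exists c.
  have xn : x = `|x| *: normalized x by rewrite scalerA mulfV ?scale1r// normr_eq0.
  by rewrite [in LHS]xn bop_scale Xc scalerA mulrC -scalerA -xn.
have [|x Px|c1 X1] := @eigen_scalar X [set x | P x = x].
- by move=> a x y /= Px Py; rewrite bop_add bop_scale Px Py.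
- by apply: eX; left.
have [|x Px|c0 X0] := @eigen_scalar X [set x | P x = 0].
- by move=> a x y /= Px Py; rewrite bop_add bop_scale Px Py scaler0 addr0.
- by apply: eX; right.
exists c0, (c1 - c0); apply: bopP => x; rewrite !bopE bop_idE.
rewrite -{1}(subrK (P x) x) bop_add (X1 (P x)); last by rewrite /= pP.1.
rewrite X0; last by rewrite /= bop_sub pP.1 subrr.
by rewrite scalerBr scalerBl -addrA [X in _ + X]addrC.
Qed.

Lemma diag_all_scalar X : (forall e, diagonal_op e X) -> exists c, X = c *: I.
Proof.
move=> dX; have [|a [b ->]] := @in_diag_span I X proj_id; first by move=> e _.
by exists (a + b); rewrite scalerDl.
Qed.

Lemma normal_norm A x : commuting A (adjoint A) ->
  '[A x, A x] = '[adjoint A x, adjoint A x].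
Proof. by move=> nA; rewrite adjointE// -nA -adjointEr. Qed.

(** Let r1 = r2 + s and r2 be the roots of the quadratic equation of B. Then
    N = B - r2 satisfies N^2 = s N. If s = 0 the normal operator N is nilpotent,
    hence zero; otherwise N / s is a normal idempotent, hence self-adjoint. *)
Lemma normal_quadratic B (al be : C) : commuting B (adjoint B) ->
  (forall x, B (B x) = al *: x + be *: B x) ->
  exists a b P, is_proj P /\ B = a *: I + b *: P.
Proof.
move=> nB B2; pose s := sqrtC (be ^+ 2 + 4%:R * al).
have s2 : s ^+ 2 = be ^+ 2 + 4%:R * al by rewrite sqrtCK.
pose r1 := (be + s) / 2%:R; pose r2 := (be - s) / 2%:R.
have n2 : (2%:R : C) != 0 by rewrite pnatr_eq0.
have r12 : r1 = r2 + s by rewrite /r1 /r2; field.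
have rD : r1 + r2 = be by rewrite /r1 /r2; field.
have rM : r1 * r2 = - al.
  have -> : r1 * r2 = (be ^+ 2 - s ^+ 2) / 4%:R by rewrite /r1 /r2; field.
  by rewrite s2; field.
pose N := B - r2 *: I.
have NN x : N (N x) = s *: N x.
  have beE : be = r2 + r2 + s by rewrite -rD r12; ring.
  have alE : al = - ((r2 + s) * r2) by rewrite -r12 rM opprK.
  rewrite /N !bopE !bop_idE bop_sub bop_scale B2.
  by apply: inner_ext => y; rewrite !(innerBl, innerDl, innerZl) alE beE; ring.
have nN : commuting N (adjoint N).
  have -> : adjoint N = adjoint B - r2^* *: I.
    by rewrite /N -[- (_ *: _)]scaleNr adjointD// adjointZ// adjoint_id// rmorphN scaleNr.
  move=> x; rewrite /N !bopE !bop_idE !bop_sub !bop_scale nB.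
  by apply: inner_ext => y; rewrite !(innerBl, innerDl, innerZl); ring.
have NE : N = B - r2 *: I by [].
clearbody N; have [s0|s0] := eqVneq s 0.
  exists r2, 0, 0; split; first exact: proj_zero.
  suff N0 : N = 0 by rewrite scaler0 addr0 -[LHS](subrK (r2 *: I)) -NE N0 add0r.
  apply: bopP => x; apply: inner_eq0; rewrite adjointE//.
  suff -> : adjoint N (N x) = 0 by rewrite inner0r.
  by apply: inner_eq0; rewrite -normal_norm// NN s0 scale0r inner0l.
pose Q := s^-1 *: N.
have QQ x : Q (Q x) = Q x by rewrite /Q !bopE bop_scale NN [s^-1 *: (s *: _)]scalerA mulVf// scale1r.
have nQ : commuting Q (adjoint Q).
  by move=> x; rewrite adjointZ// /Q !bopE !bop_scale nN !scalerA mulrC.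
exists r2, s, Q; split; last by rewrite /Q scalerA mulfV// scale1r NE addrC subrK.
split=> // x y.
have aQ z : adjoint Q z = adjoint Q (Q z).
  apply/eqP; rewrite -subr_eq0 -bop_sub; apply/eqP/inner_eq0.
  by rewrite -normal_norm// bop_sub QQ subrr inner0l.
have Qh u v : '[Q u, v] = '[Q u, Q v].
  by rewrite [LHS]adjointE// aQ -adjointE.
by rewrite Qh [RHS]innerC [in RHS]Qh -innerC.
Qed.

End Projections.

(** * Conjugations and symmetric operators *)

Section Conjugations.
Variables (R : realType) (H : hilbertType R).
Local Notation C := R[i].
Implicit Types (x y z : H) (a : C) (A B P Q : bop H) (e : onbasis H) (J : conjugation H).
Local Notation I := (bop_id H).

(** Unitary maps (s the identity) and antiunitary maps (s the complex
    conjugation) are treated together; V is the inverse of U. *)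
Definition semiunitary (s : C -> C) (U V : H -> H) :=
  [/\ s = id \/ s = Num.conj, forall a x y, U (a *: x + y) = s a *: U x + U y,
      cancel U V, cancel V U & forall x y, '[U x, U y] = s '[x, y]].

Section Semiunitary.
Variables (s : C -> C) (U V : H -> H).
Hypothesis uU : semiunitary s U V.

Lemma semiunitary_invol a : s (s a) = a.
Proof. by case: uU => -[->|->] _ _ _ _ //; rewrite conjCK. Qed.

Lemma semiunitary0 : s 0 = 0.
Proof. by case: uU => -[->|->] _ _ _ _ //; rewrite rmorph0. Qed.

Lemma semiunitary1 : s 1 = 1.
Proof. by case: uU => -[->|->] _ _ _ _ //; rewrite rmorph1. Qed.

Lemma semiunitary_inv : semiunitary s V U.
Proof.
have [sE lU UV VU Us] := uU; split=> // [a x y|x y]; last first.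
  by rewrite -[in RHS](VU x) -[in RHS](VU y) Us semiunitary_invol.
by rewrite -[RHS]UV lU semiunitary_invol !VU.
Qed.

Lemma semiunitary_norm x : `|U x| = `|x|.
Proof.
have [sE _ _ _ Us] := uU; apply/eqP; rewrite -(@eqrXn2 _ 2)// !inner_normE Us.
by case: sE => -> //; rewrite -innerC.
Qed.

Lemma sandwich_subproof A : U \o A \o V \in bounded_op (H := H).
Proof.
have [M M0 AM] := bop_bounded A.
have [_ lU _ _ _] := uU; have [_ lV _ _ _] := semiunitary_inv.
apply: (@bounded_bop _ _ _ M) => [a x y||x] /=.
- by rewrite lV bop_add bop_scale lU semiunitary_invol.
- exact: ltW.
- rewrite semiunitary_norm (le_trans (AM _))// ler_wpM2l ?(ltW M0)//.
  have [_ _ UV VU _] := uU.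
  by rewrite -[in leRHS](VU x) semiunitary_norm.
Qed.
End Semiunitary.

Definition sandwich s U V (uU : semiunitary s U V) A := Bop (sandwich_subproof uU A).

Lemma conjugation_semiunitary J : semiunitary Num.conj J J.
Proof.
case: J => J lJ JK Ji; split=> //; first by right.
by move=> x y /=; rewrite Ji [LHS]innerC.
Qed.

Lemma conjugation_eq J1 J2 : (forall x, J1 x = J2 x) -> J1 = J2.
Proof.
case: J1 => [f ? ? ?]; case: J2 => [g ? ? ?] /= /funext fg; move: fg => fg.
by subst g; congr Conjugation; exact: Prop_irrelevance.
Qed.

Lemma conjugationK J x : J (J x) = x.
Proof. by case: J => J lJ JK Ji /=; rewrite JK. Qed.

Lemma conjugation_inner J x y : '[J x, J y] = '[y, x].
Proof. by case: J. Qed.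

Lemma conjugation_innerl J x y : '[J x, y] = '[J y, x].
Proof. by rewrite -{1}(conjugationK J y) conjugation_inner. Qed.

Lemma conjugation_lin J a x y : J (a *: x + y) = a^* *: J x + J y.
Proof. by case: J => J lJ JK Ji /=; rewrite lJ. Qed.

Lemma conjugation_scale J a x : J (a *: x) = a^* *: J x.
Proof.
have J0 : J 0 = 0.
  by apply: inner_eq0; rewrite conjugation_inner inner0l.
by rewrite -[a *: x]addr0 conjugation_lin J0 addr0.
Qed.

Lemma conjugation_add J x y : J (x + y) = J x + J y.
Proof. by rewrite -[x]scale1r conjugation_lin rmorph1 !scale1r. Qed.

Lemma conjugation_sub J x y : J (x - y) = J x - J y.
Proof. by rewrite addrC -scaleN1r conjugation_lin rmorphN rmorph1 scaleN1r addrC. Qed.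

(** The unitary involution 2Q - 1 composed with J is a conjugation because the two
    commute; every conjugation commuting with J arises in this way. *)
Lemma flip_subproof J Q : is_proj Q ->
  (forall x, J (Q x) = Q (J x)) ->
  [/\ antilinear (fun x => (Q (J x) + Q (J x)) - J x),
   involutive (fun x => (Q (J x) + Q (J x)) - J x) &
   forall x y, '[(Q (J x) + Q (J x)) - J x, (Q (J y) + Q (J y)) - J y] = '[y, x]].
Proof.
move=> [QQ Qs] JQ; split=> [a x y|x|x y].
- rewrite conjugation_lin bop_add bop_scale /=.
  by apply: inner_ext => z; rewrite !(innerBl, innerDl, innerZl); ring.
- rewrite conjugation_sub conjugation_add !JQ !conjugationK !bop_sub bop_add !QQ.
  by apply: inner_ext => z; rewrite !(innerBl, innerDl, innerZl); ring.
- rewrite !(innerBl, innerBr, innerDl, innerDr) !Qs !QQ conjugation_inner.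
  by ring.
Qed.

Definition flip J Q (pQ : is_proj Q) (JQ : forall x, J (Q x) = Q (J x)) : conjugation H :=
  let: And3 h1 h2 h3 := flip_subproof pQ JQ in Conjugation h1 h2 h3.

Lemma flipE J Q (pQ : is_proj Q) (JQ : forall x, J (Q x) = Q (J x)) x :
  flip pQ JQ x = Q (J x) + Q (J x) - J x.
Proof. by rewrite /flip; case: flip_subproof. Qed.

(** A vector w of the span is not closer to z than the partial Fourier sum p of
    z over the indices involved in w, and the squared distance from z to p is
    that of the norms; now let w tend to z. *)
Lemma parseval_le e z (M : C) :
  (forall s, uniq s -> \sum_(i <- s) `|'[z, e i]| ^+ 2 <= M) -> '[z, z] <= M.
Proof.
move=> zM; apply/ler_addgt0Pl => eps eps0.
have s0 : 0 < sqrtC eps by rewrite sqrtC_gt0.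
have de : dense (linspan e) by case: (e).
have [w [zw [s [k wE]]]] :=
  de (ball z (sqrtC eps)) (ex_intro _ z (ballxx z s0)) (ball_open z _).
move: zw; rewrite -ball_normE /= => zw.
pose p := \sum_(i <- undup s) '[z, e i] *: e i.
have ze i : i \in s -> '[z - p, e i] = 0.
  move=> js; rewrite innerBl (inner_lincomb (@onb_inner _ _ e))// ?undup_uniq ?mem_undup//.
  by rewrite subrr.
have zw0 : '[z - p, p - w] = 0.
  rewrite wE innerBr !inner_sumr !big1_seq ?subrr// => i /andP[_ js].
    by move: js; rewrite ?mem_undup => js; rewrite innerZr ze ?mulr0.
  by move: js; rewrite ?mem_undup => js; rewrite innerZr ze ?mulr0.
have zpp : '[z - p, p] = 0.
  by rewrite inner_sumr big1_seq// => i /andP[_ js]; rewrite innerZr ze ?mulr0// -mem_undup.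
rewrite -[X in '[X, _]](subrK p) -[X in '[_, X]](subrK p) pythagoras// lerD//; last first.
  by rewrite /p (norm_lincomb (@onb_inner _ _ e) (fun i => '[z, e i])) ?undup_uniq// zM ?undup_uniq.
rewrite (le_trans (y := '[z - w, z - w]))//.
  by rewrite -(subrKA p z (- w)) (pythagoras zw0) lerDl inner_ge0.
rewrite -inner_normE -[leRHS]sqrtCK ler_pXn2r// ?nnegrE//; first exact: ltW.
exact: ltW s0.
Qed.

(** Conjugation of the coordinates. Its isometry is the polarized Parseval
    identity: it is clear when x is in the span, and both sides are bounded in x. *)
Lemma onb_conjugation e : exists J, forall i, J (e i) = e i.
Proof.
have oe := @onb_inner _ _ e.
have bes x (s : seq (seq_index (onb_length e))) : uniq s ->
    \sum_(i <- s) `|('[x, e i])^*| ^+ 2 <= '[x, x].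
  move=> us; under eq_bigr do rewrite norm_conjC.
  exact: bessel.
have /choice[J JE] : forall x, exists y, forall i, '[y, e i] = ('[x, e i])^*.
  by move=> x; have [y [yE _]] := riesz_fischer oe (bes x); exists y.
have lJ : antilinear J.
  move=> a x y; apply: (onb_extl (e := e)) => i.
  by rewrite /= JE !innerDl !innerZl !JE rmorphD rmorphM.
have JK : involutive J by move=> x; apply: (onb_extl (e := e)) => i; rewrite !JE conjCK.
have Je i : J (e i) = e i.
  by apply: (onb_extl (e := e)) => j; rewrite JE onb_inner; case: eqVneq => _; rewrite ?rmorph1 ?rmorph0.
have nJ x : '[J x, J x] <= '[x, x].
  by apply: (@parseval_le e) => s us; under eq_bigr do rewrite JE; exact: bes.
have nJ' x : `|J x| <= `|x|.
  by rewrite -(@ler_pXn2r _ 2)// ?nnegrE// !inner_normE.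
have JB x y : J (x - y) = J x - J y.
  by rewrite addrC -scaleN1r lJ /= rmorphN rmorph1 scaleN1r addrC.
have J0 : J 0 = 0 by have := JB 0 0; rewrite !subrr.
have Ji x y : '[J x, J y] = '[y, x].
  apply/eqP; rewrite -subr_eq0; apply/eqP; move: x.
  have K0 : 0 < `|J y| + `|y| + 1 by rewrite ltr_wpDl// addr_ge0.
  apply: (@bounded_map_onb_eq0 _ _ e C^o (fun x => '[J x, J y] - '[y, x]) _ K0).
  - by move=> u v; rewrite JB !innerBl innerBr opprD addrACA [in RHS]opprD.
  - move=> x; rewrite (le_trans (ler_normB _ _))//.
    rewrite 2!mulrDl mul1r -[leLHS]addr0 lerD// lerD//.
      by rewrite (le_trans (cauchy_schwarz _ _))// mulrC ler_wpM2l.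
    by rewrite (le_trans (cauchy_schwarz _ _)).
  - move=> x [s [k ->]].
    have -> : J (\sum_(i <- s) k i *: e i) = \sum_(i <- s) (k i)^* *: e i.
      elim: s => [|i s IH]; first by rewrite !big_nil J0.
      by rewrite !big_cons lJ IH Je.
    rewrite inner_suml inner_sumr -sumrB big1// => i _.
    by rewrite innerZl innerZr [X in _ * X]innerC JE conjCK subrr.
by exists (Conjugation lJ JK Ji).
Qed.

Definition fixes_lines J e := forall i, exists c, J (e i) = c *: e i.

Hypothesis sepH : separable H.

Lemma proj_adjoint P : is_proj P -> adjoint P = P.
Proof. by move=> [_ Ps]; apply: adjoint_unique => // x y; rewrite Ps. Qed.

Lemma csymP J A : csymmetric_op J A <-> forall x, J (A (J x)) = adjoint A x.
Proof.
split=> [+ x|JA]; first by move=> /(congr1 (fun f => f x)).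
by apply/funext => x; exact: JA.
Qed.

Lemma csym_lin J a A B : csymmetric_op J A -> csymmetric_op J B ->
  csymmetric_op J (a *: A + B).
Proof.
move=> /csymP JA /csymP JB; apply/csymP => x.
by rewrite adjointD// adjointZ// !bopE conjugation_lin JA JB.
Qed.

Lemma csym_scalar J a : csymmetric_op J (a *: I).
Proof.
apply/csymP => x; rewrite adjointZ// adjoint_id// !bopE !bop_idE.
by rewrite conjugation_scale conjugationK.
Qed.

Lemma csym_id J : csymmetric_op J I.
Proof. by rewrite -[I]scale1r; exact: csym_scalar. Qed.

Lemma csym_sq J A : csymmetric_op J A -> csymmetric_op J (bop_comp A A).
Proof.
move=> /csymP JA; apply/csymP => x; rewrite adjoint_comp// !bop_compE -!JA.
by rewrite conjugationK.
Qed.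

Lemma csym_adjoint J A : csymmetric_op J A -> csymmetric_op J (adjoint A).
Proof.
by move=> /csymP JA; apply/csymP => x; rewrite adjointK// -JA !conjugationK.
Qed.

Lemma csym_proj J P : is_proj P -> csymmetric_op J P -> forall x, J (P x) = P (J x).
Proof.
move=> pP /csymP JP x; have := JP (J x).
by rewrite proj_adjoint// conjugationK.
Qed.

(** In terms of the eigenvalues, J A J and the adjoint of A both have the
    conjugate eigenvalues in the basis e. *)
Lemma diag_csym J e A : fixes_lines J e -> diagonal_op e A -> csymmetric_op J A.
Proof.
move=> Je dA; apply/csymP => x.
rewrite -[LHS]/(sandwich (conjugation_semiunitary J) A x); congr (bop_fun _ x).
apply: (bop_ext_onb (e := e)) => i.
have [c Jc] := Je i; have /diag_eig/(_ i)[a Aa] := dA.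
have cc : c^* * c = 1.
  have := @onb_unit _ _ e i; rewrite -(conjugation_inner J) Jc innerZl innerZr onb_unit mulr1.
  by rewrite mulrC.
rewrite /= Jc bop_scale Aa scalerA conjugation_scale Jc scalerA rmorphM/= mulrAC cc mul1r.
apply: (onb_extl (e := e)) => j; rewrite -adjointEr// innerZl onb_inner.
have /diag_eig/(_ j)[b Bb] := dA; rewrite Bb innerZr onb_inner.
by case: eqVneq => [ij|]; rewrite ?mulr0// -{}ij in Bb *; rewrite !mulr1;
  have := congr1 (fun u => '[u, e i]) Aa; rewrite Bb !innerZl onb_unit !mulr1 => ->.
Qed.

(** In a basis fixed by J this says that the matrix of A is symmetric. *)
Lemma csym_transpose J A x y : csymmetric_op J A -> '[A x, y] = '[A (J y), J x].
Proof.
move=> /csymP JA; rewrite adjointE// -JA -[in RHS](conjugationK J (A (J y))).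
by rewrite conjugation_inner.
Qed.

(** The sign change is made with the projection onto the complement of e n,
    which commutes with J. *)
Lemma onb_flip e J n : (forall i, J (e i) = e i) ->
  exists Jn : conjugation H, forall x, Jn x = J x - 2%:R *: ('[J x, e n] *: e n).
Proof.
move=> Je; pose Q := I - ketbra (e n) (e n).
have pQ : is_proj Q by apply/proj_compl/proj_ketbra/onb_unit.
have JQ x : J (Q x) = Q (J x).
  rewrite /Q !bopE !bop_idE !ketbraE conjugation_sub conjugation_scale Je.
  by rewrite (conjugation_innerl J x) Je -innerC.
exists (flip pQ JQ) => x; rewrite flipE /Q !bopE !bop_idE !ketbraE.
by apply: inner_ext => z; rewrite !(innerBl, innerDl, innerZl); ring.
Qed.

(** For the conjugation of the coordinates the matrix of X is symmetric; with
    the sign of the i-th coordinate changed, the entries (i, j) and (j, i) are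
    opposite as well, so they vanish. *)
Lemma csym_all_diag e X : (forall J, fixes_lines J e -> csymmetric_op J X) ->
  diagonal_op e X.
Proof.
move=> JX i j ij; have [J Je] := onb_conjugation e; have [Ji JiE] := onb_flip i Je.
have Jil k : Ji (e k) = e k - 2%:R *: ((k == i)%:R *: e i) by rewrite JiE Je onb_inner.
have Jk k : k != i -> Ji (e k) = e k by move=> /negbTE ki; rewrite Jil ki scale0r scaler0 subr0.
have Jii : Ji (e i) = - e i.
  by rewrite Jil eqxx scale1r scaler_nat mulr2n opprD addNKr.
have X1 := csym_transpose (e j) (e i) (JX J (fun k => ex_intro _ 1 (etrans (Je k) (esym (scale1r _))))).
have fJi : fixes_lines Ji e.
  move=> k; have [->|ki] := eqVneq k i; first by exists (-1); rewrite Jii scaleN1r.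
  by exists 1; rewrite Jk// scale1r.
have X2 := csym_transpose (e j) (e i) (JX Ji fJi).
move: X2; rewrite Jii Jk; last by rewrite eq_sym.
rewrite bop_opp innerNl => X2; move: X1; rewrite !Je => X1.
have : '[X (e j), e i] *+ 2 = 0 by rewrite mulr2n {1}X1 X2 subrr.
by move/eqP; rewrite mulrn_eq0 => /eqP.
Qed.

End Conjugations.

(** * Preservers send projections to affine images of projections *)

Section Compatible.
Variables (R : realType) (H : hilbertType R).
Local Notation C := R[i].
Implicit Types (x y z : H) (a : C) (A B P Q : bop H) (e : onbasis H) (J : conjugation H).
Local Notation I := (bop_id H).

(** What a map that preserves the algebras of diagonal operators and one that
    preserves the spaces of symmetric operators have in common; all later
    arguments only use this. *)
Definition compatible (T : bop H -> bop H) :=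
  [/\ exists c, T I = c *: I,
      forall P, is_proj P -> exists a b Q, is_proj Q /\ T P = a *: I + b *: Q &
      forall e A P, is_proj P -> diagonal_op e A -> diagonal_op e P ->
        commuting (T A) (T P)].

Hypothesis sepH : separable H.
Variable T : {linear bop H -> bop H}.
Hypothesis injT : injective T.

Lemma linear_two_terms a b A B : T (a *: A + b *: B) = a *: T A + b *: T B.
Proof. by rewrite linearD !linearZ. Qed.

(** For a projection P let X be the operator with T X = (T P)^2. It is diagonal
    in every basis in which P is, hence a combination of I and P; so T P is a
    diagonal operator satisfying a quadratic equation. *)
Lemma basis_preserver_compatible (phi : onbasis H -> onbasis H) :
  bijective phi -> (forall e, T @` diagonal_op e = diagonal_op (phi e)) ->
  compatible T.
Proof.
move=> [g gK Kg] Tphi.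
have Td e A : diagonal_op e A -> diagonal_op (phi e) (T A).
  by move=> dA; rewrite -Tphi; exists A.
have dT e A : diagonal_op (phi e) (T A) -> diagonal_op e A.
  by rewrite -Tphi => -[B dB /injT <-].
have TI : exists c, T I = c *: I.
  apply: (diag_all_scalar sepH) => e; rewrite -(Kg e); apply: Td; exact: diag_id.
split=> // [P pP|e A P _ dA dP]; last by apply: diag_commute; apply: Td; eauto.
have [c TIc] := TI.
have [e0 [dP _]] := common_basis sepH pP (proj_id H) (fun x => erefl).
have nB : commuting (T P) (adjoint (T P)).
  by apply: diag_commute (Td _ _ dP) _; apply: diag_adjoint => //; exact: Td.
have : diagonal_op (phi e0) (bop_comp (T P) (T P)) by apply: diag_comp; exact: Td.
rewrite -Tphi => -[X _ TX].
have [|a [b Xab]] := in_diag_span sepH (X := X) pP.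
  by move=> e deP; apply: dT; rewrite TX; apply: diag_comp; exact: Td.
apply: (normal_quadratic sepH nB (al := a * c) (be := b)) => x.
by rewrite -bop_compE -TX Xab linear_two_terms TIc !bopE bop_idE scalerA.
Qed.

(** An operator X that is symmetric for all conjugations for which P is symmetric
    is diagonal in every basis in which P is, hence a combination of I and P.
    This applies to the preimages of the square and of the adjoint of T P, so
    that T P is normal and satisfies a quadratic equation: T P = a + b Q.

    For the commutation, let J0 be the conjugation of the coordinates in a basis
    that diagonalizes A and P, and let D0 = (2Q - 1) psi(J0). It commutes with
    the images of J0 and of all its sign changes, so its preimage under psi
    commutes with J0 and its sign changes and thus maps each basis vector to a
    multiple of itself. Consequently A is symmetric for this preimage, and T A
    is symmetric both for psi(J0) and for D0, which means that it commutes with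
    2Q - 1. *)
Lemma conjugation_preserver_compatible (psi : conjugation H -> conjugation H) :
  bijective psi -> preserves_commutativity psi ->
  (forall J, T @` csymmetric_op J = csymmetric_op (psi J)) ->
  compatible T.
Proof.
move=> [g gK Kg] cpsi Tpsi.
have Ts J A : csymmetric_op J A -> csymmetric_op (psi J) (T A).
  by move=> dA; rewrite -Tpsi; exists A.
have sT J A : csymmetric_op (psi J) (T A) -> csymmetric_op J A.
  by rewrite -Tpsi => -[B dB /injT <-].
have [c TIc] : exists c, T I = c *: I.
  apply: (diag_all_scalar sepH) => e; apply: (csym_all_diag sepH) => J _.
  by rewrite -(Kg J); apply: Ts; exact: csym_id.
have fixJ e J : (forall i, J (e i) = e i) -> fixes_lines J e.
  by move=> Je i; exists 1; rewrite scale1r.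
have pre P X B : is_proj P -> T X = B ->
    (forall J, csymmetric_op J (T P) -> csymmetric_op J B) ->
    exists a b, B = a *: I + b *: T P.
  move=> pP TX JB; have [e deP|a [b Xab]] := in_diag_span sepH (X := X) pP.
    apply: (csym_all_diag sepH) => J Je; apply: sT; rewrite TX; apply/JB/Ts.
    exact: (diag_csym sepH Je).
  by exists (a * c), b; rewrite -TX Xab linear_two_terms TIc scalerA.
have TP P : is_proj P -> exists a b Q, is_proj Q /\ T P = a *: I + b *: Q.
  move=> pP.
  have [e0 [dP _]] := common_basis sepH pP (proj_id H) (fun x => erefl).
  have [J0 Je0] := onb_conjugation e0.
  have sP : csymmetric_op (psi J0) (T P).
    by apply: Ts; apply: (diag_csym sepH _ dP); exact: fixJ.
  have : csymmetric_op (psi J0) (bop_comp (T P) (T P)) by exact: csym_sq.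
  rewrite -Tpsi => -[X _ TX].
  have [|a [b ab]] := pre P X _ pP TX; first by move=> J; exact: csym_sq.
  have : csymmetric_op (psi J0) (adjoint (T P)) by exact: csym_adjoint.
  rewrite -Tpsi => -[Y _ TY].
  have [|a' [b' ab']] := pre P Y _ pP TY; first by move=> J; exact: csym_adjoint.
  apply: (normal_quadratic sepH (al := a) (be := b)) => x.
    by rewrite ab' !bopE !bop_idE bop_add !bop_scale.
  by rewrite -bop_compE ab !bopE bop_idE.
split=> //; first by exists c.
move=> e A P pP dA dP; have [a [b [Q [pQ TPE]]]] := TP P pP.
suff [b0|cQ] : b = 0 \/ commuting (T A) Q.
- by move=> x; rewrite TPE b0 scale0r addr0 !bopE !bop_idE bop_scale.
- by move=> x; rewrite TPE !bopE !bop_idE bop_add !bop_scale cQ.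
have [b0|b0] := eqVneq b 0; [by left|right].
have [J0 Je0] := onb_conjugation e.
have sQ J : fixes_lines J e -> csymmetric_op (psi J) Q.
  move=> Je; have -> : Q = b^-1 *: T P + (- (a / b)) *: I.
    apply: bopP => x; rewrite TPE !bopE !bop_idE.
    by apply: inner_ext => y; rewrite !(innerDl, innerZl); field.
  apply: (csym_lin sepH); last exact: csym_scalar.
  by apply: Ts; exact: (diag_csym sepH Je).
have DQ J Je := csym_proj sepH pQ (sQ J Je).
pose D0 := flip pQ (DQ J0 (fixJ e J0 Je0)).
have D0E x : D0 x = Q (psi J0 x) + Q (psi J0 x) - psi J0 x by exact: flipE.
(* Jn changes the sign of the n-th coordinate; as psi Jn commutes with psi J0 and
   with Q, it commutes with D0. *)
have J0D0 : forall n, exists2 Jn : conjugation H, fixes_lines Jn e &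
    (forall x, Jn x = J0 x - 2%:R *: ('[J0 x, e n] *: e n)) /\
    (forall x, psi Jn (D0 x) = D0 (psi Jn x)).
  move=> n; have [Jn JnE] := onb_flip n Je0.
  have fJn : fixes_lines Jn e.
    move=> k; rewrite JnE Je0 onb_inner; case: eqVneq => [->|_].
      by exists (-1); rewrite scale1r scaler_nat mulr2n opprD addNKr scaleN1r.
    by exists 1; rewrite scale0r scaler0 subr0 scale1r.
  exists Jn => //; split=> // x.
  have JJ : Jn \o J0 = J0 \o Jn.
    apply/funext => y /=; rewrite !JnE conjugation_sub !conjugation_scale !conjugationK Je0.
    by rewrite conjugation_innerl Je0 -innerC rmorph_nat.
  have /(congr1 (fun f => f x)) /= pJJ := (cpsi Jn J0).1 JJ.
  by rewrite !D0E conjugation_sub conjugation_add !DQ// pJJ.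
have [J'' J''E] : exists J'', psi J'' = D0 by exists (g D0).
(* Commuting with J0 and Jn, J'' commutes with the reflection of the n-th
   coordinate, whose eigenspaces are the line of e n and its complement. *)
have fJ'' : fixes_lines J'' e.
  move=> n; have [Jn fJn [JnE Jn0]] := J0D0 n.
  have c1 : J'' \o Jn = Jn \o J''.
    by apply/cpsi/funext => x /=; rewrite J''E Jn0.
  have c2 : J'' \o J0 = J0 \o J''.
    apply/cpsi/funext => x /=; rewrite J''E !D0E conjugation_sub conjugation_add.
    by rewrite !(DQ J0 (fixJ e J0 Je0)) !conjugationK.
  pose v := J'' (e n); have v0 : J0 v = v.
    by have /= := congr1 (fun f => f (e n)) c2; rewrite Je0.
  have vE : - v = v - 2%:R *: ('[v, e n] *: e n).
    rewrite -{2 3}v0 -JnE; have /= <- := congr1 (fun f => f (e n)) c1.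
    rewrite JnE Je0 onb_unit scale1r scaler_nat mulr2n opprD addNKr.
    by rewrite -[- e n]scaleN1r conjugation_scale rmorphN rmorph1 scaleN1r.
  have n2 : (2%:R : C) != 0 by rewrite pnatr_eq0.
  exists '[v, e n]; apply: (scalerI n2).
  by rewrite -[RHS]opprK -[X in - X](addKr v) -vE opprD !opprK scaler_nat mulr2n.
have sA : csymmetric_op D0 (T A).
  by rewrite -J''E; apply: Ts; exact: (diag_csym sepH fJ'').
have s0 : csymmetric_op (psi J0) (T A).
  by apply: Ts; exact: (diag_csym sepH (fixJ e J0 Je0)).
have QA x : adjoint (T A) (Q x) = Q (adjoint (T A) x).
  pose W y := Q y + Q y - y; pose J := psi J0.
  have WW y : W (W y) = y.
    rewrite /W bop_sub !bop_add pQ.1.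
    by apply: inner_ext => z; rewrite !(innerBl, innerDl); ring.
  have JW y : J (W y) = W (J y).
    by rewrite /W conjugation_sub conjugation_add (DQ J0 (fixJ e J0 Je0)).
  have aW y : adjoint (T A) (W y) = W (adjoint (T A) y).
    have /csymP/(_ (W y)) <- := sA; have /csymP/(_ y) <- := s0.
    have D0W z : D0 z = W (J z) by exact: D0E.
    by rewrite (D0W (W y)) -(JW (W y)) WW D0W.
  have := aW x; rewrite /W !bop_sub !bop_add => /addIr aQ2.
  have n2 : (2%:R : C) != 0 by rewrite pnatr_eq0.
  by apply: (scalerI n2); rewrite !scaler_nat !mulr2n.
move=> x; apply: inner_ext => y.
by rewrite pQ.2 !(adjointE sepH (T A)) QA pQ.2.
Qed.

End Compatible.

(** * Images of rank-one projections *)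

Section OrthogonalCombination.
Variables (R : realType) (H : hilbertType R).
Local Notation C := R[i].

(** There are more unknowns than equations. *)
Lemma orthogonal_combination n (v : 'I_n.+1 -> H) (w : 'I_n -> H) :
  exists2 c : 'I_n.+1 -> C, exists i, c i != 0 &
    forall j, '[\sum_i c i *: v i, w j] = 0.
Proof.
pose M : 'M[C]_(n.+1, n) := \matrix_(i, j) '[v i, w j].
have : kermx M != 0.
  by rewrite -mxrank_eq0 mxrank_ker subn_eq0 -ltnNge (leq_ltn_trans (rank_leq_col M)).
move=> /rowV0Pn[c /sub_kermxP cM c0]; exists (fun i => c 0 i).
  apply: contrapT => nc; move/eqP: c0; apply; apply/rowP => i; rewrite mxE.
  by apply: contrapT => /eqP ci; apply: nc; exists i.
move=> j; rewrite inner_suml.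
transitivity ((c *m M) 0 j); last by rewrite cM mxE.
rewrite mxE; by apply: eq_bigr => i _; rewrite innerZl mxE.
Qed.

(** How the dimension of H enters: there is always room for one more direction. *)
Lemma dim3_orthogonal : dim_ge H 3 -> forall x y : H,
  exists z, [/\ '[z, z] = 1, '[z, x] = 0 & '[z, y] = 0].
Proof.
move=> [v freev] x y.
have [c [i ci] cw] := orthogonal_combination v (fun j : 'I_2 => if j == 0 then x else y).
pose z := \sum_i c i *: v i; have z0 : z != 0.
  by apply/eqP => z0; move: ci; rewrite (freev c z0) eqxx.
have zx : '[z, x] = 0 by exact: (cw 0).
have zy : '[z, y] = 0 by exact: (cw 1).
exists (normalized z); split; first exact: normalized_unit.
  by rewrite innerZl zx mulr0.
by rewrite innerZl zy mulr0.
Qed.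

End OrthogonalCombination.

Section RankOne.
Variables (R : realType) (H : hilbertType R).
Local Notation C := R[i].
Implicit Types (x y z : H) (a : C) (A B P Q : bop H) (e : onbasis H).
Local Notation I := (bop_id H).
Hypothesis sepH : separable H.
Hypothesis dim3 : forall x y : H,
  exists z, [/\ '[z, z] = 1, '[z, x] = 0 & '[z, y] = 0].

Lemma ketbra_nonscalar x c : '[x, x] = 1 -> ketbra x x <> c *: I.
Proof.
move=> x1 xc; have [z [z1 zx _]] := dim3 x x.
have := congr1 (fun A : bop H => A z) xc; rewrite ketbraE !bopE bop_idE zx scale0r.
move=> /esym/eqP; rewrite scaler_eq0 (negbTE (inner1_neq0 z1)) orbF => /eqP c0.
have := congr1 (fun A : bop H => A x) xc; rewrite ketbraE !bopE x1 scale1r c0 scale0r.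
by apply/eqP/inner1_neq0.
Qed.

Lemma proj_two_vectors Q : is_proj Q -> Q <> 0 ->
  (forall u, '[u, u] = 1 -> Q <> ketbra u u) ->
  exists u v, [/\ '[u, u] = 1, '[v, v] = 1, '[v, u] = 0, Q u = u & Q v = v].
Proof.
move=> pQ Q0 nQ; have [x Qx] : exists x, Q x <> 0.
  by apply: contrapT => nx; apply: Q0; apply: bopP => x; apply: contrapT => Qx; apply: nx; exists x.
pose u := normalized (Q x); have u1 : '[u, u] = 1 by apply: normalized_unit; apply/eqP.
have Qu : Q u = u by rewrite /u bop_scale pQ.1.
have [y Qy] : exists y, Q y - ketbra u u y <> 0.
  apply: contrapT => ny; apply: (nQ u u1); apply: bopP => y; apply: contrapT => Qy.
  by apply: ny; exists y => /eqP; rewrite subr_eq0 => /eqP.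
pose w := Q y - ketbra u u y; have wu : '[w, u] = 0.
  by rewrite innerBl ketbraE innerZl u1 mulr1 pQ.2 Qu subrr.
exists u, (normalized w); split=> //; first by apply: normalized_unit; apply/eqP.
  by rewrite innerZl wu mulr0.
by rewrite bop_scale /w bop_sub pQ.1 ketbraE bop_scale Qu.
Qed.

Lemma two_eigenvalues a b P v (l : C) : is_proj P -> v != 0 ->
  (a *: I + b *: P) v = l *: v -> l = a \/ l = a + b.
Proof.
move=> pP v0; rewrite !bopE bop_idE => E.
have bP : b *: P v = (l - a) *: v by rewrite scalerBl -E addrC addKr.
have : (l - a - b) *: P v = 0.
  by rewrite scalerBl bP -bop_scale -bP bop_scale pP.1 subrr.
move/eqP; rewrite scaler_eq0 => /orP[|/eqP Pv]; first
  by rewrite subr_eq0 subr_eq => /eqP; right; rewrite addrC.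
move: bP; rewrite Pv scaler0 => /esym/eqP.
by rewrite scaler_eq0 (negbTE v0) orbF subr_eq0 => /eqP; left.
Qed.

Lemma pigeonhole2 (T : Type) (u v w a b : T) : u <> v -> u <> w ->
  u = a \/ u = b -> v = a \/ v = b -> w = a \/ w = b -> v = w.
Proof. by move=> uv uw [ua|ub] [va|vb] [wa|wb]; congruence. Qed.

Section Pair.
Variables T T' : {linear bop H -> bop H}.
Hypotheses (TK : cancel T T') (TK' : cancel T' T).
Hypotheses (cT : compatible T) (cT' : compatible T').

Lemma compatible_scalar A c : T A = c *: I -> exists d, A = d *: I.
Proof.
move=> TA; have [[d dE] _ _] := cT'; exists (c * d).
by rewrite -(TK A) TA linearZ/= dE scalerA.
Qed.

Lemma compatible_commuting P Q : is_proj P -> is_proj Q -> commuting P Q ->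
  commuting (T P) (T Q).
Proof.
move=> pP pQ cPQ; have [e [dP dQ]] := common_basis sepH pP pQ cPQ.
by have [_ _] := cT; apply; eauto.
Qed.

End Pair.

Lemma commuting_affine a b a' b' P Q : b != 0 -> b' != 0 ->
  commuting (a *: I + b *: P) (a' *: I + b' *: Q) -> commuting P Q.
Proof.
move=> b0 b0' cPQ x; apply: (scalerI b0); apply: (scalerI b0').
move: (cPQ x); rewrite !bopE !bop_idE !bop_add !bop_scale => E.
apply: inner_ext => y; have := congr1 (fun u => '[u, y]) E.
rewrite !(innerDl, innerZl) => {}E; apply/eqP; rewrite -subr_eq0; apply/eqP.
by move/eqP: E; rewrite -subr_eq0 => /eqP <-; ring.
Qed.

Section Image.
Variables T T' : {linear bop H -> bop H}.
Hypotheses (TK : cancel T T') (TK' : cancel T' T).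
Hypotheses (cT : compatible T) (cT' : compatible T').

(** A projection S commuting with a projection P onto a line has S + P or S - P as
    a projection, so T maps a combination of S and P with nonzero coefficients to
    an operator with at most two eigenvalues. If Q and 1 - Q both had two
    orthonormal vectors in their ranges, take R' with range spanned by n1 and m1
    and let S come from the preimage of R'. A combination of Q and R' has at n1,
    n2, m1, m2 the eigenvalues p + q, q, p, 0 up to a constant, and with p and q
    nonzero these are never only two numbers. *)
Lemma no_four_atoms x a b Q n1 n2 m1 m2 : '[x, x] = 1 -> is_proj Q -> b != 0 ->
  T (ketbra x x) = a *: I + b *: Q ->
  [/\ '[n1, n1] = 1, '[n2, n2] = 1, '[n2, n1] = 0, Q n1 = n1 & Q n2 = n2] ->
  [/\ '[m1, m1] = 1, '[m2, m2] = 1, '[m2, m1] = 0, Q m1 = 0 & Q m2 = 0] ->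
  False.
Proof.
move=> x1 pQ b0 TPx [n11 n22 n21 Qn1 Qn2] [m11 m22 m21 Qm1 Qm2].
pose R' := ketbra n1 n1 + ketbra m1 m1.
have nm u v : Q u = u -> Q v = 0 -> '[u, v] = 0 by exact: proj_orth.
have mn u v : Q u = u -> Q v = 0 -> '[v, u] = 0 by move=> Qu Qv; exact/inner_eq0C/nm.
have pR : is_proj R'.
  apply: proj_add; [exact: proj_ketbra|exact: proj_ketbra|move=> y].
  by rewrite !ketbraE innerZl (mn _ _ Qn1 Qm1) mulr0 scale0r.
have cQR : commuting Q R'.
  move=> y; rewrite /R' !bopE !ketbraE bop_add !bop_scale Qn1 Qm1 scaler0 addr0.
  by rewrite pQ.2 Qn1 pQ.2 Qm1 inner0r scale0r addr0.
have Rn1 : R' n1 = n1.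
  by rewrite /R' !bopE !ketbraE n11 (nm _ _ Qn1 Qm1) scale1r scale0r addr0.
have Rn2 : R' n2 = 0.
  by rewrite /R' !bopE !ketbraE n21 (nm _ _ Qn2 Qm1) !scale0r addr0.
have Rm1 : R' m1 = m1.
  by rewrite /R' !bopE !ketbraE m11 (mn _ _ Qn1 Qm1) scale1r scale0r add0r.
have Rm2 : R' m2 = 0.
  by rewrite /R' !bopE !ketbraE m21 (mn _ _ Qn1 Qm2) !scale0r addr0.
clearbody R'; have [[c TI] Tproj _] := cT; have [[c' T'I] T'proj _] := cT'.
have [a' [b' [S [pS T'R]]]] := T'proj _ pR.
have b'0 : b' != 0.
  apply/eqP => b'0; have RE : R' = (a' * c) *: I.
    by rewrite -(TK' R') T'R b'0 scale0r addr0 linearZ/= TI scalerA.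
  move: Rn1 Rn2; rewrite RE !bopE !bop_idE => r1 /eqP.
  rewrite scaler_eq0 (negbTE (inner1_neq0 n22)) orbF => /eqP r2.
  by move: r1; rewrite r2 scale0r => /esym/eqP; apply/negP/inner1_neq0.
have T'Q : T' Q = (- (a / b * c')) *: I + b^-1 *: ketbra x x.
  have -> : Q = (- (a / b)) *: I + b^-1 *: T (ketbra x x).
    apply: bopP => y; rewrite TPx !bopE !bop_idE.
    by apply: inner_ext => w; rewrite !(innerDl, innerZl); field.
  by rewrite linear_two_terms TK T'I scalerA mulNr.
(* S is the projection for R' under the inverse of T, as ketbra x x is for Q. *)
have cS : commuting (ketbra x x) S.
  have cc := compatible_commuting cT' pQ pR cQR; rewrite T'Q T'R in cc.
  by apply: (commuting_affine _ b'0 cc); rewrite invr_eq0.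
have Sx : S x = '[S x, x] *: x.
  by have := cS x; rewrite !ketbraE x1 scale1r.
(* x is an eigenvector of S, with eigenvalue 0 or 1. *)
have [eps eps0 pZ] : exists2 eps : C, eps != 0 & is_proj (S + eps *: ketbra x x).
  have [Sx1|Sx1] : '[S x, x] = 0 \/ '[S x, x] = 1.
    have : '[S (S x), x] = '[S x, x] by rewrite pS.1.
    rewrite {1}Sx bop_scale innerZl => /eqP.
    rewrite -subr_eq0 -[X in _ - X]mulr1 -mulrBr mulf_eq0 subr_eq0.
    by case/orP => /eqP; [left|right].
  - exists 1; first exact: oner_neq0.
    rewrite scale1r; apply: proj_add => //; first exact: proj_ketbra.
    by move=> y; rewrite ketbraE bop_scale Sx Sx1 scale0r scaler0.
  - exists (-1); first by rewrite oppr_eq0 oner_neq0.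
    rewrite scaleN1r; apply: proj_sub => //; first exact: proj_ketbra.
    by move=> y; rewrite ketbraE bop_scale Sx Sx1 scale1r.
have [a2 [b2 [Z' [pZ' TZ]]]] := Tproj _ pZ.
have TS : T S = b'^-1 *: R' + (- (a' * c / b')) *: I.
  have -> : S = b'^-1 *: T' R' + (- (a' / b')) *: I.
    apply: bopP => y; rewrite T'R !bopE !bop_idE.
    by apply: inner_ext => w; rewrite !(innerDl, innerZl); field.
  by rewrite linear_two_terms TK' TI scalerA; congr (_ + _ *: _); ring.
pose s := - (a' * c / b') + eps * a; pose p := b'^-1; pose q := eps * b.
have TZE : a2 *: I + b2 *: Z' = p *: R' + (s *: I + q *: Q).
  rewrite -TZ linearD linearZ/= TS TPx.
  apply: bopP => y; rewrite !bopE !bop_idE.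
  by apply: inner_ext => w; rewrite !(innerDl, innerZl) /s /p /q; ring.
have ev v r k : v != 0 -> R' v = r *: v -> Q v = k *: v ->
    p * r + (s + q * k) = a2 \/ p * r + (s + q * k) = a2 + b2.
  move=> v0 Rv Qv; apply: (two_eigenvalues pZ' v0).
  by rewrite TZE !bopE bop_idE Rv Qv !scalerA !scalerDl.
have := ev n1 1 1 (inner1_neq0 n11); have := ev n2 0 1 (inner1_neq0 n22).
have := ev m1 1 0 (inner1_neq0 m11); have := ev m2 0 0 (inner1_neq0 m22).
rewrite !scale1r !scale0r !mulr1 !mulr0 !add0r !addr0.
move=> /(_ Rm2 Qm2) E00 /(_ Rm1 Qm1) E10 /(_ Rn2 Qn2) E01 /(_ Rn1 Qn1) E11.
have p0 : p != 0 by rewrite invr_eq0.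
have q0 : q != 0 by rewrite mulf_neq0.
have neq (u v : C) : u != 0 -> v <> u + v.
  by move=> u0 /esym/eqP; rewrite -subr_eq0 addrK; exact/negP.
(* The eigenvalues at m2, m1, n2, n1 are s, p + s, s + q, p + (s + q). *)
have pq : p + s = s + q.
  by apply: (pigeonhole2 _ _ E00 E10 E01); [exact: neq|rewrite addrC; exact: neq].
have pqE : p = q by apply: (addIr s); rewrite pq addrC.
have : s = p + (s + q).
  apply: (pigeonhole2 (u := s + q) _ _ E01 E00 E11); last exact: neq.
  by rewrite addrC => /esym; exact: neq.
rewrite pqE addrCA -{1}[s]addr0 => /addrI/esym/eqP.
by rewrite -mulr2n mulrn_eq0 (negbTE q0).
Qed.

(** If the projection Q in the image is not onto a line, its complement is. *)
Lemma rank_one_image x : '[x, x] = 1 ->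
  exists a b y, [/\ b != 0, '[y, y] = 1 & T (ketbra x x) = a *: I + b *: ketbra y y].
Proof.
move=> x1; have [_ Tproj _] := cT.
have [a [b [Q [pQ TPx]]]] := Tproj _ (proj_ketbra x1).
have nsc c : T (ketbra x x) <> c *: I.
  by move=> /(compatible_scalar TK cT')[d]; exact: ketbra_nonscalar.
have b0 : b != 0.
  by apply/eqP => b0; apply: (nsc a); rewrite TPx b0 scale0r addr0.
have Q0 : Q <> 0 by move=> Q0; apply: (nsc a); rewrite TPx Q0 scaler0 addr0.
have Q1 : I - Q <> 0.
  move=> /eqP; rewrite subr_eq0 => /eqP QI.
  by apply: (nsc (a + b)); rewrite TPx -QI scalerDl.
have [[u [u1 QE]]|nQ] := pselect (exists u, '[u, u] = 1 /\ Q = ketbra u u).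
  by exists a, b, u; rewrite -QE.
have [[u [uu QE]]|nQ'] := pselect (exists u, '[u, u] = 1 /\ I - Q = ketbra u u).
  exists (a + b), (- b), u; rewrite oppr_eq0; split=> //.
  rewrite -QE TPx; apply: bopP => y; rewrite !bopE bop_idE.
  by apply: inner_ext => w; rewrite !(innerBl, innerDl, innerZl); ring.
have [|n1 [n2 N]] := proj_two_vectors pQ Q0; first by move=> u u1 QE; apply: nQ; exists u.
have [|m1 [m2 [m11 m22 m21 Qm1 Qm2]]] := proj_two_vectors (proj_compl pQ) Q1.
  by move=> u u1 QE; apply: nQ'; exists u.
have QI m : (I - Q) m = m -> Q m = 0.
  by rewrite !bopE bop_idE => /eqP; rewrite -subr_eq0 addrAC subrr sub0r oppr_eq0 => /eqP.
by exfalso; apply: (no_four_atoms (m1 := m1) (m2 := m2) x1 pQ b0 TPx N); split=> //; exact: QI.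
Qed.

End Image.
End RankOne.

(** * The unitary or antiunitary map behind the images of lines *)

Section Plane.
Variables (R : realType) (H : hilbertType R).
Local Notation C := R[i].
Implicit Types (x y z : H) (a b t : C).

Lemma ketbraZ a x : ketbra (a *: x) (a *: x) = (a * a^*) *: ketbra x x.
Proof.
apply: bopP => y; rewrite !bopE !ketbraE innerZr !scalerA; congr (_ *: _).
by ring.
Qed.

Lemma mul_conj_eq0 a : a * a^* = 0 -> a = 0.
Proof. by move/eqP; rewrite mulf_eq0 conjC_eq0 orbb => /eqP. Qed.

(** All w t lie in the plane of g and h, because the rank-one operators of w t
    and w (- t) have a sum supported there. In the basis g, h the matrix of the rank
    one operator of w t is (1 + F, k; k', |t|^2 - F) with F, k, k' real-linear in
    t. Its determinant vanishes for t and - t, hence 2 F (|t|^2 - 1) = 0, whence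
    F = 0. Then k is the combination t m + t^* m' with |k| = |t| for all t, which
    means that one of m, m' vanishes and the other has modulus 1. *)
Lemma rank_one_plane (g h : H) (N N' : bop H) (w : C -> H) :
  '[g, g] = 1 -> '[h, h] = 1 -> '[g, h] = 0 ->
  (forall t, '[w t, w t] = 1 + t * t^*) ->
  (forall t, ketbra (w t) (w t) =
     ketbra g g + t *: N + t^* *: N' + (t * t^*) *: ketbra h h) ->
  exists m m', [/\ N g = m *: h, N' g = m' *: h, m * m' = 0, m * m^* + m' * m'^* = 1 &
    forall t, let u := g + (t * m + t^* * m') *: h in
      ketbra (w t) (w t) = ketbra u u].
Proof.
move=> g1 h1 gh w1 wE; have hg := inner_eq0C gh.
have DE t x : '[x, w t] *: w t =
    '[x, g] *: g + t *: N x + t^* *: N' x + (t * t^*) *: ('[x, h] *: h).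
  by have := congr1 (fun A : bop H => A x) (wE t); rewrite !bopE !ketbraE.
have wgh t : w t = '[w t, g] *: g + '[w t, h] *: h.
  pose y := w t - ('[w t, g] *: g + '[w t, h] *: h).
  have yg : '[y, g] = 0 by rewrite innerBl innerDl !innerZl g1 hg mulr1 mulr0 addr0 subrr.
  have yh : '[y, h] = 0 by rewrite innerBl innerDl !innerZl h1 gh mulr1 mulr0 add0r subrr.
  have wy0 : '[w t, y] = 0.
    have := DE t y; have := DE (- t) y.
    rewrite yg yh !scale0r !scaler0 !add0r !addr0 rmorphN !scaleNr -opprD => E1 E2.
    have E : '[y, w t] * '[w t, y] + '[y, w (- t)] * '[w (- t), y] = 0.
      by rewrite -!innerZl -innerDl E1 E2 subrr inner0l.
    have pos v : 0 <= '[y, v] * '[v, y] by rewrite (innerC v) mul_conjC_ge0.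
    move/eqP: E; rewrite paddr_eq0// => /andP[/eqP E _].
    by apply: mul_conj_eq0; rewrite -innerC mulrC.
  have : '[y, y] = 0.
    by rewrite {1}/y innerBl wy0 innerDl !innerZl (inner_eq0C yg) (inner_eq0C yh) !mulr0 addr0 subrr.
  by move/inner_eq0/eqP; rewrite subr_eq0 => /eqP.
pose n := '[N g, g]; pose n' := '[N' g, g]; pose p := '[N h, h]; pose p' := '[N' h, h].
pose m := '[N g, h]; pose m' := '[N' g, h]; pose q := '[N h, g]; pose q' := '[N' h, g].
have Egg t : '[g, w t] * '[w t, g] = 1 + t * n + t^* * n'.
  by rewrite -innerZl DE !innerDl !innerZl g1 gh; ring.
have Ehh t : '[h, w t] * '[w t, h] = t * t^* + t * p + t^* * p'.
  by rewrite -innerZl DE !innerDl !innerZl h1 hg; ring.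
have Egh t : '[g, w t] * '[w t, h] = t * m + t^* * m'.
  by rewrite -innerZl DE !innerDl !innerZl gh; ring.
have Ehg t : '[h, w t] * '[w t, g] = t * q + t^* * q'.
  by rewrite -innerZl DE !innerDl !innerZl hg; ring.
have tr t : t * p + t^* * p' = - (t * n + t^* * n').
  have := w1 t; rewrite {1}wgh innerDl !innerZl ['[w t, g] * _]mulrC Egg ['[w t, h] * _]mulrC Ehh => E.
  by apply/eqP; rewrite -subr_eq0; move/eqP: E; rewrite -subr_eq0 => /eqP <-; apply/eqP; ring.
have det t : (1 + (t * n + t^* * n')) * (t * t^* - (t * n + t^* * n')) =
    (t * m + t^* * m') * (t * q + t^* * q').
  by rewrite -tr addrA -Egg addrA -Ehh -Egh -Ehg; ring.
have n2 : (2%:R : C) != 0 by rewrite pnatr_eq0.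
have n6 : (6%:R : C) != 0 by rewrite pnatr_eq0.
have i0 : ('i : C) != 0 by exact: neq0Ci.
have ii : ('i : C) * 'i = -1 by rewrite -expr2 sqrCi.
(* Any modulus other than 1 would do; this one is used for t = 2 and t = 2 i. *)
have F0 t : t * t^* = 4%:R -> t * n + t^* * n' = 0.
  move=> t4; have := det t; have := det (- t); rewrite rmorphN !mulNr mulrN opprK t4 => D1 D2.
  apply: (mulfI n6); rewrite mulr0.
  move/eqP: D2; rewrite -subr_eq0 => /eqP D2; move/eqP: D1; rewrite -subr_eq0 => /eqP D1.
  by rewrite -(subrr 0) -{1}D2 -{1}D1; ring.
have E2 : 2%:R * n + 2%:R * n' = 0.
  by have := F0 2%:R; rewrite rmorph_nat; apply; rewrite -natrM.
have Ei : 2%:R * 'i * n - 2%:R * 'i * n' = 0.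
  have := F0 (2%:R * 'i); rewrite rmorphM rmorph_nat /= conjCi mulrN mulNr; apply.
  by rewrite mulrN mulrACA ii -natrM mulrN1 opprK.
have nn' : n = n'.
  move/eqP: Ei; rewrite -mulrBr mulf_eq0 mulf_eq0 (negbTE n2) (negbTE i0) /= subr_eq0.
  by move/eqP.
have n0 : n = 0.
  move/eqP: E2; rewrite -mulrDr mulf_eq0 (negbTE n2) /= -nn' -mulr2n mulrn_eq0 /=.
  by move/eqP.
have n'0 : n' = 0 by rewrite -nn'.
have gw1 t : '[g, w t] * '[w t, g] = 1 by rewrite Egg n0 n'0 !mulr0 !addr0.
have gwE t : '[g, w t] *: w t = g + (t * m + t^* * m') *: h.
  by rewrite [X in _ *: X = _]wgh scalerDr !scalerA gw1 scale1r Egh.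
have Dg t : t *: N g + t^* *: N' g = (t * m + t^* * m') *: h.
  have := DE t g; rewrite g1 gh scale1r scale0r scaler0 addr0 -addrA gwE.
  by move/addrI.
have Ng1 : N g + N' g = (m + m') *: h.
  by have := Dg 1; rewrite rmorph1 !scale1r !mul1r.
have Ng2 : N g - N' g = (m - m') *: h.
  apply: (scalerI i0); have := Dg 'i; rewrite conjCi => E.
  by rewrite scalerBr scalerA -scaleNr E; congr (_ *: _); ring.
have Ng : N g = m *: h.
  apply: (scalerI n2); rewrite scaler_nat mulr2n -{1}(addrK (N' g) (N g)) Ng1.
  by rewrite -addrA addrC [- _ + _]addrC Ng2 -scalerDl scalerA; congr (_ *: _); ring.
have N'g : N' g = m' *: h.
  by apply: (addrI (N g)); rewrite Ng1 Ng scalerDl.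
have mod t : (t * m + t^* * m') * (t * m + t^* * m')^* = t * t^*.
  rewrite -Egh rmorphM/= -!innerC mulrACA [_ * '[w t, g]]gw1 mul1r.
  by rewrite mulrC Ehh -addrA tr n0 n'0 !mulr0 addr0 oppr0 addr0.
have M1 : m * m^* + m' * m'^* + (m * m'^* + m' * m^*) = 1.
  have := mod 1; rewrite rmorph1 !mul1r rmorphD => <-.
  by rewrite /=; ring.
have Mi : m * m^* + m' * m'^* - (m * m'^* + m' * m^*) = 1.
  have := mod 'i; rewrite conjCi mulrN ii opprK => <-.
  rewrite rmorphD !rmorphM /= rmorphN /= conjCi -[LHS]mul1r -[1]opprK -ii.
  by ring.
have M0 : m * m'^* + m' * m^* = 0.
  have /addrI/eqP := etrans M1 (esym Mi).
  by rewrite -subr_eq0 opprK -mulr2n mulrn_eq0 => /eqP.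
have MM : m * m^* + m' * m'^* = 1 by rewrite -M1 M0 addr0.
have M2 : m * m'^* - m' * m^* = 0.
  have c1i : (1 + 'i : C)^* = 1 - 'i by rewrite rmorphD rmorph1 /= conjCi.
  have c2i : (1 - 'i : C)^* = 1 + 'i by rewrite rmorphB rmorph1 /= conjCi opprK.
  have := mod (1 + 'i); rewrite c1i rmorphD !rmorphM /= c1i c2i => E.
  have E' : (1 + 'i) * (1 - 'i) = 2%:R :> C by rewrite mulrC -subr_sqr expr1n sqrCi opprK.
  have : (1 + 'i) * (1 - 'i) * (m * m^* + m' * m'^*) +
     (1 + 'i) * (1 + 'i) * (m * m'^*) + (1 - 'i) * (1 - 'i) * (m' * m^*) =
     (1 + 'i) * (1 - 'i) by rewrite -[RHS]E; ring.
  have s1 : (1 + 'i) * (1 + 'i) = 2%:R * 'i :> C.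
    by rewrite mulrDl !mulrDr ii; ring.
  have s2 : (1 - 'i) * (1 - 'i) = - (2%:R * 'i) :> C.
    by rewrite mulrBl !mulrBr ii; ring.
  rewrite MM mulr1 s1 s2 -addrA mulNr -mulrBr -[RHS]addr0 => /addrI/eqP.
  by rewrite mulf_eq0 mulf_eq0 (negbTE n2) (negbTE i0) => /eqP.
have mm' : m * m'^* = 0.
  move/eqP: M2; rewrite subr_eq0 => /eqP M2; move/eqP: M0; rewrite -M2 -mulr2n mulrn_eq0.
  by move/eqP.
exists m, m'; split=> //.
  move/eqP: mm'; rewrite mulf_eq0 conjC_eq0 => /orP[] /eqP ->.
    by rewrite mul0r.
  by rewrite mulr0.
by move=> t /=; rewrite -gwE ketbraZ -innerC gw1 scale1r.
Qed.
End Plane.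

Section Wigner.
Variables (R : realType) (H : hilbertType R).
Local Notation C := R[i].
Implicit Types (x y z : H) (a b : C) (A B P Q : bop H) (e : onbasis H).
Local Notation I := (bop_id H).
Hypothesis sepH : separable H.
Hypothesis dim3 : forall x y : H,
  exists z, [/\ '[z, z] = 1, '[z, x] = 0 & '[z, y] = 0].
Variables T T' : {linear bop H -> bop H}.
Hypotheses (TK : cancel T T') (TK' : cancel T' T).
Hypotheses (cT : compatible T) (cT' : compatible T').

(** If the images are parallel, some combination of the two rank-one projections
    is mapped to a scalar and hence is a scalar, which is zero as seen on a vector
    orthogonal to x and y. *)
Lemma parallel_image x y u v a b a' b' k : '[x, x] = 1 -> '[u, u] = 1 -> '[v, v] = 1 ->
  b != 0 -> b' != 0 ->
  T (ketbra x x) = a *: I + b *: ketbra u u ->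
  T (ketbra y y) = a' *: I + b' *: ketbra v v ->
  u = k *: v -> exists c, x = c *: y.
Proof.
move=> x1 u1 v1 b0 b0' Tx Ty uv.
have kk : k * k^* = 1 by move: u1; rewrite uv innerZl innerZr v1 mulr1.
have Puv : ketbra u u = ketbra v v by rewrite uv ketbraZ kk scale1r.
have [d dE] : exists d, b' *: ketbra x x + (- b) *: ketbra y y = d *: I.
  apply: (compatible_scalar TK cT' (c := b' * a - b * a')).
  rewrite linear_two_terms Tx Ty Puv; apply: bopP => z; rewrite !bopE bop_idE.
  by apply: inner_ext => w; rewrite !(innerDl, innerZl); ring.
have [z [z1 zx zy]] := dim3 x y.
have d0 : d = 0.
  have := congr1 (fun A : bop H => '[A z, z]) dE.
  rewrite !bopE bop_idE !ketbraE zx zy !scale0r !scaler0 addr0 inner0l innerZl z1.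
  by rewrite mulr1.
have := congr1 (fun A : bop H => A x) dE.
rewrite d0 scale0r !bopE !ketbraE x1 scale1r => /eqP; rewrite scaleNr subr_eq0 => /eqP E.
exists (b / b' * '[x, y]); apply: (scalerI b0'); rewrite E !scalerA.
by congr (_ *: _); field.
Qed.

(** The images of commuting projections commute, and two lines whose projections
    commute are orthogonal or equal. *)
Lemma orthogonal_image x y u v a b a' b' : '[x, x] = 1 -> '[y, y] = 1 ->
  '[u, u] = 1 -> '[v, v] = 1 -> b != 0 -> b' != 0 ->
  T (ketbra x x) = a *: I + b *: ketbra u u ->
  T (ketbra y y) = a' *: I + b' *: ketbra v v ->
  '[x, y] = 0 -> '[u, v] = 0.
Proof.
move=> x1 y1 u1 v1 b0 b0' Tx Ty xy.
have cxy : commuting (ketbra x x) (ketbra y y).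
  by move=> z; rewrite !ketbraE !innerZl xy (inner_eq0C xy) !mulr0 !scale0r.
have := compatible_commuting sepH cT (proj_ketbra x1) (proj_ketbra y1) cxy.
rewrite Tx Ty => /(commuting_affine b0 b0')/(_ u).
rewrite !ketbraE u1 scale1r innerZl => E; apply: contrapT => /eqP uv.
have vu : v = '[v, u] *: u by apply: (scalerI uv); rewrite -E scalerA.
have [c yx] := parallel_image y1 v1 u1 b0' b0 Ty Tx vu.
have : '[x, y] != 0.
  rewrite yx innerZr x1 mulr1 conjC_eq0; apply/eqP => c0.
  by move: (inner1_neq0 y1); rewrite yx c0 scale0r eqxx.
by rewrite xy eqxx.
Qed.

(** The projections onto the lines of x + y and x - y have the same sum as those
    onto the lines of x and y. Applying T, the scalars cancel because all images
    kill the image of a vector z orthogonal to x and y; so the image wp of x + y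
    is an eigenvector of b P_u + b' P_v, and being parallel to neither u nor v it
    forces b = b'. *)
Lemma coefficient_orthogonal x y u v a b a' b' : '[x, x] = 1 -> '[y, y] = 1 ->
  '[u, u] = 1 -> '[v, v] = 1 -> b != 0 -> b' != 0 ->
  T (ketbra x x) = a *: I + b *: ketbra u u ->
  T (ketbra y y) = a' *: I + b' *: ketbra v v ->
  '[x, y] = 0 -> b = b'.
Proof.
move=> x1 y1 u1 v1 b0 b0' Tx Ty xy; have yx := inner_eq0C xy.
have uv := orthogonal_image x1 y1 u1 v1 b0 b0' Tx Ty xy.
have [r [r0 rr rr2]] := inv_sqrt2 R.
pose p := r *: (x + y); pose m := r *: (x - y).
have p1 : '[p, p] = 1.
  rewrite innerZl innerZr rr innerDl !innerDr x1 y1 xy yx -[RHS]rr2.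
  by ring.
have m1 : '[m, m] = 1.
  rewrite innerZl innerZr rr innerBl !innerBr x1 y1 xy yx -[RHS]rr2.
  by ring.
have [ap [bp [wp [bp0 wp1 Tp]]]] := rank_one_image sepH dim3 TK TK' cT cT' p1.
have [am [bm [wm [bm0 wm1 Tm]]]] := rank_one_image sepH dim3 TK TK' cT cT' m1.
have pm : '[p, m] = 0.
  by rewrite innerZl innerZr innerDl !innerBr x1 y1 xy yx; ring.
have wpm := orthogonal_image p1 m1 wp1 wm1 bp0 bm0 Tp Tm pm.
have sumE : ketbra p p + ketbra m m = ketbra x x + ketbra y y.
  apply: bopP => z; rewrite !bopE !ketbraE !innerZr rr !innerDr !innerNr.
  apply: inner_ext => w; rewrite !(innerDl, innerZl, innerNl).
  rewrite -[RHS]mul1r -rr2; ring.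
have [z [z1 zx zy]] := dim3 x y.
have zp : '[z, p] = 0 by rewrite innerZr innerDr zx zy addr0 mulr0.
have zm : '[z, m] = 0 by rewrite innerZr innerBr zx zy subr0 mulr0.
have [az [bz [wz [bz0 wz1 Tz]]]] := rank_one_image sepH dim3 TK TK' cT cT' z1.
have zu := orthogonal_image z1 x1 wz1 u1 bz0 b0 Tz Tx zx.
have zv := orthogonal_image z1 y1 wz1 v1 bz0 b0' Tz Ty zy.
have zwp := orthogonal_image z1 p1 wz1 wp1 bz0 bp0 Tz Tp zp.
have zwm := orthogonal_image z1 m1 wz1 wm1 bz0 bm0 Tz Tm zm.
have := congr1 T sumE; rewrite !linearD Tp Tm Tx Ty => E.
(* The scalar parts agree, as seen at wz, which all four lines are orthogonal to. *)
have Ez : ap + am = a + a'.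
  have := congr1 (fun A : bop H => '[A wz, wz]) E.
  rewrite !bopE !bop_idE !ketbraE zu zv zwp zwm !scale0r !scaler0 !addr0.
  by rewrite !innerDl !innerZl wz1 !mulr1.
have Ep : bp *: wp = b *: ('[wp, u] *: u) + b' *: ('[wp, v] *: v).
  have := congr1 (fun A : bop H => A wp) E.
  rewrite !bopE !bop_idE !ketbraE wp1 wpm scale0r scale1r scaler0 addr0.
  have apE : ap = a + a' - am by rewrite -Ez addrK.
  rewrite apE => {}E; apply: inner_ext => w; have := congr1 (fun z => '[z, w]) E.
  rewrite !(innerDl, innerZl) => {}E; apply/eqP; rewrite -subr_eq0.
  by move/eqP: E; rewrite -subr_eq0 => /eqP <-; apply/eqP; ring.
have bu : bp * '[wp, u] = b * '[wp, u].
  have := congr1 (fun z => '[z, u]) Ep.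
  by rewrite innerDl !innerZl u1 (inner_eq0C uv) !mulr0 mulr1 addr0.
have bv : bp * '[wp, v] = b' * '[wp, v].
  have := congr1 (fun z => '[z, v]) Ep.
  by rewrite innerDl !innerZl v1 uv !mulr0 mulr1 add0r.
have px : '[p, x] = r by rewrite innerZl innerDl x1 yx addr0 mulr1.
have py : '[p, y] = r by rewrite innerZl innerDl y1 xy add0r mulr1.
have [wu0|wu0] := eqVneq '[wp, u] 0.
  have [c pE] : exists c, p = c *: y.
    apply: (parallel_image (k := b' / bp * '[wp, v]) p1 wp1 v1 bp0 b0' Tp Ty).
    apply: (scalerI bp0); rewrite Ep wu0 scale0r scaler0 add0r !scalerA.
    by congr (_ *: _); field.
  by move: r0; rewrite -px pE innerZl yx mulr0 eqxx.
have [wv0|wv0] := eqVneq '[wp, v] 0.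
  have [c pE] : exists c, p = c *: x.
    apply: (parallel_image (k := b / bp * '[wp, u]) p1 wp1 u1 bp0 b0 Tp Tx).
    apply: (scalerI bp0); rewrite Ep wv0 scale0r scaler0 addr0 !scalerA.
    by congr (_ *: _); field.
  by move: r0; rewrite -py pE innerZl xy mulr0 eqxx.
by rewrite -(mulIf wu0 bu) (mulIf wv0 bv).
Qed.

(** Any two unit vectors have a common orthogonal one, so the coefficient b is
    the same for all lines. *)
Lemma rank_one_images : exists (b : C) (Q : H -> H), [/\ b != 0,
  forall v, exists a, T (ketbra v v) = a *: I + b *: ketbra (Q v) (Q v),
  forall v, '[Q v, Q v] = '[v, v] &
  forall v w, '[v, w] = 0 -> '[Q v, Q w] = 0].
Proof.
have [e0 [e01 _ _]] := dim3 0 0.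
have [a0 [b [q0 [b0 q01 Te0]]]] := rank_one_image sepH dim3 TK TK' cT cT' e01.
have bE x a b' y : '[x, x] = 1 -> b' != 0 -> '[y, y] = 1 ->
    T (ketbra x x) = a *: I + b' *: ketbra y y -> b' = b.
  move=> x1 b'0 y1 Tx; have [z [z1 zx ze0]] := dim3 x e0.
  have [az [bz [wz [bz0 wz1 Tz]]]] := rank_one_image sepH dim3 TK TK' cT cT' z1.
  rewrite -(coefficient_orthogonal z1 x1 wz1 y1 bz0 b'0 Tz Tx zx).
  exact: (coefficient_orthogonal z1 e01 wz1 q01 bz0 b0 Tz Te0 ze0).
have /choice[q qP] : forall x, exists y, '[x, x] = 1 ->
    '[y, y] = 1 /\ exists a, T (ketbra x x) = a *: I + b *: ketbra y y.
  move=> x; have [x1|] := pselect ('[x, x] = 1); last by exists 0.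
  have [a [b' [y [b'0 y1 Tx]]]] := rank_one_image sepH dim3 TK TK' cT cT' x1.
  by exists y => _; split=> //; exists a; rewrite -(bE _ _ _ _ x1 b'0 y1 Tx).
have nE (v : H) : v = `|v| *: normalized v.
  have [->|v0] := eqVneq v 0; first by rewrite normr0 scale0r.
  by rewrite scalerA mulfV ?normr_eq0// scale1r.
pose Q v := `|v| *: q (normalized v); exists b, Q; split=> //.
- move=> v; have [v0|v0] := eqVneq v 0.
    exists 0; rewrite scale0r add0r /Q v0 normr0 scale0r.
    have k0 : ketbra 0 0 = 0 :> bop H.
      by apply: bopP => y; rewrite ketbraE scaler0.
    by rewrite k0 linear0 scaler0.
  have [q1 [a Ta]] := qP _ (normalized_unit v0); exists (`|v| * `|v| * a).
  have -> : ketbra v v = (`|v| * `|v|) *: ketbra (normalized v) (normalized v).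
    by rewrite -[X in _ * X]conjC_norm -ketbraZ -nE.
  rewrite linearZ /= Ta /Q ketbraZ conjC_norm scalerDr !scalerA.
  by congr (_ + _ *: _); rewrite mulrC.
- move=> v; have [->|v0] := eqVneq v 0; first by rewrite /Q normr0 scale0r.
  have [q1 _] := qP _ (normalized_unit v0).
  by rewrite innerZl innerZr q1 mulr1 conjC_norm -expr2 inner_normE.
- move=> v w vw; have [->|v0] := eqVneq v 0; first by rewrite /Q normr0 scale0r inner0l.
  have [->|w0] := eqVneq w 0; first by rewrite /Q normr0 scale0r inner0r.
  have v1 := normalized_unit v0; have w1 := normalized_unit w0.
  have [qv [a Ta]] := qP _ v1; have [qw [a' Ta']] := qP _ w1.
  rewrite innerZl innerZr (orthogonal_image v1 w1 qv qw b0 b0 Ta Ta') ?mulr0//.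
  by rewrite innerZl innerZr vw !mulr0.
Qed.

End Wigner.

Section WignerMap.
Variables (R : realType) (H : hilbertType R).
Local Notation C := R[i].
Implicit Types (x y z : H) (a b : C) (A B P Q : bop H) (e : onbasis H).
Local Notation I := (bop_id H).

(** Polarization. *)
Lemma isometry_inner (s : C -> C) (W : H -> H) : s = id \/ s = Num.conj ->
  (forall a x y, W (a *: x + y) = s a *: W x + W y) ->
  (forall x, '[W x, W x] = '[x, x]) -> forall x y, '[W x, W y] = s '[x, y].
Proof.
move=> sE lW nW x y.
have WD a : '[W (a *: x + y), W (a *: x + y)] = '[a *: x + y, a *: x + y] by exact: nW.
have n2 : (2%:R : C) != 0 by rewrite pnatr_eq0.
have i0 : ('i : C) != 0 by exact: neq0Ci.
have ii : ('i : C) * 'i = -1 by rewrite -expr2 sqrCi.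
have E1 : '[W x, W y] + '[W y, W x] = '[x, y] + '[y, x].
  have := WD 1; rewrite lW; have -> : s 1 = 1 by case: sE => -> //; rewrite rmorph1.
  rewrite !scale1r !innerDl !innerDr !nW => E; apply/eqP; rewrite -subr_eq0.
  by move/eqP: E; rewrite -subr_eq0 => /eqP <-; apply/eqP; ring.
have E2 : s 'i * '[W x, W y] + (s 'i)^* * '[W y, W x] = 'i * '[x, y] - 'i * '[y, x].
  have := WD 'i; rewrite lW !innerDl !innerDr !innerZl !innerZr !nW.
  have -> : s 'i * ((s 'i)^* * '[x, x]) = 'i * (('i)^* * '[x, x]).
    by case: sE => -> //; rewrite !mulrA conjCK [_^* * _]mulrC.
  rewrite conjCi => E; apply/eqP; rewrite -subr_eq0.
  by move/eqP: E; rewrite -subr_eq0 => /eqP <-; apply/eqP; ring.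
apply: (mulfI n2); apply: (mulfI i0); case: sE => sE; rewrite sE in E2 *.
  move: E2; rewrite conjCi => E2.
  transitivity ('i * ('[W x, W y] + '[W y, W x]) + ('i * '[W x, W y] + - 'i * '[W y, W x])).
    by ring.
  by rewrite E1 E2; ring.
move: E2; rewrite conjCK conjCi -innerC => E2.
transitivity ('i * ('[W x, W y] + '[W y, W x]) - (- 'i * '[W x, W y] + 'i * '[W y, W x])).
  by ring.
by rewrite E1 E2; ring.
Qed.

(** A vector space is not the union of two proper subspaces. *)
Lemma linear_dichotomy (D : set H) (U V : H -> H) :
  (forall x y, D x -> D y -> D (x + y)) ->
  (forall x y, U (x + y) = U x + U y) -> (forall x y, V (x + y) = V x + V y) ->
  (forall x, D x -> U x = 0 \/ V x = 0) ->
  (forall x, D x -> U x = 0) \/ (forall x, D x -> V x = 0).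
Proof.
move=> DD UD VD UV; apply: contrapT => /not_orP[/existsNP[x /not_implyP[Dx Ux]] ].
move=> /existsNP[y /not_implyP[Dy Vy]].
have Vx : V x = 0 by case: (UV _ Dx).
have Uy : U y = 0 by case: (UV _ Dy).
by case: (UV _ (DD _ _ Dx Dy)); rewrite ?UD ?VD ?Vx ?Uy ?addr0 ?add0r.
Qed.

Hypothesis sepH : separable H.
Hypothesis dim3 : forall x y : H,
  exists z, [/\ '[z, z] = 1, '[z, x] = 0 & '[z, y] = 0].
Variables T T' : {linear bop H -> bop H}.
Hypotheses (TK : cancel T T') (TK' : cancel T' T).
Hypotheses (cT : compatible T) (cT' : compatible T').

Section Frame.
Variables (b : C) (Q : H -> H) (e0 : H).
Hypotheses (b0 : b != 0) (e01 : '[e0, e0] = 1).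
Hypothesis TQ : forall v, exists a, T (ketbra v v) = a *: I + b *: ketbra (Q v) (Q v).
Hypothesis nQ : forall v, '[Q v, Q v] = '[v, v].
Hypothesis oQ : forall v w, '[v, w] = 0 -> '[Q v, Q w] = 0.

Local Notation g := (Q e0).
(** With x orthogonal to e0, the operator T (ketbra x e0) is up to a scalar b times
    either ketbra (W x) g or ketbra g (W x), W the map to be found; this extracts
    W x from one of the two operators T (ketbra x e0), T (ketbra e0 x) and zero
    from the other. *)
Definition offdiag (B : bop H) := b^-1 *: (B g - '[B g, g] *: g).
Local Notation U x := (offdiag (T (ketbra x e0))).
Local Notation V x := (offdiag (T (ketbra e0 x))).

Lemma offdiag_lin a A B : offdiag (a *: A + B) = a *: offdiag A + offdiag B.
Proof.
rewrite /offdiag !bopE; apply: inner_ext => z.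
by rewrite !(innerBl, innerDl, innerZl); ring.
Qed.

Lemma ketbra_linl a x y z : ketbra (a *: x + y) z = a *: ketbra x z + ketbra y z.
Proof.
by apply: bopP => w; rewrite !bopE !ketbraE scalerDr !scalerA mulrC.
Qed.

Lemma ketbra_linr a x y z : ketbra z (a *: x + y) = a^* *: ketbra z x + ketbra z y.
Proof.
by apply: bopP => w; rewrite !bopE !ketbraE innerDr innerZr scalerDl scalerA.
Qed.

Lemma offdiag_ketl a x y : U (a *: x + y) = a *: U x + U y.
Proof. by rewrite ketbra_linl linearP offdiag_lin. Qed.

Lemma offdiag_ketr a x y : V (a *: x + y) = a^* *: V x + V y.
Proof. by rewrite ketbra_linr linearP offdiag_lin. Qed.

(** Expanding T at the rank-one operator of e0 + t x gives the situation of
    rank_one_plane. The scalar parts are read off at the image k of a vector orthogonal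
    to e0 and x. *)
Lemma frame_unit x : '[x, x] = 1 -> '[x, e0] = 0 ->
  [/\ U x = 0 \/ V x = 0, '[U x, U x] + '[V x, V x] = 1,
    '[U x, g] = 0 /\ '[V x, g] = 0,
    forall t, let u := g + (t *: U x + t^* *: V x) in
      ketbra (Q (e0 + t *: x)) (Q (e0 + t *: x)) = ketbra u u &
    ketbra (Q x) (Q x) = ketbra (U x + V x) (U x + V x)].
Proof.
move=> x1 xe; have ex := inner_eq0C xe.
have g1 : '[g, g] = 1 by rewrite nQ.
pose h := Q x; have h1 : '[h, h] = 1 by rewrite nQ.
have gh : '[g, h] = 0 by exact: oQ.
have [z [z1 ze zx]] := dim3 e0 x; pose k := Q z; have k1 : '[k, k] = 1 by rewrite nQ.
pose w t := Q (e0 + t *: x).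
have kw t : '[k, w t] = 0 by apply: oQ; rewrite innerDr innerZr ze zx mulr0 addr0.
have kg : '[k, g] = 0 by exact: oQ.
have kh : '[k, h] = 0 by exact: oQ.
pose X := T (ketbra x e0); pose Y := T (ketbra e0 x).
pose N := b^-1 *: (X - '[X k, k] *: I); pose N' := b^-1 *: (Y - '[Y k, k] *: I).
have w1 t : '[w t, w t] = 1 + t * t^*.
  by rewrite nQ innerDl !innerDr !innerZl !innerZr ex xe x1 e01; ring.
have wE t : ketbra (w t) (w t) =
    ketbra g g + t *: N + t^* *: N' + (t * t^*) *: ketbra h h.
  have [at_ Tt] := TQ (e0 + t *: x); have [a0 T0] := TQ e0; have [ax Tx] := TQ x.
  have kE : ketbra (e0 + t *: x) (e0 + t *: x) =
      ketbra e0 e0 + t *: ketbra x e0 + t^* *: ketbra e0 x + (t * t^*) *: ketbra x x.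
    apply: bopP => y; rewrite !bopE !ketbraE innerDr innerZr.
    by apply: inner_ext => v; rewrite !(innerDl, innerZl, innerDr, innerZr); ring.
  have := congr1 T kE; rewrite !linearD !linearZ /= Tt T0 Tx -/X -/Y -/(w t) -/h => E.
  (* The scalar parts agree, as seen at k. *)
  have at_E : at_ = a0 + t * '[X k, k] + t^* * '[Y k, k] + t * t^* * ax.
    have := congr1 (fun A : bop H => '[A k, k]) E.
    rewrite !bopE !bop_idE !ketbraE kw kg kh !scale0r !scaler0 !addr0.
    by rewrite !innerDl !innerZl k1 !mulr1.
  apply: bopP => y; apply: inner_ext => v.
  have := congr1 (fun A : bop H => '[A y, v]) E.
  rewrite /N /N' at_E !bopE !bop_idE !(innerDl, innerZl, innerBl, innerNl) => {}E.
  apply: (mulfI b0); apply/eqP; rewrite -subr_eq0; move/eqP: E; rewrite -subr_eq0.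
  by move=> /eqP <-; apply/eqP; field.
have [m [m' [Ng N'g mm MM wm]]] := rank_one_plane g1 h1 gh w1 wE.
have hg := inner_eq0C gh.
have UE : U x = m *: h.
  rewrite -Ng /offdiag -/X /N !bopE bop_idE; congr (_ *: (_ - _ *: _)).
  have := congr1 (fun v => '[v, g]) Ng; rewrite !bopE bop_idE !innerZl hg mulr0.
  move/eqP; rewrite mulf_eq0 invr_eq0 (negbTE b0) innerBl innerZl g1 mulr1 /= subr_eq0.
  by move/eqP.
have VE : V x = m' *: h.
  rewrite -N'g /offdiag -/Y /N' !bopE bop_idE; congr (_ *: (_ - _ *: _)).
  have := congr1 (fun v => '[v, g]) N'g; rewrite !bopE bop_idE !innerZl hg mulr0.
  move/eqP; rewrite mulf_eq0 invr_eq0 (negbTE b0) innerBl innerZl g1 mulr1 /= subr_eq0.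
  by move/eqP.
have mm0 : m = 0 \/ m' = 0.
  by move/eqP: mm; rewrite mulf_eq0 => /orP[]/eqP; [left|right].
rewrite UE VE; split.
- by case: mm0 => ->; [left|right]; rewrite scale0r.
- by rewrite !innerZl !innerZr h1 !mulr1.
- by rewrite !innerZl hg !mulr0.
- by move=> t /=; rewrite wm !scalerA -scalerDl.
- rewrite -scalerDl ketbraZ (_ : _ * _ = 1) ?scale1r// -MM rmorphD.
  by case: mm0 => ->; rewrite /= rmorph0; ring.
Qed.

(** For each x one of the two off-diagonal parts vanishes; as they are additive,
    the same one vanishes for all x. Which one survives decides whether the map
    is linear or antilinear. *)
Lemma wigner_frame : exists (s : C -> C) (F : H -> H), [/\ s = id \/ s = Num.conj,
  forall a x y, F (a *: x + y) = s a *: F x + F y &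
  forall x, '[x, x] = 1 -> '[x, e0] = 0 ->
    [/\ '[F x, F x] = 1, '[F x, g] = 0,
      forall t, ketbra (Q (e0 + t *: x)) (Q (e0 + t *: x)) =
        ketbra (g + F (t *: x)) (g + F (t *: x)) &
      ketbra (Q x) (Q x) = ketbra (F x) (F x)]].
Proof.
have U0 : U 0 = 0 by have := offdiag_ketl (-1) 0 0; rewrite scaler0 addr0 scaleN1r addNr.
have V0 : V 0 = 0.
  by have := offdiag_ketr (-1) 0 0; rewrite scaler0 addr0 rmorphN rmorph1 scaleN1r addNr.
have UZ a x : U (a *: x) = a *: U x by rewrite -[a *: x]addr0 offdiag_ketl U0 addr0.
have VZ a x : V (a *: x) = a^* *: V x by rewrite -[a *: x]addr0 offdiag_ketr V0 addr0.
have [||||U_0|V_0] := @linear_dichotomy [set x | '[x, e0] = 0]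
  (fun x => U x) (fun x => V x).
- by move=> x y /= xe ye; rewrite innerDl xe ye addr0.
- by move=> x y; rewrite -[x]scale1r offdiag_ketl !scale1r.
- by move=> x y; rewrite -[x]scale1r offdiag_ketr rmorph1 !scale1r.
- move=> x /= xe; have [->|x0] := eqVneq x 0; first by left.
  have nxe : '[normalized x, e0] = 0 by rewrite innerZl xe mulr0.
  have [[E|E] _ _ _ _] := frame_unit (normalized_unit x0) nxe; [left|right].
    have -> : x = `|x| *: normalized x by rewrite scalerA mulfV ?normr_eq0// scale1r.
    by rewrite UZ E scaler0.
  have -> : x = `|x| *: normalized x by rewrite scalerA mulfV ?normr_eq0// scale1r.
  by rewrite VZ E scaler0.
- exists Num.conj, (fun x => V x); split; [by right|exact: offdiag_ketr|].
  move=> x x1 xe; have [_ + [_ Vg] wm hE] := frame_unit x1 xe.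
  rewrite U_0// inner0r add0r => V1; split=> // [t|].
    by rewrite wm U_0// scaler0 add0r VZ.
  by rewrite hE U_0// add0r.
- exists id, (fun x => U x); split; [by left|exact: offdiag_ketl|].
  move=> x x1 xe; have [_ + [Ug _] wm hE] := frame_unit x1 xe.
  rewrite V_0// inner0r addr0 => U1; split=> // [t|].
    by rewrite wm V_0// scaler0 addr0 UZ.
  by rewrite hE V_0// addr0.
Qed.

End Frame.

(** The map sends e0 to g and is F on the orthogonal complement of e0. Its
    surjectivity follows from the description of the inverse of T on rank-one
    projections. *)
Lemma wigner : exists (b : C) (s : C -> C) (U V : H -> H), [/\ b != 0,
  semiunitary s U V &
  forall v, exists a, T (ketbra v v) = a *: I + b *: ketbra (U v) (U v)].
Proof.
have [b [Q [b0 TQ nQ oQ]]] := rank_one_images sepH dim3 TK TK' cT cT'.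
have [e0 [e01 _ _]] := dim3 0 0; pose g := Q e0.
have g1 : '[g, g] = 1 by rewrite nQ.
have [s [F [sE lF FP]]] := wigner_frame b0 e01 TQ nQ oQ.
have sD a a' : s (a + a') = s a + s a' by case: sE => -> //; rewrite rmorphD.
have sM a a' : s (a * a') = s a * s a' by case: sE => -> //; rewrite rmorphM.
have s0 : s 0 = 0 by case: sE => -> //; rewrite rmorph0.
have sN a : s (- a) = - s a by case: sE => -> //; rewrite rmorphN.
have s1 : s 1 = 1 by case: sE => -> //; rewrite rmorph1.
have ss a : s (s a) = a by case: sE => -> //; rewrite conjCK.
have sa a : s a * (s a)^* = a * a^* by case: sE => -> //; rewrite conjCK mulrC.
have F0 : F 0 = 0.
  by have := lF (-1) 0 0; rewrite scaler0 addr0 sN s1 scaleN1r addNr.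
have FZ a x : F (a *: x) = s a *: F x by rewrite -[a *: x]addr0 lF F0 addr0.
have FD x y : F (x + y) = F x + F y by rewrite -[x]scale1r lF s1 !scale1r.
pose W y := s '[y, e0] *: g + F (y - '[y, e0] *: e0).
have lW a x y : W (a *: x + y) = s a *: W x + W y.
  rewrite /W innerDl innerZl sD sM scalerDl scalerDr scalerA.
  have -> : a *: x + y - (a * '[x, e0] + '[y, e0]) *: e0 =
      a *: (x - '[x, e0] *: e0) + (y - '[y, e0] *: e0).
    by apply: inner_ext => z; rewrite !(innerDl, innerBl, innerZl, innerNl); ring.
  by rewrite lF addrACA.
have WZ a x : W (a *: x) = s a *: W x.
  have W0 : W 0 = 0 by rewrite /W inner0l s0 !scale0r subr0 F0 addr0.
  by rewrite -[a *: x]addr0 lW W0 addr0.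
have decomp y : exists t x, [/\ '[x, x] = 1, '[x, e0] = 0 & y = '[y, e0] *: e0 + t *: x].
  pose y' := y - '[y, e0] *: e0.
  have y'e : '[y', e0] = 0 by rewrite innerBl innerZl e01 mulr1 subrr.
  have [y'0|y'0] := eqVneq y' 0.
    have [x [x1 xe _]] := dim3 e0 e0; exists 0, x; split=> //.
    by rewrite scale0r addr0; apply/eqP; rewrite -subr_eq0; apply/eqP.
  exists `|y'|, (normalized y'); split; first exact: normalized_unit.
    by rewrite innerZl y'e mulr0.
  by rewrite scalerA mulfV ?normr_eq0// scale1r addrC subrK.
have WE a x : '[x, e0] = 0 -> W (a *: e0 + x) = s a *: g + F x.
  by move=> xe; rewrite /W innerDl innerZl e01 xe mulr1 addr0 [a *: e0 + x]addrC addrK.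
have nW y : '[W y, W y] = '[y, y].
  have [t [x [x1 xe yE]]] := decomp y; have [Fx Fg _ _] := FP x x1 xe.
  have tx : '[t *: x, e0] = 0 by rewrite innerZl xe mulr0.
  rewrite yE WE// FZ !pythagoras.
  - by rewrite !innerZl !innerZr g1 e01 Fx x1 !mulr1 !sa.
  - by rewrite innerZl innerZr (inner_eq0C xe) !mulr0.
  - by rewrite innerZl innerZr (inner_eq0C Fg) !mulr0.
have TW y : exists a, T (ketbra y y) = a *: I + b *: ketbra (W y) (W y).
  have TZ l v : (exists a, T (ketbra v v) = a *: I + b *: ketbra (W v) (W v)) ->
      exists a, T (ketbra (l *: v) (l *: v)) = a *: I + b *: ketbra (W (l *: v)) (W (l *: v)).
    move=> [a Ta]; exists (l * l^* * a).
    rewrite WZ !ketbraZ sa linearZ /= Ta scalerDr !scalerA.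
    by congr (_ + _ *: _); rewrite mulrC.
  have TQW v : ketbra (Q v) (Q v) = ketbra (W v) (W v) ->
      exists a, T (ketbra v v) = a *: I + b *: ketbra (W v) (W v).
    by move=> <-; exact: TQ.
  have [t [x [x1 xe yE]]] := decomp y; have [Fx Fg Fe Fh] := FP x x1 xe.
  have [l0|l0] := eqVneq '[y, e0] 0.
    rewrite yE l0 scale0r add0r; apply/TZ/TQW.
    by rewrite Fh -[in RHS](add0r x) -(scale0r e0) WE// s0 scale0r add0r.
  have -> : y = '[y, e0] *: (e0 + (t / '[y, e0]) *: x).
    by rewrite scalerDr scalerA mulrC divfK.
  apply/TZ/TQW; rewrite Fe -[X in W (X + _)]scale1r WE ?s1 ?scale1r//.
  by rewrite innerZl xe mulr0.
have iW := isometry_inner sE lW nW.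
have /choice[V WV] : forall y, exists x, W x = y.
  move=> y; have [y0|y0] := eqVneq y 0.
    by exists 0; rewrite y0; apply: inner_eq0; rewrite nW inner0l.
  pose u := normalized y; have u1 := normalized_unit y0.
  have [a' [b' [x [b'0 x1 T'u]]]] := rank_one_image sepH dim3 TK' TK cT' cT u1.
  have [a Tx] := TW x; have [[c TI] _ _] := cT.
  have uE : ketbra u u = (a' * c + b' * a) *: I + (b' * b) *: ketbra (W x) (W x).
    by rewrite -(TK' (ketbra u u)) T'u linear_two_terms TI Tx scalerDr !scalerA addrA -scalerDl.
  have [z [z1 zu zx]] := dim3 u (W x).
  have := congr1 (fun A : bop H => '[A z, z]) uE.
  rewrite !bopE bop_idE !ketbraE zu zx !scale0r scaler0 addr0 inner0l innerZl z1 mulr1.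
  move=> /esym c0; have := congr1 (fun A : bop H => A u) uE.
  rewrite c0 scale0r !bopE !ketbraE u1 scale1r add0r scalerA => uW.
  exists (`|y| *: (s (b' * b * '[u, W x]) *: x)).
  rewrite !WZ ss -uW; have -> : s `|y| = `|y| by case: sE => -> //; rewrite conjC_norm.
  by rewrite /u scalerA mulfV ?scale1r// normr_eq0.
have WI : injective W.
  move=> x y xy; apply/eqP; rewrite -subr_eq0; apply/eqP/inner_eq0.
  have -> : x - y = (-1) *: y + x by rewrite scaleN1r addrC.
  by rewrite -nW lW sN s1 scaleN1r xy addNr inner0l.
exists b, s, W, V; split=> //; split=> // x; exact: WI.
Qed.

End WignerMap.

(** * Maps that fix rank-one projections up to scalars *)

Section DiagonalIdentity.
Variables (R : realType) (H : hilbertType R).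
Local Notation C := R[i].
Implicit Types (x y z : H) (a b : C) (A B P Q : bop H) (e : onbasis H).
Local Notation I := (bop_id H).

(** In the plane of e n and e m the basis is turned by 45 degrees. *)
Lemma rotate_basis e n m : n != m -> exists e' : onbasis H,
  (forall A c, diagonal_op e A -> A (e n) = c *: e n -> A (e m) = c *: e m ->
    diagonal_op e' A) /\
  exists i r, r != 0 /\ e' i = r *: (e n + e m).
Proof.
move=> nm; have [r [r0 rr rr2]] := inv_sqrt2 R.
(* The factor r is the inverse square root of 2. *)
pose f i : H := if i == n then r *: (e n + e m) else
  if i == m then r *: (e n - e m) else e i.
have mn : m == n = false by rewrite eq_sym (negbTE nm).
have fn : f n = r *: (e n + e m) by rewrite /f eqxx.
have fm : f m = r *: (e n - e m) by rewrite /f mn eqxx.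
have fi i : i != n -> i != m -> f i = e i by rewrite /f => /negbTE -> /negbTE ->.
have E := @onb_inner _ _ e.
have nmf : n == m = false by exact: negbTE.
have fo i j : '[f i, f j] = (i == j)%:R.
  have [->|jn] := eqVneq j n; have [->|i_n] := eqVneq i n.
  - rewrite fn innerZl innerZr rr innerDl !innerDr !E !eqxx nmf mn /=.
    by transitivity (r * r * 2%:R); [ring|rewrite rr2].
  - have [->|im] := eqVneq i m.
      rewrite fn fm innerZl innerZr rr innerBl !innerDr !E !eqxx nmf mn /=; ring.
    by rewrite fi// fn innerZr innerDr !E (negbTE i_n) (negbTE im) addr0 mulr0.
  - have [->|jm] := eqVneq j m.
      rewrite fn fm innerZl innerZr rr innerDl !innerBr !E !eqxx nmf mn /=; ring.
    rewrite fn (fi j)// innerZl innerDl !E ![_ == j]eq_sym (negbTE jn) (negbTE jm).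
    by rewrite addr0 mulr0.
  - have [->|jm] := eqVneq j m; have [->|im] := eqVneq i m.
    + rewrite fm innerZl innerZr rr innerBl !innerBr !E !eqxx nmf mn /=.
    by transitivity (r * r * 2%:R); [ring|rewrite rr2].
    + by rewrite (fi i)// fm innerZr innerBr !E (negbTE i_n) (negbTE im) subr0 mulr0.
    + rewrite (fi j)// fm innerZl innerBl !E ![_ == j]eq_sym (negbTE jn) (negbTE jm).
      by rewrite subr0 mulr0.
    + by rewrite !fi.
have ft : total_family f.
  move=> x xf; apply: (@onb_total _ _ e) => i.
  have := xf n; rewrite fn innerZr rr => /eqP; rewrite mulf_eq0 (negbTE r0) /= innerDr => /eqP xn.
  have := xf m; rewrite fm innerZr rr => /eqP; rewrite mulf_eq0 (negbTE r0) /= innerBr subr_eq0 => /eqP xm.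
  have x0 : '[x, e m] = 0.
    by move/eqP: xn; rewrite xm -mulr2n mulrn_eq0 /= => /eqP.
  have [->|i_n] := eqVneq i n; first by rewrite xm.
  have [->|im] := eqVneq i m; first by [].
  by have := xf i; rewrite fi.
exists (Onbasis fo (total_dense fo ft)); split; last by exists n, r.
move=> A c dA An Am; apply/diag_eig => i /=.
have [->|i_n] := eqVneq i n.
  by exists c; rewrite fn bop_scale bop_add An Am -scalerDr !scalerA mulrC.
have [->|im] := eqVneq i m.
  by exists c; rewrite fm bop_scale bop_sub An Am -scalerBr !scalerA mulrC.
by rewrite fi//; move/diag_eig: dA; apply.
Qed.

(** X A commutes with each X (ketbra (e j) (e j)), so X A is diagonal in e as well.
    If A has equal eigenvalues at n and m it is also diagonal in the rotated basis,
    so X A has equal eigenvalues at n and m too; subtracting a multiple of the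
    projection onto e n reduces arbitrary eigenvalues to this case and shows that
    the eigenvalues of A and X A differ by a constant. *)
Lemma diag_linear_identity (X : {linear bop H -> bop H}) :
  (forall x, '[x, x] = 1 -> exists a, X (ketbra x x) = a *: I + ketbra x x) ->
  (forall e A P, is_proj P -> diagonal_op e A -> diagonal_op e P ->
     commuting (X A) (X P)) ->
  forall e A, diagonal_op e A -> exists c, X A = A + c *: I.
Proof.
move=> XP Xc.
have Xd e A : diagonal_op e A -> diagonal_op e (X A).
  move=> dA; apply/diag_eig => j; have e1 := @onb_unit _ _ e j.
  have [a Xj] := XP _ e1.
  have := Xc e A _ (proj_ketbra e1) dA (diag_ketbra j) (e j).
  rewrite Xj !bopE !bop_idE !ketbraE e1 scale1r bop_add bop_scale => /addrI Xe.
  by exists '[X A (e j), e j].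
move=> e A dA; have /diag_eig/choice[al alE] := dA.
have /diag_eig/choice[be beE] := Xd e A dA.
have diff n m : be n - al n = be m - al m.
  have [->//|nm] := eqVneq n m; have [e' [de' [i [r [r0 e'i]]]]] := rotate_basis nm.
  pose d := al n - al m; pose A' := - d *: ketbra (e n) (e n) + A.
  have dA' : diagonal_op e A' by apply: diag_lin => //; exact: diag_ketbra.
  have mn : m == n = false by rewrite eq_sym (negbTE nm).
  have [|g gE] := (diag_eig e' (X A')).1 _ i.
    apply/Xd/(de' _ (al m)) => //.
      rewrite /A' !bopE ketbraE onb_unit scale1r alE -scalerDl; congr (_ *: _).
      by rewrite /d opprB addrNK.
    by rewrite /A' !bopE ketbraE onb_inner mn scale0r scaler0 add0r alE.
  have [a Xn] := XP _ (@onb_unit _ _ e n).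
  have XA' : X A' = - d *: (a *: I + ketbra (e n) (e n)) + X A.
    by rewrite linearP Xn.
  move: gE; rewrite e'i bop_scale scalerA mulrC -scalerA => /(scalerI r0).
  rewrite XA' !bopE bop_idE ketbraE !bop_add innerDl onb_unit onb_inner mn addr0 scale1r.
  rewrite !beE => gE.
  have := congr1 (fun v => '[v, e n]) gE; have := congr1 (fun v => '[v, e m]) gE.
  rewrite !(innerDl, innerZl) !onb_inner !eqxx mn (negbTE nm) /d => E1 E2.
  have E : - (al n - al m) * (a * 1 + 1) + be n = - (al n - al m) * (a * 1) + be m.
    transitivity g.
      by move: E2; rewrite !(mulr0, addr0, mulr1).
    by move: E1; rewrite !(mulr0, addr0, add0r, mulr1).
  apply/eqP; rewrite -subr_eq0; move/eqP: E; rewrite -subr_eq0 => /eqP <-.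
  by apply/eqP; ring.
have [[n0 _]|no] := pselect (exists n : seq_index (onb_length e), True).
  exists (be n0 - al n0); apply: (bop_ext_onb (e := e)) => j.
  by rewrite beE !bopE bop_idE alE -scalerDl (diff n0 j) addrC subrK.
by exists 0; apply: (bop_ext_onb (e := e)) => j; case: no; exists j.
Qed.

End DiagonalIdentity.

Section FiniteBlocks.
Variables (R : realType) (H : hilbertType R).
Local Notation C := R[i].
Implicit Types (x y z : H) (a b : C) (A B P Q : bop H) (e : onbasis H).
Local Notation I := (bop_id H).

(** Killing the orthogonal complement of finitely many vectors: for a projection
    this means that the range is finite dimensional. *)
Definition finite_rank P := exists n (L : 'I_n -> H),
  forall x, (forall j, '[x, L j] = 0) -> P x = 0.

Definition subspace (V : set H) := V 0 /\ forall a x y, V x -> V y -> V (a *: x + y).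

Lemma subspace_sum (V : set H) (I : Type) (s : seq I) (k : I -> C) (F : I -> H) :
  subspace V -> (forall i, V (F i)) -> V (\sum_(i <- s) k i *: F i).
Proof.
move=> [V0 VD] VF; elim: s => [|i s IH]; first by rewrite big_nil.
by rewrite big_cons; apply: VD.
Qed.

(** The iterates of A at v are linearly dependent, so p(A) v = 0 for a nonzero
    polynomial p. Splitting off a linear factor X - z, either q(A) v is an
    eigenvector or the polynomial q of smaller degree can be used. *)
Lemma finite_rank_eigenvector A P (V : set H) v : finite_rank P -> subspace V ->
  (forall x, V x -> P x = x) -> (forall x, V x -> V (A x)) -> V v -> v <> 0 ->
  exists w, [/\ V w, w <> 0 & exists c, A w = c *: w].
Proof.
move=> [n [L PL]] sV VP VA Vv v0; pose Av i := iter i A v.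
have VAv i : V (Av i) by elim: i => //= i; exact: VA.
pose ev N (p : {poly C}) := \sum_(i < N) p`_i *: Av i.
have Vev N p : V (ev N p) by apply: subspace_sum.
have eig N : forall p : {poly C}, p != 0 -> (size p <= N.+1)%N -> ev N.+1 p = 0 ->
    exists w, [/\ V w, w <> 0 & exists c, A w = c *: w].
  elim: N => [|N IH] p p0 sp pv.
    move: pv; rewrite /ev big_ord_recl big_ord0 addr0 /Av /= => /eqP.
    rewrite scaler_eq0 => /orP[/eqP p00|/eqP //].
    move: p0; rewrite -lead_coef_eq0 lead_coefE; move: sp.
    by case: (size p) => [|[|//]] _ /=; rewrite p00 eqxx.
  have [s1|] := eqVneq (size p) 1%N.
    by apply: (IH p p0); rewrite ?s1//; move: pv; rewrite {1}/ev big_ord_recr /= nth_default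
       ?s1// scale0r addr0.
  move=> /closed_rootP[z /factor_theorem[q pE]].
  have q0 : q != 0 by apply: contraNneq p0 => q0; rewrite pE q0 mul0r.
  have sq : (size q <= N.+1)%N.
    by move: sp; rewrite pE size_Mmonic ?monicXsubC// size_XsubC addn2.
  have [qv|qv] := eqVneq (ev N.+1 q) 0; first exact: (IH q).
  exists (ev N.+1 q); split=> //; first exact/eqP.
  exists z; apply/eqP; rewrite -subr_eq0; apply/eqP; rewrite -pv /ev.
  have pi i : p`_i = (if i == 0 then 0 else q`_i.-1) - q`_i * z.
    by rewrite pE mulrBr coefB coefMX coefMC.
  transitivity (\sum_(i < N.+1) q`_i *: Av i.+1 - z *: \sum_(i < N.+1) q`_i *: Av i).
    rewrite bop_sum; congr (_ - _); apply: eq_bigr => i _.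
    by rewrite bop_scale.
  under [RHS]eq_bigr do rewrite pi scalerBl.
  rewrite sumrB; congr (_ - _).
    by rewrite [RHS]big_ord_recl /= scale0r add0r.
  rewrite [RHS]big_ord_recr /= nth_default// mul0r scale0r addr0 scaler_sumr.
  by apply: eq_bigr => i _; rewrite scalerA mulrC.
pose vw (i : 'I_n.+1) := Av i.
have [c [i ci] cL] := orthogonal_combination vw L.
(* The coefficients of a nontrivial relation between the iterates. *)
pose p : {poly C} := \poly_(i < n.+1) c (inord i).
have pc (j : 'I_n.+1) : p`_j = c j by rewrite coef_poly ltn_ord inord_val.
have p0 : p != 0.
  by apply: contraNneq ci => p0; rewrite -pc p0 coef0.
apply: (eig n p p0); first exact: size_poly.
rewrite -[LHS]VP; last exact: Vev.
have -> : ev n.+1 p = \sum_i c i *: vw i by apply: eq_bigr => k _; rewrite pc.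
exact: PL.
Qed.

(** An operator commuting with the increasing projections Q k is a direct sum of
    self-adjoint operators on finite dimensional spaces. The basis consists of
    eigenvectors of A lying in one of these blocks. *)
Lemma selfadjoint_diagonalizable A (Q : nat -> bop H) : separable H ->
  (forall x y, '[A x, y] = '[x, A y]) ->
  (forall k, is_proj (Q k)) -> (forall k, finite_rank (Q k)) ->
  (forall j k, (j <= k)%N -> forall x, Q k (Q j x) = Q j x) ->
  (forall k, commuting A (Q k)) ->
  (forall x, (forall k, Q k x = 0) -> x = 0) ->
  exists e, diagonal_op e A.
Proof.
move=> sepH As pQ fQ Qinc AQ Qsep.
have Qdec j k x : (j <= k)%N -> Q j (Q k x) = Q j x.
  move=> jk; apply: inner_ext => y.
  by rewrite (pQ j).2 (pQ k).2 Qinc// -(pQ j).2.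
pose G := [set v : H | (exists c, A v = c *: v) /\ forall k, Q k v = v \/ Q k v = 0].
have [|||e [eG _]] := @onbasis_in _ _ G set0 sepH (orthonormal0 H).
- by move=> x.
- move=> a x [[c Ax] Qx]; split; first by exists c; rewrite bop_scale Ax !scalerA mulrC.
  by move=> k; rewrite bop_scale; case: (Qx k) => ->; rewrite ?scaler0; [left|right].
- move=> S _ SG oS z z0 zS.
  have exk : exists k, Q k z != 0.
    apply: contrapT => nk; apply: z0; apply: Qsep => k.
    by apply: contrapT => Qz; apply: nk; exists k; exact/eqP.
  (* Q k z lies in the k-th block, as k is minimal. *)
  have [k Qkz kmin] := ex_minnP exk.
  pose V := [set x | [/\ Q k x = x, forall j, (j < k)%N -> Q j x = 0 &
                         forall s, S s -> '[x, s] = 0]].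
  have sV : subspace V.
    split; first by split=> [|j _|s _]; rewrite ?bop_zero ?inner0l.
    move=> a x y [Qx Qx0 xS] [Qy Qy0 yS]; split=> [|j jk|s Ss].
    - by rewrite bop_add bop_scale Qx Qy.
    - by rewrite bop_add bop_scale Qx0// Qy0// scaler0 addr0.
    - by rewrite innerDl innerZl xS// yS// mulr0 addr0.
  have VA x : V x -> V (A x).
    move=> [Qx Qx0 xS]; split=> [|j jk|s Ss].
    - by rewrite -AQ Qx.
    - by rewrite -AQ Qx0// bop_zero.
    - by rewrite As; have [[c ->] _] := SG _ Ss; rewrite innerZr xS// mulr0.
  have Vz : V (Q k z).
    split; first exact: (pQ k).1.
      move=> j jk; rewrite Qdec ?(ltnW jk)//; apply: contrapT => /eqP Qjz.
      by move: (kmin j Qjz); rewrite leqNgt jk.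
    by apply: (proj_orth_set (pQ k) _ zS) => s /SG[].
  have [w [[Qw Qw0 wS] w0 Aw]] := finite_rank_eigenvector (fQ k) sV
    (fun x Vx => let: And3 h _ _ := Vx in h) VA Vz (elimN eqP Qkz).
  exists w; split=> //; split=> // j; have [jk|kj] := ltnP j k; first by right; exact: Qw0.
  by left; rewrite -Qw Qinc.
exists e; apply/diag_eig => j; exact: (eG j).1.
Qed.

End FiniteBlocks.

Section Filtration.
Variables (R : realType) (H : hilbertType R).
Local Notation C := R[i].
Implicit Types (x y z : H) (a b : C) (A B P Q : bop H) (e : onbasis H).
Local Notation I := (bop_id H).
Hypothesis sepH : separable H.

Definition projects_onto P (S : set H) := [/\ is_proj P,
  forall s, S s -> P s = s & forall x, (forall s, S s -> '[x, s] = 0) -> P x = 0].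

(** The projection onto the closed span of S: its Fourier sum with respect to a
    maximal orthonormal set inside the double orthogonal complement G of S. *)
Lemma projection_exists (S : set H) : exists P, projects_onto P S.
Proof.
pose G := [set x : H | forall y, (forall s, S s -> '[y, s] = 0) -> '[x, y] = 0].
have GD a x y : G x -> G y -> G (a *: x + y).
  by move=> Gx Gy z zS; rewrite innerDl innerZl Gx// Gy// mulr0 addr0.
have [|B [_ BG oB maxB]] := @max_orthonormal _ _ G set0 (orthonormal0 H).
  by move=> x.
have [d [e [oe re]]] := orthonormal_enum sepH oB.
have eG i : G (e i) by apply: BG; rewrite -re; exists i.
have /choice[P PP] : forall x, exists y, (forall i, '[y, e i] = '[x, e i]) /\
    exists2 u : nat -> H, (forall n, linspan e (u n)) & u @ \oo --> y.
  by move=> x; exact: fourier.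
have Pe x i : '[P x, e i] = '[x, e i] by exact: (PP x).1.
have Po x z : (forall i, '[z, e i] = 0) -> '[P x, z] = 0.
  move=> ze; have [_ [u us ux]] := PP x.
  by apply: (inner_lim (N := 0%N) ux) => n _; exact: linspan_orth (us n) ze.
have PPl x y : '[P x, y] = '[P x, P y].
  apply/eqP; rewrite -subr_eq0 -innerBr; apply/eqP/Po => i.
  by rewrite innerBl Pe subrr.
have Ps x y : '[P x, y] = '[x, P y] by rewrite PPl [RHS]innerC [in RHS]PPl -innerC.
have lP : linear P.
  move=> a x y; apply: inner_ext => z.
  by rewrite innerDl innerZl !Ps innerDl innerZl.
have bP x : `|P x| <= 1 * `|x|.
  rewrite mul1r; have [->|x0] := eqVneq (P x) 0; first by rewrite normr0.
  have : `|P x| ^+ 2 <= `|P x| * `|x|.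
    rewrite inner_normE -[leLHS]ger0_norm ?inner_ge0// -PPl mulrC innerC norm_conjC.
    exact: cauchy_schwarz.
  by rewrite expr2 ler_pM2l// normr_gt0.
exists (Bop (bounded_bop lP ler01 bP)); split=> /=.
- by split=> // x /=; apply: inner_ext => y; rewrite Ps -PPl.
- move=> s Ss; apply/esym/eqP; rewrite -subr_eq0; apply/negPn/negP => sP.
  apply: (maxB (normalized (s - P s))).
  + move=> z zS; rewrite innerZl innerBl (inner_eq0C (zS s Ss)) sub0r Po ?oppr0 ?mulr0// => i.
    exact/inner_eq0C/eG.
  + exact: normalized_unit.
  + by move=> t; rewrite -re => -[i _ <-]; rewrite innerZl innerBl Pe subrr mulr0.
- move=> x xS; apply: inner_eq0; rewrite -PPl; apply: Po => i.
  exact/inner_eq0C/eG.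
Qed.

Lemma projects_sub P S Q : projects_onto P S -> is_proj Q ->
  (forall s, S s -> Q s = s) -> forall x, Q (P x) = P x.
Proof.
move=> [pP _ P0] pQ QS x.
have PQ y : P (Q y) = P y.
  apply/esym/eqP; rewrite -subr_eq0 -bop_sub; apply/eqP/P0 => s Ss.
  by rewrite innerBl pQ.2 QS// subrr.
by apply: inner_ext => y; rewrite pQ.2 !pP.2 PQ.
Qed.

Lemma projects_map P S Q A : projects_onto P S -> is_proj Q ->
  (forall x y, '[A x, y] = '[x, A y]) ->
  (forall s, S s -> Q (A s) = A s) -> forall x, Q (A (P x)) = A (P x).
Proof.
move=> [pP _ P0] pQ As QS x.
have PQ y : P (A (Q y)) = P (A y).
  apply/esym/eqP; rewrite -subr_eq0 -bop_sub; apply/eqP/P0 => s Ss.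
  by rewrite innerBl !As pQ.2 QS// subrr.
by apply: inner_ext => y; rewrite pQ.2 !As !pP.2 PQ.
Qed.

(** The range of P k is the span of a finite list; the next list adds the images
    under A and the next vector of a fixed orthonormal basis. *)
Lemma selfadjoint_filtration A : (forall x y, '[A x, y] = '[x, A y]) ->
  exists P : nat -> bop H, [/\ forall k, is_proj (P k) /\ finite_rank (P k),
    P 0%N = 0, forall k x, P k.+1 (P k x) = P k x,
    forall k x, P k.+1 (A (P k x)) = A (P k x) &
    forall x, (forall k, P k x = 0) -> x = 0].
Proof.
move=> As; have [e] := onbasis_exists sepH.
pose d n : H := oapp e 0 (pickle_inv n : option (seq_index (onb_length e))).
pose fix L n : seq H := if n is k.+1 then L k ++ map A (L k) ++ [:: d k] else [::].
have /choice[P PL] : forall n, exists P, projects_onto P [set` L n].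
  by move=> n; exact: projection_exists.
have pP k : is_proj (P k) by case: (PL k).
have PS k s : s \in L k -> P k s = s by case: (PL k) => _ + _; apply.
exists P; split=> [k||k|k|x Px].
- split=> //; exists (size (L k)), (fun i => nth 0 (L k) i) => x xL.
  have [_ _ P0] := PL k; apply: P0 => s /= /(nthP 0)[i il <-].
  exact: (xL (Ordinal il)).
- by apply: bopP => x; have [_ _ P0] := PL 0%N; rewrite P0// => s.
- apply: (projects_sub (PL k)) => // s sL; apply: PS.
  by rewrite /= mem_cat sL.
- apply: (projects_map (PL k)) => // s sL; apply: PS.
  by rewrite /= !mem_cat map_f ?orbT.
- apply: (@onb_total _ _ e) => i; pose k := pickle i.
  have dk : d k = e i by rewrite /d /k pickleK_inv.
  have : P k.+1 (d k) = d k by apply: PS; rewrite /= !mem_cat inE eqxx !orbT.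
  by rewrite dk => <-; rewrite -(pP _).2 Px inner0l.
Qed.

(** With E k = P k.+1 - P k, the operator A is block tridiagonal: E i A E j = 0
    when i and j differ by more than 1. Let W be the symmetry acting as + + - - on
    the successive ranges of the E k. Then A + W A W keeps only couplings between
    blocks with equal signs, and A - W A W those between blocks with opposite
    signs, so that the first commutes with P 2, P 4, P 6 and so on and the second
    with P 1, P 3, P 5 and so on: both are direct sums of finite blocks. *)
Lemma selfadjoint_sum_diagonal A : (forall x y, '[A x, y] = '[x, A y]) ->
  exists B1 B2 e1 e2, [/\ diagonal_op e1 B1, diagonal_op e2 B2 & A = B1 + B2].
Proof.
move=> As; have [P [PP P0 Pinc PA Psep]] := selfadjoint_filtration As.
have pP k := (PP k).1; have fP k := (PP k).2.
have PI j k x : (j <= k)%N -> P k (P j x) = P j x.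
  elim: k => [|k IH]; first by rewrite leqn0 => /eqP ->; exact: (pP 0%N).1.
  rewrite leq_eqVlt => /orP[/eqP ->|jk]; first exact: (pP k.+1).1.
  by rewrite -(IH jk) Pinc.
have PD j k x : (j <= k)%N -> P j (P k x) = P j x.
  by move=> jk; apply: inner_ext => y; rewrite (pP j).2 (pP k).2 PI// -(pP j).2.
pose E k x := P k.+1 x - P k x.
have EE j k x : (j < k)%N -> E j (E k x) = 0.
  move=> jk; rewrite /E !bop_sub !PD ?(ltnW jk)// ?(leqW jk)//; last exact: leqW (ltnW jk).
  by rewrite !subrr.
have Es k x y : '[E k x, y] = '[x, E k y].
  by rewrite innerBl innerBr (pP k.+1).2 (pP k).2.
have EEk k x : E k (E k x) = E k x.
  by rewrite /E !bop_sub (pP k.+1).1 (pP k).1 PI// PD// subrr subr0.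
have EE' j k x : (k < j)%N -> E j (E k x) = 0.
  by move=> jk; apply: inner_ext => y; rewrite !Es EE// inner0r inner0l.
have ED k x : E k x = P k.+1 x - P k x by [].
clearbody E.
(* eps runs through the signs + + - - periodically. *)
pose eps k : C := (-1) ^+ k./2.
pose S := [set x : H | exists k, ~~ odd k./2 /\ E k x = x].
have [M [pM MS MO]] := projection_exists S.
pose W : bop H := M + M - I.
have WE k x : E k x = x -> W x = eps k *: x.
  move=> Ex; rewrite /W !bopE bop_idE /eps -signr_odd; case: (boolP (odd k./2)) => ok.
    rewrite MO ?add0r ?sub0r ?expr1 ?scaleN1r// => s [j [oj Es']].
    have jk : j != k by apply: contraTneq ok => <-.
    rewrite -Ex -Es' Es; case: (ltngtP j k) jk => // jk _.
      by rewrite EE' ?inner0r.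
    by rewrite EE ?inner0r.
  by rewrite MS ?expr0 ?scale1r ?addrK//; exists k.
have Ws x y : '[W x, y] = '[x, W y].
  by rewrite /W !bopE !bop_idE innerBl innerBr innerDl innerDr !pM.2.
clearbody W.
have WP k x : P k (W (P k x)) = W (P k x).
  have -> : P k x = \sum_(i < k) E i x.
    elim: k => [|k IH]; first by rewrite big_ord0 P0.
    by rewrite big_ord_recr /= -IH ED addrC subrK.
  rewrite bop_sum bop_sum; apply: eq_bigr => i _.
  have Pk : P k (E i x) = E i x by rewrite ED bop_sub !PI// ltnW.
  by rewrite (WE i)// bop_scale Pk.
have Wc k x : P k (W x) = W (P k x).
  rewrite -WP; apply: inner_ext => y.
  by rewrite !(pP k).2 !Ws (pP k).2 WP.
have epse k : eps k * eps k = 1.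
  by rewrite -expr2 sqrr_sign.
pose B (s : C) : bop H := A + s *: bop_comp W (bop_comp A W).
have BE s x : B s x = A x + s *: W (A (W x)) by [].
have BsE s : B s = A + s *: bop_comp W (bop_comp A W) by [].
clearbody B.
have Bs s x y : s^* = s -> '[B s x, y] = '[x, B s y].
  by move=> ss; rewrite !BE innerDl innerDr innerZl innerZr ss As !Ws As Ws.
(* The coupling E m.+1 A E m occurs in B s with coefficient 1 + s eps m eps m.+1;
   it is the only one between the range of P m.+1 and its complement. *)
have BP s m : s^* = s -> 1 + s * (eps m * eps m.+1) = 0 ->
    commuting (B s) (P m.+1).
  move=> ss sm; suff PB x : P m.+1 (B s (P m.+1 x)) = B s (P m.+1 x).
    move=> x; rewrite -PB; apply: inner_ext => y.
    by rewrite !(pP m.+1).2 !Bs// (pP m.+1).2 PB.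
  have -> : P m.+1 x = P m x + E m x by rewrite ED addrC subrK.
  rewrite !bop_add; congr (_ + _).
    by rewrite !BE -(Wc m x) bop_add bop_scale PA (Wc m.+1) PA.
  pose y := A (E m x).
  have y2 : P m.+2 y = y.
    by rewrite /y -{1}(_ : P m.+1 (E m x) = E m x) ?PA// ED bop_sub (pP m.+1).1 PI.
  have yE : y = P m.+1 y + E m.+1 y by rewrite ED y2 addrC subrK.
  have WEm : W (E m x) = eps m *: E m x by apply: WE; exact: EEk.
  have WEy : W (E m.+1 y) = eps m.+1 *: E m.+1 y by apply: WE; exact: EEk.
  have Pv : P m.+1 (E m.+1 y) = 0 by rewrite ED bop_sub PD// (pP m.+1).1 subrr.
  have BEm : B s (E m x) = y + (s * eps m) *: W y.
    by rewrite BE WEm !bop_scale -/y scalerA.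
  have Wy : W y = W (P m.+1 y) + eps m.+1 *: E m.+1 y by rewrite -WEy -bop_add -yE.
  rewrite BEm Wy bop_add !bop_scale bop_add bop_scale WP Pv scaler0 addr0.
  rewrite [X in _ = X + _]yE scalerDr addrACA -[LHS]addr0; congr (_ + _).
  by rewrite scalerA -[E m.+1 y]scale1r scalerA mulr1 -scalerDl -mulrA sm scale0r.
have diag s n0 : s^* = s -> (forall k, commuting (B s) (P (k.*2 + n0)%N)) ->
    exists e, diagonal_op e (B s).
  move=> ss Bk; apply: (selfadjoint_diagonalizable (Q := fun k => P (k.*2 + n0)%N)) => //.
  - by move=> x y; exact: Bs.
  - by move=> j k jk x; apply: PI; rewrite leq_add2r leq_double.
  - move=> x Px; apply: Psep => k; rewrite -(PD k (k.*2 + n0)%N).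
      by rewrite Px bop_zero.
    by rewrite (leq_trans _ (leq_addr _ _))// -addnn leq_addr.
have [e1 d1] : exists e, diagonal_op e (B 1).
  apply: (@diag 1 2%N); first exact: rmorph1.
  move=> k; rewrite addn2; apply: BP; first exact: rmorph1.
  rewrite mul1r /eps -signr_odd -[X in _ * X]signr_odd.
  by rewrite /= uphalf_double doubleK /=; case: (odd k);
    rewrite !(expr0, expr1, mulN1r, mulrN1, mul1r, mulr1, opprK, subrr, addNr).
have [e2 d2] : exists e, diagonal_op e (B (-1)).
  apply: (@diag (-1) 1%N); first by rewrite rmorphN rmorph1.
  move=> k; rewrite addn1; apply: BP; first by rewrite rmorphN rmorph1.
  have -> : eps k.*2.+1 = eps k.*2 by rewrite /eps /= uphalf_double doubleK.
  by rewrite epse mulr1 subrr.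
have n2 : (2%:R : C) != 0 by rewrite pnatr_eq0.
exists (2%:R^-1 *: B 1), (2%:R^-1 *: B (-1)), e1, e2; split.
- by rewrite -[_ *: _]addr0; apply: diag_lin => // i j _; rewrite inner0l.
- by rewrite -[_ *: _]addr0; apply: diag_lin => // i j _; rewrite inner0l.
- by rewrite -scalerDr !BsE scale1r scaleN1r addrACA subrr addr0 -mulr2n -[A *+ 2]scaler_nat
    scalerA mulVf// scale1r.
Qed.

(** Diagonal operators span all operators, by the decomposition into real and
    imaginary parts. *)
Lemma linear_identity (X : {linear bop H -> bop H}) :
  (forall x, '[x, x] = 1 -> exists a, X (ketbra x x) = a *: I + ketbra x x) ->
  (forall e A P, is_proj P -> diagonal_op e A -> diagonal_op e P ->
     commuting (X A) (X P)) ->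
  forall A, exists c, X A = A + c *: I.
Proof.
move=> XP Xc; have Xd := diag_linear_identity XP Xc.
have Xs A : (forall x y, '[A x, y] = '[x, A y]) -> exists c, X A = A + c *: I.
  move=> /selfadjoint_sum_diagonal[B1 [B2 [e1 [e2 [d1 d2 ->]]]]].
  have [c1 E1] := Xd _ _ d1; have [c2 E2] := Xd _ _ d2; exists (c1 + c2).
  by rewrite linearD E1 E2 addrACA scalerDl.
move=> A; pose S1 := A + adjoint A; pose S2 := 'i *: (A - adjoint A).
have [|c1 E1] := Xs S1.
  by move=> x y; rewrite /S1 !bopE innerDl innerDr adjointE// -adjointEr// addrC.
have [|c2 E2] := Xs S2.
  move=> x y; rewrite /S2 !bopE innerZl innerZr innerBl innerBr conjCi.
  by rewrite -(adjointE sepH A x y) -(adjointEr sepH A x y) mulNr -mulrN opprB.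
have n2 : (2%:R : C) != 0 by rewrite pnatr_eq0.
have ii : ('i : C) * 'i = -1 by rewrite -expr2 sqrCi.
have AE : A = 2%:R^-1 *: S1 + (- (2%:R^-1 * 'i)) *: S2.
  apply: bopP => x; rewrite /S1 /S2 !bopE; apply: inner_ext => y.
  rewrite !(innerDl, innerBl, innerNl, innerZl).
  transitivity (2%:R^-1 * (2%:R * '[A x, y])); first by rewrite mulrA mulVf// mul1r.
  rewrite -[LHS]addr0.
  have -> : - (2%:R^-1 * 'i) * ('i * ('[A x, y] - '[adjoint A x, y])) =
    2%:R^-1 * ('[A x, y] - '[adjoint A x, y]).
    by rewrite mulrA mulNr -mulrA ii mulrN1 opprK.
  by ring.
clearbody S1 S2; exists (2%:R^-1 * c1 + - (2%:R^-1 * 'i) * c2).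
rewrite {1}AE linear_two_terms E1 E2 !scalerDr addrACA -AE !scalerA.
by rewrite -scalerDl.
Qed.

End Filtration.

(** * The standard form and its consequences *)

Section StandardForm.
Variables (R : realType) (H : hilbertType R).
Local Notation C := R[i].
Implicit Types (x y z : H) (a b : C) (A B P Q : bop H) (e : onbasis H) (J : conjugation H).
Local Notation I := (bop_id H).

Definition scalar_twist (t : bool) : C -> C := if t then Num.conj else id.
(** The adjoint makes A |-> U A^* V linear when U is antilinear, so that both cases
    of the standard form are given by linear maps. *)
Definition twist (t : bool) A := if t then adjoint A else A.

Definition standard_form (T : bop H -> bop H) :=
  exists t c U V (uU : semiunitary (scalar_twist t) U V), c != 0 /\
    forall A, exists k, T A = c *: sandwich uU (twist t A) + k *: I.

Lemma semiunitary_scale s U V (uU : semiunitary s U V) a x : U (a *: x) = s a *: U x.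
Proof.
have [_ lU _ _ Ui] := uU; have U0 : U 0 = 0.
  by apply: inner_eq0; rewrite Ui inner0l (semiunitary0 uU).
by rewrite -[a *: x]addr0 lU U0 addr0.
Qed.

Lemma sandwich_lin s U V (uU : semiunitary s U V) a A B :
  sandwich uU (a *: A + B) = s a *: sandwich uU A + sandwich uU B.
Proof. by have [_ lU _ _ _] := uU; apply: bopP => x; rewrite /= lU. Qed.

Lemma sandwich_id s U V (uU : semiunitary s U V) : sandwich uU I = I.
Proof. by have [_ _ _ VU _] := uU; apply: bopP => x; rewrite /= VU. Qed.

Lemma sandwich_commuting s U V (uU : semiunitary s U V) A B : commuting A B ->
  commuting (sandwich uU A) (sandwich uU B).
Proof. by have [_ _ UV _ _] := uU; move=> AB x; rewrite /= !UV AB. Qed.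

Lemma sandwich_ketbra s U V (uU : semiunitary s U V) x :
  sandwich uU (ketbra x x) = ketbra (U x) (U x).
Proof.
have [_ _ _ VU Ui] := uU; apply: bopP => y.
by rewrite ketbraE /= (semiunitary_scale uU) -[in RHS](VU y) Ui.
Qed.

Hypothesis sepH : separable H.

Lemma commuting_adjoint A B : commuting A B -> commuting (adjoint A) (adjoint B).
Proof.
by move=> AB x; apply: inner_extr => y; rewrite -!adjointE// AB.
Qed.

Lemma sandwich_adjoint s U V (uU : semiunitary s U V) A :
  adjoint (sandwich uU A) = sandwich uU (adjoint A).
Proof.
have [_ _ UV VU Ui] := uU; apply: adjoint_unique => // x y /=.
by rewrite -{1}(VU y) Ui adjointE// -Ui VU.
Qed.

Lemma scalar_twistK t a : scalar_twist t (scalar_twist t a) = a.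
Proof. by case: t => //=; rewrite conjCK. Qed.

Lemma twist_lin t a A B :
  twist t (a *: A + B) = scalar_twist t a *: twist t A + twist t B.
Proof. by case: t => //=; rewrite adjointD// adjointZ. Qed.

Lemma twist_id t : twist t I = I.
Proof. by case: t => //=; exact: adjoint_id. Qed.

Lemma twist_ketbra t x : twist t (ketbra x x) = ketbra x x.
Proof. by case: t => //=; exact: adjoint_ketbra. Qed.

Lemma twistK t A : twist t (twist t A) = A.
Proof. by case: t => //=; exact: adjointK. Qed.

Lemma twist_commuting t A B : commuting A B -> commuting (twist t A) (twist t B).
Proof. by case: t => //=; exact: commuting_adjoint. Qed.

Lemma sandwichK s U V (uU : semiunitary s U V) (uV : semiunitary s V U) A :
  sandwich uU (sandwich uV A) = A.
Proof. by have [_ _ UV VU _] := uU; apply: bopP => x; rewrite /= !VU. Qed.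

Section Image.
Variable T : {linear bop H -> bop H}.

(** Undoing the semiunitary map that describes T on rank-one projections leaves a
    map that fixes rank-one projections up to scalars, as in linear_identity. *)
Lemma compatible_standard (T' : {linear bop H -> bop H}) :
  (forall x y : H, exists z, [/\ '[z, z] = 1, '[z, x] = 0 & '[z, y] = 0]) ->
  cancel T T' -> cancel T' T -> compatible T -> compatible T' -> standard_form T.
Proof.
move=> dim3 TK TK' cT cT'.
have [b [s [U [V [b0 uU TU]]]]] := wigner sepH dim3 TK TK' cT cT'.
have [t st] : exists t, s = scalar_twist t.
  by case: (uU) => -[->|->] _ _ _ _; [exists false|exists true].
rewrite {}st in uU; exists t, b, U, V, uU; split=> //.
have uV := semiunitary_inv uU.
have [_ _ UV VU Ui] := uU.
(* Psi undoes U and, when U is antilinear, the adjoint. *)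
pose Psi B := twist t (sandwich uV B).
have Psi_lin a A B : Psi (a *: A + B) = a *: Psi A + Psi B.
  by rewrite /Psi sandwich_lin twist_lin scalar_twistK.
have PsiI : Psi I = I by rewrite /Psi sandwich_id twist_id.
have PsiU v : Psi (ketbra (U v) (U v)) = ketbra v v.
  by rewrite /Psi sandwich_ketbra UV twist_ketbra.
have PsiC A B : commuting A B -> commuting (Psi A) (Psi B).
  by move=> AB; apply/twist_commuting/sandwich_commuting.
have PsiK A : sandwich uU (twist t (Psi A)) = A by rewrite /Psi twistK sandwichK.
clearbody Psi; have Psi0 : Psi 0 = 0.
  by have := Psi_lin (-1) 0 0; rewrite scaler0 addr0 scaleN1r addNr.
have PsiZ a A : Psi (a *: A) = a *: Psi A by rewrite -[a *: A]addr0 Psi_lin Psi0 addr0.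
pose X0 A := b^-1 *: Psi (T A).
have lX0 : linear X0.
  by move=> a A B; rewrite /X0 linearP Psi_lin scalerDr !scalerA mulrC.
pose X : {linear bop H -> bop H} := HB.pack X0 (GRing.isLinear.Build _ _ _ _ X0 lX0).
have XE A : X A = b^-1 *: Psi (T A) by [].
clearbody X; move=> A; have [x x1|e B P pP dB dP x|k XA] := linear_identity sepH (X := X) _ _ A.
- have [a Ta] := TU x; exists (b^-1 * a); rewrite XE Ta Psi_lin PsiI PsiZ PsiU.
  by rewrite scalerDr !scalerA mulVf// scale1r.
- rewrite !XE !bopE !bop_scale; congr (_ *: (_ *: _)).
  by apply: PsiC; have [_ _] := cT; apply; eauto.
- exists (b * k).
  have TA : Psi (T A) = b *: A + ((b * k) *: I + 0).
    by rewrite addr0 -scalerA -scalerDr -XA XE scalerA mulfV// scale1r.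
  have z0 : sandwich uU (twist t 0) = 0.
    have := congr1 (sandwich uU) (twist_lin t (-1) 0 0).
    by rewrite scaler0 addr0 sandwich_lin scalar_twistK scaleN1r addNr.
  rewrite -(PsiK (T A)) TA twist_lin sandwich_lin scalar_twistK; congr (_ + _).
  by rewrite twist_lin sandwich_lin scalar_twistK twist_id sandwich_id z0 addr0.
Qed.

Hypothesis surT : forall B, exists A, T A = B.

Lemma image_eq (D D' : set (bop H)) : (forall A, D A <-> D' (T A)) -> T @` D = D'.
Proof.
move=> DD; rewrite eqEsubset; split=> [_ [A /DD DA <-] //|B D'B].
by have [A TA] := surT B; exists A => //; apply/DD; rewrite TA.
Qed.

Lemma onbasis_eq (d : option nat) (f g : seq_index d -> H) o1 d1 o2 d2 : f = g ->
  @Onbasis R H d f o1 d1 = @Onbasis R H d g o2 d2.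
Proof. by move=> fg; subst g; congr Onbasis; exact: Prop_irrelevance. Qed.

Lemma push_basis_subproof s U V (uU : semiunitary s U V) e :
  orthonormal_family (U \o e) /\ dense (linspan (U \o e)).
Proof.
have [_ _ _ VU Ui] := uU.
have oU : orthonormal_family (U \o e).
  move=> i j /=; rewrite Ui onb_inner; case: eqVneq => _.
    exact: semiunitary1 uU.
  exact: semiunitary0 uU.
split=> //; apply: total_dense => // x xU.
have Vx : V x = 0.
  apply: (@onb_total _ _ e) => i; rewrite -(semiunitary_invol uU '[V x, e i]) -Ui VU.
  by rewrite xU (semiunitary0 uU).
by rewrite -(VU x) Vx -[0](scale0r x) (semiunitary_scale uU) (semiunitary0 uU) !scale0r.
Qed.

Definition push_basis s U V (uU : semiunitary s U V) e : onbasis H :=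
  Onbasis (push_basis_subproof uU e).1 (push_basis_subproof uU e).2.

Lemma push_basisK s U V (uU : semiunitary s U V) (uV : semiunitary s V U) :
  cancel (push_basis uU) (push_basis uV).
Proof.
have [_ _ UV _ _] := uU; move=> [d f o1 d1]; apply: onbasis_eq.
by apply/funext => i /=; rewrite UV.
Qed.

Lemma push_conjugation_subproof s U V (uU : semiunitary s U V) J :
  [/\ antilinear (U \o J \o V), involutive (U \o J \o V) &
    forall x y, '[(U \o J \o V) x, (U \o J \o V) y] = '[y, x]].
Proof.
have [sE lU UV VU Ui] := uU; have [_ lV _ _ Vi] := semiunitary_inv uU.
split=> [a x y|x|x y] /=.
- rewrite lV conjugation_lin lU; congr (_ *: _ + _).
  by case: sE => ->; rewrite ?conjCK.
- by rewrite UV conjugationK VU.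
- by rewrite Ui conjugation_inner Vi (semiunitary_invol uU).
Qed.

Definition push_conjugation s U V (uU : semiunitary s U V) J : conjugation H :=
  let: And3 h1 h2 h3 := push_conjugation_subproof uU J in Conjugation h1 h2 h3.

Lemma push_conjugationE s U V (uU : semiunitary s U V) J x :
  push_conjugation uU J x = U (J (V x)).
Proof. by rewrite /push_conjugation; case: push_conjugation_subproof. Qed.

Lemma push_conjugationK s U V (uU : semiunitary s U V) (uV : semiunitary s V U) :
  cancel (push_conjugation uU) (push_conjugation uV).
Proof.
have [_ _ UV _ _] := uU; move=> J; apply: conjugation_eq => x.
by rewrite !push_conjugationE !UV.
Qed.

Lemma push_conjugation_commute s U V (uU : semiunitary s U V) :
  preserves_commutativity (push_conjugation uU).
Proof.
have [_ _ UV VU _] := uU; move=> J1 J2; split=> E; apply/funext => x /=.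
  rewrite !push_conjugationE !UV; congr U.
  exact: (congr1 (fun f => f (V x)) E).
have := congr1 (fun f => V (f (U x))) E.
by rewrite /= !push_conjugationE !UV.
Qed.

Lemma diag_affine e a b A : a != 0 ->
  diagonal_op e A <-> diagonal_op e (a *: A + b *: I).
Proof.
move=> a0; have dI k : diagonal_op e (k *: I).
  by apply/diag_eig => j; exists k; rewrite !bopE bop_idE.
split=> [dA|dA]; first exact: diag_lin.
have -> : A = a^-1 *: (a *: A + b *: I) + (- (b / a)) *: I.
  by apply: bopP => x; rewrite !bopE bop_idE; apply: inner_ext => y;
    rewrite !(innerDl, innerZl); field.
exact: diag_lin.
Qed.

Lemma csym_affine J a b A : a != 0 ->
  csymmetric_op J A <-> csymmetric_op J (a *: A + b *: I).
Proof.
move=> a0; have sI k := csym_scalar sepH J k.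
split=> [sA|sA]; first exact: csym_lin.
have -> : A = a^-1 *: (a *: A + b *: I) + (- (b / a)) *: I.
  by apply: bopP => x; rewrite !bopE bop_idE; apply: inner_ext => y;
    rewrite !(innerDl, innerZl); field.
exact: csym_lin.
Qed.

Lemma diag_twist t e A : diagonal_op e A <-> diagonal_op e (twist t A).
Proof.
case: t => //=; split; first exact: diag_adjoint.
by move=> /(diag_adjoint sepH); rewrite adjointK.
Qed.

Lemma csym_twist t J A : csymmetric_op J A <-> csymmetric_op J (twist t A).
Proof.
case: t => //=; split; first exact: csym_adjoint.
by move=> /(csym_adjoint sepH); rewrite adjointK.
Qed.

Lemma diag_sandwich s U V (uU : semiunitary s U V) e A :
  diagonal_op e A <-> diagonal_op (push_basis uU e) (sandwich uU A).
Proof.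
have [_ _ UV _ Ui] := uU; split=> dA i j ij /=.
  by rewrite UV Ui dA// (semiunitary0 uU).
have := dA i j ij; rewrite /= UV Ui => /(congr1 s).
by rewrite (semiunitary_invol uU) (semiunitary0 uU).
Qed.

Lemma csym_sandwich s U V (uU : semiunitary s U V) J A :
  csymmetric_op J A <-> csymmetric_op (push_conjugation uU J) (sandwich uU A).
Proof.
have [_ _ UV VU _] := uU; split=> /csymP sA; apply/csymP => x.
  by rewrite sandwich_adjoint !push_conjugationE /= !UV sA.
have := sA (U x); rewrite sandwich_adjoint !push_conjugationE /= !UV.
by move=> /(congr1 V); rewrite !UV.
Qed.

Lemma standard_basis_preserver : standard_form T ->
  exists2 phi : onbasis H -> onbasis H, bijective phi &
    forall e, T @` diagonal_op e = diagonal_op (phi e).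
Proof.
move=> [t [c [U [V [uU [c0 TE]]]]]]; have uV := semiunitary_inv uU.
exists (push_basis uU).
  by exists (push_basis uV); exact: push_basisK.
move=> e; apply: image_eq => A; have [k ->] := TE A.
by rewrite (diag_twist t) (diag_sandwich uU) (diag_affine _ k _ c0).
Qed.

Lemma standard_conjugation_preserver : standard_form T ->
  exists2 psi : conjugation H -> conjugation H,
    bijective psi /\ preserves_commutativity psi &
    forall J, T @` csymmetric_op J = csymmetric_op (psi J).
Proof.
move=> [t [c [U [V [uU [c0 TE]]]]]]; have uV := semiunitary_inv uU.
exists (push_conjugation uU).
  split; last exact: push_conjugation_commute.
  by exists (push_conjugation uV); exact: push_conjugationK.
move=> J; apply: image_eq => A; have [k ->] := TE A.
by rewrite (csym_twist t) (csym_sandwich uU) (csym_affine _ k _ c0).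
Qed.

End Image.
End StandardForm.

Section OperatorForm.
Variables (R : realType) (H : hilbertType R).
Local Notation C := R[i].
Implicit Types (x y z : H) (a b : C) (A B P Q : bop H).
Local Notation I := (bop_id H).

Lemma bop_norm_le A x : `|A x| <= `|A| * `|x|.
Proof.
have [->|x0] := eqVneq x 0; first by rewrite bop_zero !normr0 mulr0.
have := @le_opnorm1 _ _ A (normalized x).
rewrite normrZ normfV normr_id mulVf ?normr_eq0// => /(_ (lexx _)).
by rewrite bop_scale normrZ normfV normr_id mulrC ler_pdivrMr ?normr_gt0.
Qed.

Hypothesis sepH : separable H.
Variable T : {linear bop H -> bop H}.

Definition operator_form :=
    exists (c : R[i]) (f : {linear bop H -> R[i]^o}),
      [/\ c != 0, continuous f &
        (exists2 U : bop H, unitary_op U &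
          forall A : bop H,
            T A = c *: (U \o A \o adjoint U) + f A *: id :> (H -> H)) \/
        (exists U V : H -> H, antiunitary U V /\
          forall A : bop H,
            T A = c *: (U \o adjoint A \o V) + f A *: id :> (H -> H))].

(** The scalar in the standard form is recovered linearly and continuously from a
    single matrix coefficient of T A. *)
Lemma standard_operator_form (g : H) : '[g, g] = 1 -> continuous T ->
  standard_form T -> operator_form.
Proof.
move=> g1 cT [t [c [U [V [uU [c0 TE]]]]]].
have [_ lU UV VU Ui] := uU; pose h := V g.
have Uh : U h = g by rewrite /h VU.
have th A : '[U (twist t A h), U h] = '[A h, h].
  rewrite Ui; case: (t) => //=.
  by rewrite -adjointEr// -innerC.
pose f0 A : C^o := '[T A g, g] - c * '[A h, h].
have lf0 : linear f0.
  move=> a A B; rewrite /f0 linearP !bopE !innerDl !innerZl /=.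
  by rewrite -[a *: _]/(a * _); ring.
pose f : {linear bop H -> C^o} := HB.pack f0 (GRing.isLinear.Build _ _ _ _ f0 lf0).
have cf : continuous f.
  have [M M0 TM] : exists2 M : C, 0 < M & forall A, `|T A| <= M * `|A|.
    have /linear_bounded_continuous/linear_boundedP := cT.
    by move=> /pinfty_ex_gt0[M M0 TM]; exists M.
  have ng : `|g| = 1 by apply/inner1_norm.
  have nh : `|h| = 1 by rewrite (semiunitary_norm (semiunitary_inv uU)).
  have coeff B u : `|u| = 1 -> `|'[B u, u]| <= `|B|.
    move=> u1; rewrite (le_trans (cauchy_schwarz _ _))// u1 mulr1.
    by have := bop_norm_le B u; rewrite u1 mulr1.
  apply: (@bounded_linear_continuous_map _ _ _ _ (M + `|c|)) => [|A].
    by rewrite addr_ge0// ltW.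
  rewrite -[f A]/(f0 A) (le_trans (ler_normB _ _))// mulrDl lerD//.
    exact: le_trans (coeff _ _ ng) (TM A).
  by rewrite normrM ler_wpM2l// coeff.
have fE A k : T A = c *: sandwich uU (twist t A) + k *: I -> f A = k.
  have sg : '[sandwich uU (twist t A) g, g] = '[A h, h] by rewrite -th Uh.
  move=> TA; rewrite -[f A]/(f0 A) /f0 TA !bopE bop_idE innerDl !innerZl g1 mulr1 sg.
  by rewrite addrC addKr.
have TE' A : T A = c *: sandwich uU (twist t A) + f A *: I.
  by have [k TA] := TE A; rewrite (fE _ _ TA).
exists c, f; split=> //; clear TE fE th; case: t uU lU Ui TE' => /= uU lU Ui TE'.
- right; exists U, V; split.
    by split=> // x y; rewrite Ui -innerC.
  by move=> A; rewrite TE'.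
- have nU x : `|U x| <= 1 * `|x| by rewrite mul1r (semiunitary_norm uU).
  left; pose W : bop H := Bop (bounded_bop lU ler01 nU).
  have aW : adjoint W = V :> (H -> H).
    apply/funext => y; apply: inner_extr => x.
    by rewrite -adjointE// -{1}(VU y) /= Ui.
  exists W; first by rewrite /unitary_op aW; split; apply/funext => x /=.
  by move=> A; rewrite TE' aW.
Qed.

Lemma operator_form_standard : operator_form -> standard_form T.
Proof.
move=> [c [f [c0 _ [[U [VU UV] TE]|[U [V [[lU UV VU Ui] TE]]]]]]].
- have uU : semiunitary (scalar_twist false) U (adjoint U).
    split=> //=; first by left.
    + by move=> a x y; rewrite bop_add bop_scale.
    + by move=> x; exact: (congr1 (fun h => h x) VU).
    + by move=> x; exact: (congr1 (fun h => h x) UV).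
    + by move=> x y; rewrite adjointE// (congr1 (fun h => h y) VU : adjoint U (U y) = y).
  exists false, c, U, (adjoint U), uU; split=> // A; exists (f A).
  by apply: bopP => x; rewrite TE.
- have uU : semiunitary (scalar_twist true) U V.
    by split=> //=; [right|move=> x y; rewrite Ui innerC].
  exists true, c, U, V, uU; split=> // A; exists (f A).
  by apply: bopP => x; rewrite TE.
Qed.

End OperatorForm.

Theorem theorem7 (R : realType) (H : hilbertType R)
    (sepH : separable H) (dimH : dim_ge H 3)
    (T : {linear bop H -> bop H}) (cT : continuous T) (bT : bijective T) :
  [<->
    exists2 psi : conjugation H -> conjugation H,
      bijective psi /\ preserves_commutativity psi &
      forall C, T @` csymmetric_op C = csymmetric_op (psi C);
    exists2 phi : onbasis H -> onbasis H,
      bijective phi & forall e, T @` diagonal_op e = diagonal_op (phi e);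
    exists (c : R[i]) (f : {linear bop H -> R[i]^o}),
      [/\ c != 0, continuous f &
        (exists2 U : bop H, unitary_op U &
          forall A : bop H,
            T A = c *: (U \o A \o adjoint U) + f A *: id :> (H -> H)) \/
        (exists U V : H -> H, antiunitary U V /\
          forall A : bop H,
            T A = c *: (U \o adjoint A \o V) + f A *: id :> (H -> H))]].
Proof.
have dim3 := dim3_orthogonal dimH.
have [T0 TK TK'] := bT.
have lT0 : linear T0.
  by move=> a A B; apply: (can_inj TK); rewrite linearP !TK'.
pose T' : {linear bop H -> bop H} := HB.pack T0 (GRing.isLinear.Build _ _ _ _ T0 lT0).
have TK1 : cancel T T' by [].
have TK2 : cancel T' T by [].
clearbody T'.
have surT B : exists A, T A = B by exists (T' B).
have inv_image (X : Type) (D : X -> set (bop H)) p p' : cancel p' p ->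
    (forall x, T @` D x = D (p x)) -> forall x, T' @` D x = D (p' x).
  move=> pK TD x; rewrite -{1}(pK x) -TD eqEsubset; split=> [_ [_ [A DA <-] <-]|A DA].
    by rewrite TK1.
  by exists (T A) => //; exists A.
tfae.
- move=> [psi [bpsi cpsi] Tpsi].
  apply: standard_basis_preserver => //; have [psi' psiK psiK'] := bpsi.
  apply: (compatible_standard sepH dim3 TK1 TK2).
    exact: (conjugation_preserver_compatible sepH (can_inj TK1) bpsi cpsi).
  apply: (conjugation_preserver_compatible sepH (can_inj TK2) (psi := psi')).
  + by exists psi.
  + by move=> C1 C2; have := cpsi (psi' C1) (psi' C2); rewrite !psiK'; exact: iff_sym.
  + exact: inv_image.
- move=> [phi bphi Tphi]; have [phi' phiK phiK'] := bphi.
  have [e0 [e01 _ _]] := dim3 0 0.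
  apply: (standard_operator_form sepH e01 cT).
  apply: (compatible_standard sepH dim3 TK1 TK2).
    exact: (basis_preserver_compatible sepH (can_inj TK1) bphi).
  apply: (basis_preserver_compatible sepH (can_inj TK2) (phi := phi')).
    by exists phi.
  exact: inv_image.
- by move=> /operator_form_standard sT; apply: standard_conjugation_preserver => //; exact: sT.
Qed.
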